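(* Let $n$ be a positive integer with $\gcd(n,6)=1$, and suppose there exists a prime $p\equiv 2\pmod 3$ such that $\mathrm{ord}_p(n)$ is odd. Let $c_n=0$ if $n\equiv 1\pmod 3$, and let $c_n\in\{1,2\}$ (either choice) if $n\equiv 2\pmod 3$. Then \[ \sum_{\substack{r\in\mathbb{Z},\ |r|<\sqrt n,\\ r\equiv c_n\pmod 3}}H(n-r^2)=\frac{\sigma(n)}{12}, \] where $\sigma(n)=\sum_{d\mid n}d$.
   Context: $H(N)$ denotes the Hurwitz class number: for an integer $N\ge 0$, $H(0)=-1/12$; $H(N)=0$ if $N\equiv 1,2\pmod 4$; otherwise $H(N)$ is the number of $\mathrm{SL}_2(\mathbb{Z})$-equivalence classes of (not necessarily primitive) positive definite binary quadratic forms of discriminant $-N$, where classes containing a multiple of $x^2+y^2$ are counted with weight $1/2$ and classes containing a multiple of $x^2+xy+y^2$ are counted with weight $1/3$. $\mathrm{ord}_p(n)$ is the exponent of $p$ in the factorization of $n$. The sum runs over all integers $r$ (positive, negative and zero) satisfying the stated conditions. *)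

(* Defs.v *)
From HB Require Import structures.
From mathcomp Require Import all_boot all_order all_algebra.
From mathcomp Require Import boolp classical_sets fsbigop.
Set Implicit Arguments. Unset Strict Implicit. Unset Printing Implicit Defensive.
Import Order.TTheory GRing.Theory Num.Theory.
Local Open Scope ring_scope.
Local Open Scope classical_set_scope.

(* A binary quadratic form a x^2 + b x y + c y^2 with integer coefficients,
   encoded as the triple (a, b, c). *)
Definition bqf := (int * int * int)%type.

Definition bqf_a (f : bqf) : int := f.1.1.
Definition bqf_b (f : bqf) : int := f.1.2.
Definition bqf_c (f : bqf) : int := f.2.

Definition bqf_disc (f : bqf) : int := bqf_b f ^+ 2 - 4 * bqf_a f * bqf_c f.

Definition bqf_posdef (f : bqf) : Prop := 0 < bqf_a f /\ bqf_disc f < 0.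

(* Action of g = [[al, be], [ga, de]] in SL_2(Z):
   (f.g)(x, y) = f(al x + be y, ga x + de y). *)
Definition bqf_act (f : bqf) (al be ga de : int) : bqf :=
  let a := bqf_a f in let b := bqf_b f in let c := bqf_c f in
  (a * al ^+ 2 + b * al * ga + c * ga ^+ 2,
   2 * a * al * be + b * (al * de + be * ga) + 2 * c * ga * de,
   a * be ^+ 2 + b * be * de + c * de ^+ 2).

Definition bqf_equiv (f g : bqf) : Prop :=
  exists al be ga de : int, al * de - be * ga = 1 /\ g = bqf_act f al be ga de.

Definition bqf_class (f : bqf) : set bqf := [set g | bqf_equiv f g].

Definition hurwitz_classes (N : nat) : set (set bqf) :=
  [set C | exists f, bqf_posdef f /\ bqf_disc f = - (N%:Z) /\ C = bqf_class f].

Definition class_weight (C : set bqf) : rat :=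
  if `[< exists k : int, C (k, 0, k) >] then 1 / 2
  else if `[< exists k : int, C (k, k, k) >] then 1 / 3
  else 1.

Definition hurwitz (N : nat) : rat :=
  if N == 0%N then - (1 / 12)
  else if (N %% 4 == 1)%N || (N %% 4 == 2)%N then 0
  else \sum_(C \in hurwitz_classes N) class_weight C.

Definition sigma (n : nat) : nat := \sum_(d <- divisors n) d.

(* Main.v *)
(**
  Let e(x,y,z) = xy + yz + zx, and let w(x,y,z), for x, y, z >= 0, be the number
  of positive entries minus one.  Selling reduction shows that 6 H(N) is the sum
  of w over the triples x = y = z mod 2 with e(x,y,z) = N.

  A matrix of determinant n is [[r+z, -(y+z)], [x+z, r-z]] with n = r^2 + e, so
  sums of H(n - r^2) count matrices congruent to 1 mod 2.  They are grouped into
  cosets of the group generated by the reflections in the sides of the ideal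
  triangle 0, 1, oo; there are sigma(n) cosets (Hermite forms).  Each coset has
  either elliptic elements with fixed point in the triangle, of total weight 2, or
  an attracting cusp among the vertices (a Lefschetz-type fixed point count by
  ping-pong).  Comparing with the same count for the ideal hexagon that is a
  union of four triangles (matrices fixing a point of P^1(F_3)) eliminates the
  cusps and gives, for n = 2 mod 3, the sum of 6 H(n - r^2) over r prime to 3: it
  is sigma(n).

  For n = 1 mod 3 the class number is replaced by the number R(N) of
  representations of N by 3 a^2 + 4 (x^2 + xy + y^2).  The sum of R(n - r^2) over
  all r is counted by the elements of norm n in the maximal order
  Z[w] + Z[w] j of the quaternion algebra ramified at 3, which is Euclidean; it
  equals 2 sigma(n).  Comparing both formulas for n = N + 1 or N + 4 yields
  R(N) = 12 H(N) for all N = 1 mod 3 by induction.  Finally replacing a right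
  divisor q of norm p = 2 mod 3 by its conjugate exchanges, among elements of
  norm n, those with 3 | r and those with r prime to 3, up to multiples of p;
  since ord_p(n) is odd the two halves are equal.
*)
Require Import Defs.
From HB Require Import structures.
From mathcomp Require Import all_boot all_order all_algebra.
From mathcomp Require Import boolp.
From mathcomp Require Import zify ring lra.
Set Implicit Arguments. Unset Strict Implicit. Unset Printing Implicit Defensive.
Import Order.TTheory GRing.Theory Num.Theory.
Local Open Scope ring_scope.

(** * Reflection groups of ideal polygons *)

(** The matrices [act w M] form a tree whose edges are the reflections in the sides. An edge leaves
    [M] across a side if [M] attracts beyond that side. Since the arcs beyond the sides are
    disjoint, at most one edge leaves each vertex; so the flow ends at sinks, and sinks are joined
    by undirected edges. The condition [attracting] also makes sense without real fixed points, so
    that elliptic and other matrices are treated by one flow. The absolute value of the determinant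
    must not be a square: two rational eigenvalues then differ in absolute value, and a sink is
    elliptic, of trace zero, or has a vertex as attracting point. A matrix of trace 2r and
    determinant n has characteristic polynomial t^2 - 2rt + n. For n = 2 mod 3 it has two fixed
    points on P^1(F_3) if 3 divides r and none otherwise, which is how the hexagon isolates the r
    prime to 3. For n = 1 mod 3 it has none if 3 divides r and one or four otherwise, so the same
    comparison mixes both classes; the quaternion order serves to separate them. *)

Definition mat := (int * int * int * int)%type.
Definition mmul (M N : mat) : mat :=
  let: (a, b, c, d) := M in let: (x, y, z, t) := N in
  (a * x + b * z, a * y + b * t, c * x + d * z, c * y + d * t).
Definition madj (M : mat) : mat := let: (a, b, c, d) := M in (d, - b, - c, a).
Definition mdet (M : mat) : int := let: (a, b, c, d) := M in a * d - b * c.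
Definition mopp (M : mat) : mat := let: (a, b, c, d) := M in (- a, - b, - c, - d).
Definition m1 : mat := (1, 0, 0, 1).
Definition vec := (int * int)%type.
Definition mapp (M : mat) (v : vec) : vec :=
  let: (a, b, c, d) := M in (a * v.1 + b * v.2, c * v.1 + d * v.2).

(* The attracting fixed point of M on P^1(R), when there is one, lies in the open
   positive quadrant; this is a linear condition on the entries. *)
Definition attracting (M : mat) : bool :=
  let: (a, b, c, d) := M in
  [&& (0 <= c) && (0 <= b) ==> (0 < a + d), (c <= 0) && (b <= 0) ==> (a + d < 0),
      (0 <= c) && (b <= 0) ==> (d < a) & (c <= 0) && (0 <= b) ==> (a < d)].
(** Acts on P^1(R) as the reflection in the geodesic from 0 to oo. In the basis given by the columns
    of [h], the matrix [M] becomes [cj h M] and the reflection in the side [h] becomes [Rm]. *)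
Definition Rm : mat := (1, 0, 0, -1).
Definition cj (h M : mat) := mmul (madj h) (mmul M h).
Definition refl (h : mat) := mmul h (mmul Rm (madj h)).

(* Sides of the ideal triangle and of the ideal hexagon: the columns of each matrix
   are two consecutive vertices. *)
Definition P3 : seq mat := [:: (1, 1, 0, 1); (1, 0, 1, 1); (0, -1, 1, 0)].
Definition P6 : seq mat := [:: (1, 2, 0, 1); (2, 1, 1, 1); (1, 1, 1, 2); (1, 0, 2, 1); (0, -1, 1, 1); (-1, -1, 1, 0)].

Lemma in_P3 (Q : mat -> Prop) : Q (1,1,0,1) -> Q (1,0,1,1) -> Q (0,-1,1,0) -> forall h, h \in P3 -> Q h.
Proof. by move=> A B C h; rewrite !inE => /or3P[] /eqP->. Qed.
Lemma in_P6 (Q : mat -> Prop) : Q (1,2,0,1) -> Q (2,1,1,1) -> Q (1,1,1,2) -> Q (1,0,2,1) -> Q (0,-1,1,1) -> Q (-1,-1,1,0) -> forall h, h \in P6 -> Q h.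
Proof. move=> A B C D E F h; rewrite !inE; by do ![case/orP]; move/eqP->. Qed.

(** At a vertex with an outgoing edge all other edges are incoming: the reflection in [h'] has its
    attracting arc beyond [h']. Both conditions are linear in the entries, so each pair of sides is
    a problem of linear arithmetic. *)
Lemma attracting_nest3 h h' M : h \in P3 -> h' \in P3 -> h != h' -> attracting (cj h M) -> attracting (mmul Rm (cj h' M)).
Proof.
move=> hP h'P; move: h hP h' h'P; case: M=> [[[a b] c] d].
apply: in_P3; apply: in_P3 => // _; rewrite /attracting /cj /=; lia.
Qed.
Lemma attracting_nest6 h h' M : h \in P6 -> h' \in P6 -> h != h' -> attracting (cj h M) -> attracting (mmul Rm (cj h' M)).
Proof.
move=> hP h'P; move: h hP h' h'P; case: M=> [[[a b] c] d].
apply: in_P6; apply: in_P6 => // _; rewrite /attracting /cj /=; lia.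
Qed.

Lemma mmulA A B C : mmul A (mmul B C) = mmul (mmul A B) C.
Proof.
case: A => [[[? ?] ?] ?]; case: B => [[[? ?] ?] ?]; case: C => [[[? ?] ?] ?] /=.
by congr (_, _, _, _); ring.
Qed.
Lemma mmul1m A : mmul m1 A = A.
Proof. by case: A => [[[? ?] ?] ?] /=; congr (_, _, _, _); ring. Qed.
Lemma mmulm1 A : mmul A m1 = A.
Proof. by case: A => [[[? ?] ?] ?] /=; congr (_, _, _, _); ring. Qed.
Lemma mdetM A B : mdet (mmul A B) = mdet A * mdet B.
Proof. by case: A => [[[? ?] ?] ?]; case: B => [[[? ?] ?] ?] /=; ring. Qed.
Lemma mapp_mul A B v : mapp (mmul A B) v = mapp A (mapp B v).
Proof.
by case: A => [[[? ?] ?] ?]; case: B => [[[? ?] ?] ?]; case: v => ? ? /=; congr (_, _); ring.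
Qed.
Lemma mapp1 v : mapp m1 v = v.
Proof. by case: v => ? ? /=; congr (_, _); ring. Qed.
Lemma madj_mul h : mdet h = 1 -> mmul (madj h) h = m1.
Proof.
by case: h => [[[? ?] ?] ?] /= E; rewrite /m1; congr (_, _, _, _); rewrite -?E; ring.
Qed.
Lemma mmul_adj h : mdet h = 1 -> mmul h (madj h) = m1.
Proof.
by case: h => [[[? ?] ?] ?] /= E; rewrite /m1; congr (_, _, _, _); rewrite -?E; ring.
Qed.
Lemma mmulK g M : mdet M != 0 -> mmul g M = M -> g = m1.
Proof.
case: g => [[[x y] z] t]; case: M => [[[a b] c] d] /= D [E1 E2 E3 E4].
have U u w : u * (a * d - b * c) = w * (a * d - b * c) -> u = w by apply: mulIf.
rewrite /m1; congr (_, _, _, _); apply: U.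
- rewrite mul1r; transitivity ((x * a + y * c) * d - (x * b + y * d) * c); [ring|by rewrite E1 E2].
- rewrite mul0r; transitivity ((x * b + y * d) * a - (x * a + y * c) * b); [ring|by rewrite E1 E2; ring].
- rewrite mul0r; transitivity ((z * a + t * c) * d - (z * b + t * d) * c); [ring|by rewrite E3 E4; ring].
- rewrite mul1r; transitivity ((z * b + t * d) * a - (z * a + t * c) * b); [ring|by rewrite E3 E4; ring].
Qed.
Lemma cj_refl h M : mdet h = 1 -> cj h (mmul (refl h) M) = mmul Rm (cj h M).
Proof.
move=> D; rewrite /cj /refl !mmulA madj_mul // mmul1m.
Qed.
Lemma RmK M : mmul Rm (mmul Rm M) = M.
Proof. by case: M => [[[? ?] ?] ?] /=; congr (_, _, _, _); ring. Qed.
Lemma reflK h M : mdet h = 1 -> mmul (refl h) (mmul (refl h) M) = M.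
Proof.
move=> D; rewrite /refl !mmulA -(mmulA _ (madj h) h) madj_mul // mmulm1.
by rewrite -!mmulA RmK mmulA mmul_adj // mmul1m.
Qed.
Lemma mdet_adj h : mdet (madj h) = mdet h.
Proof. by case: h => [[[? ?] ?] ?] /=; ring. Qed.
Lemma mdet_refl h : mdet h = 1 -> mdet (refl h) = -1.
Proof.
by move=> D; rewrite /refl !mdetM mdet_adj D.
Qed.
Lemma attracting_flip M : attracting M -> ~~ attracting (mmul Rm M).
Proof. by case: M => [[[a b] c] d] /=; lia. Qed.

(** * The flow on the tree of a coset *)

Definition posv (u : vec) := ((0 < u.1) && (0 < u.2)) || ((u.1 < 0) && (u.2 < 0)).
Definition negv (u : vec) := ((0 < u.1) && (u.2 < 0)) || ((u.1 < 0) && (0 < u.2)).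
(** The form with root e^(i pi/3), the centre of the ideal triangle; it is invariant under the
    symmetries of the triangle. The size [msize] sums it over the images of the three vertices. *)
Definition qp (u : vec) : int := u.1 ^+ 2 - u.1 * u.2 + u.2 ^+ 2.
Definition msize (M : mat) : int := qp (mapp M (1, 0)) + qp (mapp M (1, 1)) + qp (mapp M (0, 1)).

Section Poly.
Variable P : seq mat.
Hypothesis det1 : forall h, h \in P -> mdet h = 1.
Hypothesis nest : forall h h' M, h \in P -> h' \in P -> h != h' ->
  attracting (cj h M) -> attracting (mmul Rm (cj h' M)).
Hypothesis ping : forall h h' u, h \in P -> h' \in P -> h != h' ->
  posv (mapp (madj h) u) -> negv (mapp (madj h') u).
Hypothesis qinc : forall h u, h \in P -> negv (mapp (madj h) u) ->
  qp u < qp (mapp (refl h) u).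
Hypothesis Sbd : exists B : int -> int, forall M h, h \in P -> mdet M != 0 -> attracting (cj h M) ->
  msize (mmul (refl h) M) <= Num.max (msize M) (B `|mdet M|).
Hypothesis Sfin : forall B, exists l : seq mat, forall M, msize M <= B -> M \in l.

(** The leftmost letter acts first, so [w] is a path in the tree that starts at [M]. *)
Definition act (w : seq mat) (M : mat) := foldl (fun N h => mmul (refl h) N) M w.
Arguments act : simpl never.
Definition inw (w : seq mat) := all (mem P) w.
Definition reduced (w : seq mat) := sorted (fun h h' : mat => h != h') w.
Definition sink (M : mat) := all (fun h => ~~ attracting (cj h M)) P.
(** The edge between [M] and [mmul (refl h) M] is directed neither way. *)
Definition neutral h M := ~~ attracting (cj h M) && ~~ attracting (mmul Rm (cj h M)).

Lemma act_cons h w M : act (h :: w) M = act w (mmul (refl h) M).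
Proof. by []. Qed.
Lemma act_mul w M : act w M = mmul (act w m1) M.
Proof.
elim: w M => [|h w IH] M; first by rewrite [RHS]mmul1m.
by rewrite !act_cons IH [in RHS]IH mmulm1 mmulA.
Qed.

Lemma reduceP w : inw w -> exists2 w', inw w' /\ reduced w' & forall M, act w' M = act w M.
Proof.
elim: w => [|h w IH] /=; first by exists [::].
case/andP=> hP /IH[[|h' w'] [w'P rw'] E].
  by exists [:: h] => [|M]; [rewrite /inw /= hP|rewrite !act_cons E].
have [hh'|hh'] := eqVneq h h'; last first.
  exists [:: h, h' & w'] => [|M]; last by rewrite !act_cons -E.
  by rewrite /inw /= hP; split=> //; rewrite /reduced /= hh'.
exists w'; first by case/andP: w'P => _ ?; split=> //; apply: path_sorted rw'.
by move=> M; rewrite act_cons -E act_cons -hh' reflK //; apply: det1.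
Qed.

(** By [nest] a path that avoids the outgoing edge always walks against the flow, so its last vertex
    still has an outgoing edge, back along the path. *)
Lemma flow_last h w N : h \in P -> inw w -> path (fun x y => x != y) h w -> attracting (cj h N) ->
  ~~ sink (act w N).
Proof.
elim: w h N => [|h' w IH] h N hP /=.
  by move=> _ _ a; apply/allPn; exists h => //; rewrite negbK.
case/andP=> h'P wP /andP[hh' pw] a; apply: (IH h') => //.
by rewrite cj_refl ?det1 //; apply: nest a.
Qed.

(** Sinks span a subtree with neutral edges: if the first edge of a reduced path between two sinks
    were directed towards the start, [flow_last] would give the end an outgoing edge. *)
Lemma sink_step h w M : inw (h :: w) -> reduced (h :: w) -> sink M -> sink (act (h :: w) M) ->
  neutral h M /\ sink (mmul (refl h) M).
Proof.
move=> /= /andP[hP wP] rw sM sA.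
have nh : ~~ attracting (cj h M) by move/allP: sM; apply.
have D := det1 hP.
have nRh : ~~ attracting (mmul Rm (cj h M)).
  by apply: contraL sA => a; apply: (@flow_last h w (mmul (refl h) M)) => //; rewrite cj_refl.
split; first by rewrite /neutral nh.
apply/allP=> j jP /=; have [<-|jh] := eqVneq h j; first by rewrite cj_refl.
have jh' : j != h by rewrite eq_sym.
by apply: contra nh => a; move: (nest jP hP jh' a); rewrite cj_refl // RmK.
Qed.

(** Ping-pong on vectors: a vector on the polygon's side of [h] is sent beyond [h], hence to the
    polygon's side of the next, different letter, and every reflection on the way increases [qp]. *)
Lemma ping_act h w u : inw (h :: w) -> reduced (h :: w) -> negv (mapp (madj h) u) ->
  qp u < qp (mapp (act (h :: w) m1) u).
Proof.
elim: w h u => [|h' w IH] h u /= /andP[hP wP].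
  by move=> _ n; rewrite /act /= mmulm1; exact: qinc.
case/andP=> hh' rw n.
have D := det1 hP.
have E : act [:: h, h' & w] m1 = mmul (act (h' :: w) m1) (refl h).
  by rewrite act_cons mmulm1 act_mul.
rewrite E mapp_mul; apply: lt_trans (qinc hP n) _.
apply: IH => //; apply: (ping hP) => //.
  by move: wP => /= /andP[].
rewrite -mapp_mul /refl !mmulA madj_mul // mmul1m mapp_mul.
by move: n; case: (mapp _ _) => x y; rewrite /negv /posv /=; lia.
Qed.

(** The reflections generate a free product of groups of order 2, so the graph of a coset is a tree.
    The vector [h (1, -1)] lies on the polygon's side of [h] and starts the ping-pong. *)
Lemma act_id h w M : mdet M != 0 -> inw (h :: w) -> reduced (h :: w) -> act (h :: w) M <> M.
Proof.
move=> DM wP rw; rewrite act_mul => /mmulK-/(_ DM) E.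
have hP : h \in P by case/andP: wP.
have := @ping_act h w (mapp h (1, -1)) wP rw.
by rewrite E -mapp_mul madj_mul ?det1 // mapp1 => /(_ isT); rewrite mapp1 ltxx.
Qed.

Lemma mdet_act w M : inw w -> `|mdet (act w M)| = `|mdet M|.
Proof.
elim: w M => [|h w IH] M //= /andP[hP wP].
by rewrite act_cons IH // mdetM (mdet_refl (det1 hP)) mulN1r normrN.
Qed.

(** An endless walk along the flow stays among matrices of bounded size, hence revisits one of them.
    The walk never backtracks, so this would be a reduced word fixing a matrix, against [act_id]. *)
Lemma exists_sink M : mdet M != 0 -> exists2 w, inw w & sink (act w M).
Proof.
move=> DM; apply: contrapT => NS.
have ns w : inw w -> ~~ sink (act w M) by move=> wP; apply/negP => s; apply: NS; exists w.
pose L N := nth m1 P (find (fun h => attracting (cj h N)) P).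
pose st N := mmul (refl (L N)) N.
have LP N : ~~ sink N -> L N \in P /\ attracting (cj (L N) N).
  rewrite -has_predC => s; have s' : has (fun h => attracting (cj h N)) P.
    by apply: sub_has s => h /=; rewrite negbK.
  by split; [apply: mem_nth; rewrite -has_find|apply: (nth_find m1 s')].
pose wd k N := map L (traject st N k).
have actwd k N : act (wd k N) N = iter k st N.
  by elim: k N => // k IH N; rewrite iterSr -IH.
have wdP k N : (forall w, inw w -> ~~ sink (act w N)) -> inw (wd k N) /\ reduced (wd k N).
  elim: k N => // k IH N sN; have [LNP aN] := LP N (sN [::] isT).
  have sN' w : inw w -> ~~ sink (act w (st N)).
    by move=> wP; apply: (sN (L N :: w)); rewrite /inw /= LNP.
  have [i r] := IH _ sN'; split; first by rewrite /= LNP.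
  case: k i r {IH} => //= k i r; rewrite r andbT.
  have [LsP asN] := LP _ (sN' [::] isT).
  (* No backtracking: just after crossing a side the flow cannot cross it again. *)
  apply: contraTneq asN => <-; rewrite /st cj_refl ?det1 //.
  exact: attracting_flip.
have [B BP] := Sbd.
have itS k : msize (iter k st M) <= Num.max (msize M) (B `|mdet M|) /\ `|mdet (iter k st M)| = `|mdet M|.
  have [_ D] : True /\ `|mdet (iter k st M)| = `|mdet M|.
    by split=> //; rewrite -actwd mdet_act //; case: (wdP k M ns).
  split=> //; elim: k {D} => [|k IH]; first by rewrite le_max lexx.
  have [i _] := wdP k M ns.
  have [LsP asN] := LP (iter k st M) ltac:(rewrite -actwd; exact: ns).
  rewrite iterS; apply: le_trans (BP _ _ LsP _ asN) _; first by rewrite -actwd -normr_eq0 mdet_act ?normr_eq0 ?(wdP k M ns).1.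
  by rewrite -actwd mdet_act // actwd ge_max IH le_max lexx orbT.
have [l lP] := Sfin (Num.max (msize M) (B `|mdet M|)).
have sub : {subset traject st M (size l).+1 <= l}.
  by move=> N /trajectP[i _ ->]; apply: lP; case: (itS i).
have nu : ~~ uniq (traject st M (size l).+1).
  by apply/negP => /uniq_leq_size/(_ sub); rewrite size_traject ltnn.
case/(uniqPn M): nu => i [j [ij]]; rewrite size_traject => jl.
rewrite !nth_traject //; last exact: ltn_trans jl.
move=> E; pose N := iter i st M.
have EN : N = act (wd (j - i)%N N) N by rewrite actwd -iterD subnK // ltnW.
have [i1 r1] : inw (wd (j - i)%N N) /\ reduced (wd (j - i)%N N).
  apply: (wdP _ N) => w wP; rewrite /N -actwd.
  have -> : act w (act (wd i M) M) = act (wd i M ++ w) M by rewrite /act foldl_cat.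
  by apply: (ns _); rewrite /inw all_cat; case: (wdP i M ns); rewrite /inw => -> _.
have DN : mdet N != 0 by rewrite -normr_eq0 (itS i).2 normr_eq0.
move: i1 r1 EN; rewrite -subn_gt0 in ij; case: (j - i)%N ij => // k _ i1 r1 /esym.
exact: act_id.
Qed.
End Poly.

(** * Descent of the size *)

(** Up to a factor, the drop of [msize] under the reflection in [h], in terms of [cj h M]. The
    numbers X, -Y, Z are the entries of the sum of v v^T over the three vertices v in [V3], written
    in the basis [h]: (2, 1, 2) for the sides of the triangle, (6, 3, 2) and (2, 3, 6) for those of
    the hexagon. *)
Definition excess (X Y Z : int) (M : mat) : int :=
  let: (a, b, c, d) := M in X * (a * c) + Z * (b * d) - Y * (a * d + b * c).

Lemma msizeE a b c d : msize (a, b, c, d) = a ^+ 2 - a * c + c ^+ 2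
  + ((a + b) ^+ 2 - (a + b) * (c + d) + (c + d) ^+ 2) + (b ^+ 2 - b * d + d ^+ 2).
Proof. by rewrite /msize /qp /=; ring. Qed.
Lemma msize_P3 h M : h \in P3 ->
  msize M - msize (mmul (refl h) M) = 2 * excess 2 1 2 (cj h M).
Proof.
move: h; case: M => [[[a b] c] d].
by apply: in_P3; rewrite /excess /cj /refl /madj /Rm /mmul !msizeE; ring.
Qed.
Lemma msize_P6 h M : h \in P6 ->
  msize M - msize (mmul (refl h) M) = 6 * excess 6 3 2 (cj h M) \/
  msize M - msize (mmul (refl h) M) = 6 * excess 2 3 6 (cj h M).
Proof.
move: h; case: M => [[[a b] c] d].
apply: in_P6; rewrite /excess /cj /refl /madj /Rm /mmul !msizeE;
 ((by left; ring) || (by right; ring)).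
Qed.
Lemma qincP3 h u : h \in P3 -> negv (mapp (madj h) u) -> qp u < qp (mapp (refl h) u).
Proof.
move: h; case: u => x y; apply: in_P3; rewrite /negv /qp /refl /madj /Rm /mmul /mapp /=; nia.
Qed.
Lemma qincP6 h u : h \in P6 -> negv (mapp (madj h) u) -> qp u < qp (mapp (refl h) u).
Proof.
move: h; case: u => x y; apply: in_P6; rewrite /negv /qp /refl /madj /Rm /mmul /mapp /=; nia.
Qed.
Lemma pingP3 h h' u : h \in P3 -> h' \in P3 -> h != h' -> posv (mapp (madj h) u) -> negv (mapp (madj h') u).
Proof.
move=> hP h'P; move: h hP h' h'P; case: u => x y.
apply: in_P3; apply: in_P3 => // _; rewrite /posv /negv /=; lia.
Qed.
Lemma pingP6 h h' u : h \in P6 -> h' \in P6 -> h != h' -> posv (mapp (madj h) u) -> negv (mapp (madj h') u).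
Proof.
move=> hP h'P; move: h hP h' h'P; case: u => x y.
apply: in_P6; apply: in_P6 => // _; rewrite /posv /negv /=; lia.
Qed.

Definition mnorm (M : mat) : int := let: (a, b, c, d) := M in `|a| + `|b| + `|c| + `|d|.

Lemma mnorm_mul A B : mnorm (mmul A B) <= mnorm A * mnorm B.
Proof.
case: A => [[[a b] c] d]; case: B => [[[x y] z] t] /=.
have E u v w s : `|u * v + w * s| <= `|u| * `|v| + `|w| * `|s| :> int.
  by rewrite -!normrM ler_normD.
apply: le_trans (lerD (lerD (lerD (E _ _ _ _) (E _ _ _ _)) (E _ _ _ _)) (E _ _ _ _)) _.
have N (u : int) : 0 <= `|u| by [].
move: (N a) (N b) (N c) (N d) (N x) (N y) (N z) (N t).
move: `|a| `|b| `|c| `|d| `|x| `|y| `|z| `|t| => {}a {}b {}c {}d {}x {}y {}z {}t.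
move=> a0 b0 c0 d0 x0 y0 z0 t0.
have N0 (u v : int) : 0 <= u -> 0 <= v -> 0 <= u * v by apply: mulr_ge0.
have := (N0 _ _ a0 z0, N0 _ _ a0 t0, N0 _ _ b0 x0, N0 _ _ b0 y0).
have := (N0 _ _ c0 z0, N0 _ _ c0 t0, N0 _ _ d0 x0, N0 _ _ d0 y0).
move=> [[[? ?] ?] ?] [[[? ?] ?] ?]; lra.
Qed.
Lemma mnorm_ge0 M : 0 <= mnorm M.
Proof. by case: M => [[[a b] c] d] /=; lia. Qed.

Lemma msize_le M : msize M <= 3 * mnorm M ^+ 2.
Proof.
case: M => [[[a b] c] d]; rewrite msizeE /mnorm.
have E (x y s : int) : `|x| + `|y| <= s -> x ^+ 2 - x * y + y ^+ 2 <= s ^+ 2.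
  move=> le; apply: (@le_trans _ _ ((`|x| + `|y|) ^+ 2)); last first.
    by rewrite lerXn2r ?nnegrE // ?(le_trans _ le) ?addr_ge0.
  have H : - (x * y) <= `|x| * `|y| by rewrite -normrM -normrN ler_norm.
  have H0 : 0 <= `|x| * `|y| by rewrite mulr_ge0.
  rewrite sqrrD !real_normK ?num_real //; lra.
set s := `|a| + _ + _ + _.
have H1 := E a c s ltac:(rewrite /s; clear; lia).
have H2 := E (a + b) (c + d) s ltac:(rewrite /s; clear; lia).
have H3 := E b d s ltac:(rewrite /s; clear; lia).
lra.
Qed.

Lemma le_of_mul_le (x y K : int) : y != 0 -> `|x * y| <= K -> `|x| <= K.
Proof.
move=> y0; rewrite normrM => le; apply: le_trans le.
by rewrite ler_peMr //; lia.
Qed.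

(** A step along the flow that does not lower the size starts at a matrix bounded by its
    determinant. If ad and bc have opposite signs, |ad| + |bc| = |ad - bc|. If they have the same
    sign, then ac and bd are positive because [M] is attracting, and XZ > Y^2 bounds them. In the
    end every entry is at most 3 |det|, which gives 12. *)
Lemma excess_bound (X Y Z : int) M : (X, Y, Z) \in [:: (2, 1, 2); (6, 3, 2); (2, 3, 6)] ->
  attracting M -> mdet M != 0 -> excess X Y Z M <= 0 -> mnorm M <= 12 * `|mdet M|.
Proof.
case: M => [[[a b] c] d] XYZ A.
rewrite /mnorm /excess /mdet => D0 F.
have bd (x y K : int) : y != 0 -> `|x * y| <= K -> `|x| <= K by apply: le_of_mul_le.
have bd' (x y K : int) : x != 0 -> `|x * y| <= K -> `|y| <= K by rewrite mulrC; apply: le_of_mul_le.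
have pos (u s : int) : 0 < u -> (2 * u <= s \/ 2 * u <= 3 * s \/ 6 * u <= 3 * s) -> `|u| <= 3 * `|s| by lia.
have XYZ3 : [\/ [/\ X = 2, Y = 1 & Z = 2], [/\ X = 6, Y = 3 & Z = 2] | [/\ X = 2, Y = 3 & Z = 6]].
  by move: XYZ; rewrite !inE => /or3P[]/eqP[-> -> ->]; [constructor 1|constructor 2|constructor 3].
have [c0|c0] := eqVneq c 0.
  move: D0 F A; rewrite c0 mulr0 subr0 mulr0 addr0 mulr0 add0r mulf_eq0 negb_or => /andP[a0 d0] F A.
  have sg : (0 < b) && (0 < d) || (b < 0) && (d < 0) by move: A; rewrite /attracting; lia.
  have bd0 : 0 < b * d by case/orP: sg => /andP[? ?]; [apply: mulr_gt0|rewrite nmulr_rgt0].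
  have B : `|b * d| <= 3 * `|a * d|.
    by apply: pos => //; case: XYZ3 F => -[EX EY EZ]; rewrite ?EX ?EY ?EZ; lia.
  have [[H1 H2] H3] := (bd _ _ _ d0 B, bd a d _ d0 (lexx _), bd' a d _ a0 (lexx _)); move: H1 H2 H3; move: `|a * d| => K; lia.
have [b0|b0] := eqVneq b 0.
  move: D0 F A; rewrite b0 mul0r mul0r !mulr0 subr0 !addr0 mulf_eq0 negb_or => /andP[a0 d0] F A.
  have sg : (0 < c) && (0 < a) || (c < 0) && (a < 0) by move: A; rewrite /attracting; lia.
  have bd0 : 0 < a * c by case/orP: sg => /andP[? ?]; [apply: mulr_gt0|rewrite nmulr_rgt0].
  have B : `|a * c| <= 3 * `|a * d|.
    by apply: pos => //; case: XYZ3 F => -[EX EY EZ]; rewrite ?EX ?EY ?EZ; lia.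
  have [[H1 H2] H3] := (bd' _ _ _ a0 B, bd a d _ d0 (lexx _), bd' a d _ a0 (lexx _)); move: H1 H2 H3; move: `|a * d| => K; lia.
have [a0|a0] := eqVneq a 0.
  move: D0 F A; rewrite a0 !mul0r mulr0 sub0r !add0r normrN => D0 F A.
  have sg : (0 < b) && (0 < d) || (b < 0) && (d < 0) \/ d = 0 by move: A; rewrite /attracting; lia.
  have B : `|b * d| <= 3 * `|b * c|.
    case: sg => [sg|->]; last by rewrite mulr0; lia.
    have bd0 : 0 < b * d by case/orP: sg => /andP[? ?]; [apply: mulr_gt0|rewrite nmulr_rgt0].
    by apply: pos => //; case: XYZ3 F => -[EX EY EZ]; rewrite ?EX ?EY ?EZ; lia.
  have [[H1 H2] H3] := (bd' _ _ _ b0 B, bd b c _ c0 (lexx _), bd' b c _ b0 (lexx _)); move: H1 H2 H3; move: `|b * c| => K; lia.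
have [d0|d0] := eqVneq d 0.
  move: D0 F A; rewrite d0 !mulr0 sub0r !add0r addr0 normrN => D0 F A.
  have sg : (0 < a) && (0 < c) || (a < 0) && (c < 0) by move: A; rewrite /attracting; lia.
  have B : `|a * c| <= 3 * `|b * c|.
    have bd0 : 0 < a * c by case/orP: sg => /andP[? ?]; [apply: mulr_gt0|rewrite nmulr_rgt0].
    by apply: pos => //; case: XYZ3 F => -[EX EY EZ]; rewrite ?EX ?EY ?EZ; lia.
  have [[H1 H2] H3] := (bd _ _ _ c0 B, bd b c _ c0 (lexx _), bd' b c _ b0 (lexx _)); move: H1 H2 H3; move: `|b * c| => K; lia.
have fin K : `|a * d| <= K -> `|b * c| <= K -> `|a| + `|b| + `|c| + `|d| <= 4 * K.
  move=> K1 K2; have [[[? ?] ?] ?] := (bd _ _ _ d0 K1, bd' _ _ _ a0 K1, bd _ _ _ c0 K2, bd' _ _ _ b0 K2); lia.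
have nn : 0 <= `|a * d - b * c| by [].
have [op|same] := boolP ((0 < a * d) (+) (0 < b * c)).
  have ad0 : a * d != 0 by rewrite mulf_neq0.
  have bc0 : b * c != 0 by rewrite mulf_neq0.
  have := fin `|a * d - b * c|; move: op ad0 bc0 nn; move: (a * d) (b * c); lia.
have sgM (x y : int) : x != 0 -> y != 0 -> (0 < x * y) = ((0 < x) == (0 < y)).
  move=> x0 y0; have [x1|x1] : 0 < x \/ x < 0 by lia.
    by rewrite pmulr_rgt0 //; lia.
  by rewrite nmulr_rgt0 //; lia.
have [u0 v0] : 0 < a * c /\ 0 < b * d.
  by move: A same; rewrite !sgM // /attracting; lia.
(* Squaring Xu + Zv <= Y (ad + bc) with u = ac and v = bd and inserting this identity bounds a
   quadratic form in u, v by Y^2 det^2; it is positive definite because Y^2 < XZ. *)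
have sq : (a * d + b * c) ^+ 2 = (a * d - b * c) ^+ 2 + 4 * (a * c) * (b * d) by ring.
have {}D0 : 0 < `|a * d - b * c| by rewrite normr_gt0.
have sq' : (a * d - b * c) ^+ 2 = `|a * d - b * c| ^+ 2 by rewrite real_normK ?num_real.
have [uK vK] : a * c <= 3 * `|a * d - b * c| /\ b * d <= 3 * `|a * d - b * c|.
  move: sq F; rewrite sq'; move: D0 u0 v0; clear - XYZ3.
  move: `|_| (a * c) (b * d) (a * d + b * c) => D u v s D0 u0 v0 sq F.
  have H : (X * u + Z * v) ^+ 2 <= Y ^+ 2 * (D ^+ 2 + 4 * u * v).
    rewrite -sq -exprMn lerXn2r ?nnegrE //; case: XYZ3 F => -[-> -> ->] F; lia.
  have {}H : X ^+ 2 * u ^+ 2 + (2 * X * Z - 4 * Y ^+ 2) * (u * v) + Z ^+ 2 * v ^+ 2 <= Y ^+ 2 * D ^+ 2.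
    by rewrite -subr_ge0; move: H; rewrite -subr_ge0; congr (_ <= _); ring.
  have sg x y : 0 <= x ^+ 2 * u ^+ 2 - 2 * x * y * (u * v) + y ^+ 2 * v ^+ 2.
    by have := sqr_ge0 (x * u - y * v); congr (_ <= _); ring.
  (* For instance 36 u^2 - 12 uv + 4 v^2 is both (3u - 2v)^2 + 27 u^2 and (6u - v)^2 + 3 v^2. *)
  have [[[s1 s2] s3] s4] := (sg 6 1, sg 3 2, sg 1 6, sg 2 3).
  have uv0 : 0 < u * v by apply: mulr_gt0.
  have uu0 : 0 <= u ^+ 2 by apply: sqr_ge0.
  have vv0 : 0 <= v ^+ 2 by apply: sqr_ge0.
  have lt2 x : 3 * D < x -> 9 * D ^+ 2 < x ^+ 2 by nra.
  split; rewrite leNgt; apply/negP => /lt2; move: H s1 s2 s3 s4 uv0 uu0 vv0; move: (u ^+ 2) (u * v) (v ^+ 2) (D ^+ 2); clear -XYZ3;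
  by case: XYZ3 => -[-> -> ->]; lia.
have nu (x : int) K : 0 < x -> x <= K -> `|x| <= K by clear; lia.
have [[[]]] := (bd _ _ _ c0 (nu _ _ u0 uK), bd' _ _ _ a0 (nu _ _ u0 uK), bd _ _ _ d0 (nu _ _ v0 vK), bd' _ _ _ b0 (nu _ _ v0 vK)).
move: `|a * d - b * c| => K; clear; lia.
Qed.

Definition irange (B : nat) : seq int := [seq i%:Z - B%:Z | i <- iota 0 (2 * B).+1].
Lemma mem_irange B (x : int) : (x \in irange B) = (`|x| <= B%:Z).
Proof.
apply/mapP/idP => [[i]|le]; first by rewrite mem_iota; lia.
by exists (absz (x + B%:Z)); rewrite ?mem_iota; lia.
Qed.

Definition box (B : nat) : seq mat :=
  [seq (p, d) | p <- [seq (q, c) | q <- [seq (a, b) | a <- irange B, b <- irange B], c <- irange B], d <- irange B].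
Lemma mem_box B a b c d : (a, b, c, d) \in box B = [&& `|a| <= B%:Z, `|b| <= B%:Z, `|c| <= B%:Z & `|d| <= B%:Z].
Proof.
have M (S T : eqType) (s : seq S) (t : seq T) x y : ((x, y) \in [seq (x, y) | x <- s, y <- t]) = (x \in s) && (y \in t).
  by apply/allpairsP/andP => [[[u v] [/= us vt [-> ->]]]|[xs yt]]; last exists (x, y).
by rewrite /box !M !mem_irange !andbA.
Qed.

Lemma msize_fin (B : int) : exists l : seq mat, forall M, msize M <= B -> M \in l.
Proof.
exists (box (absz (2 * B))) => -[[[a b] c] d]; rewrite msizeE mem_box => le.
have q (x y : int) : x ^+ 2 <= 2 * (x ^+ 2 - x * y + y ^+ 2) /\ y ^+ 2 <= 2 * (x ^+ 2 - x * y + y ^+ 2) /\ 0 <= x ^+ 2 - x * y + y ^+ 2.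
  have [[]] := (sqr_ge0 (x - y), sqr_ge0 x, sqr_ge0 y); rewrite sqrrB.
  by move: (x ^+ 2) (y ^+ 2) (x * y); clear; lia.
have ab (x : int) : x ^+ 2 <= 2 * B -> `|x| <= (absz (2 * B))%:Z.
  by case: (eqVneq x 0) => [->|x0] le0; [rewrite normr0|move: x0 le0; clear; nia].
have [[q1 [q2 q3]] [q4 [q5 q6]]] := (q a c, q b d).
have [_ [_ q7]] := q (a + b) (c + d).
move: q1 q2 q3 q4 q5 q6 q7 le.
move: (a ^+ 2 - a * c + c ^+ 2) (b ^+ 2 - b * d + d ^+ 2) ((a + b) ^+ 2 - (a + b) * (c + d) + (c + d) ^+ 2) => u v w q1 q2 q3 q4 q5 q6 q7 le.
by rewrite !ab //; apply: le_trans (_ : _ <= 2 * (u + w + v)) _; lia.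
Qed.

Lemma cjK h M : mdet h = 1 -> M = mmul h (mmul (cj h M) (madj h)).
Proof.
move=> D; rewrite /cj !mmulA mmul_adj // mmul1m -mmulA mmul_adj //.
by rewrite mmulm1.
Qed.

Lemma mdet_cj h M : mdet h = 1 -> mdet (cj h M) = mdet M.
Proof. by move=> D; rewrite /cj !mdetM mdet_adj D mul1r mulr1. Qed.

(** The factor 72 = 6 * 2 * 6 bounds the norms of [h], [Rm] and [madj h] together; the 3 comes from
    [msize_le]. *)
Lemma msize_refl_bound h M K : mdet h = 1 -> mnorm h <= 6 -> mnorm (cj h M) <= K ->
  msize (mmul (refl h) M) <= 3 * (72 * K) ^+ 2.
Proof.
move=> D hurwitz6 cK.
have hn : mnorm (madj h) <= 6 by case: h hurwitz6 {D cK} => [[[a b] c] d] /=; lia.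
have K0 : 0 <= K by apply: le_trans (mnorm_ge0 _) cK.
have E : mmul (refl h) M = mmul h (mmul (mmul Rm (cj h M)) (madj h)).
  by rewrite -cj_refl // -cjK.
have le1 : mnorm (mmul (refl h) M) <= 72 * K.
  rewrite E; apply: le_trans (mnorm_mul _ _) _; apply: (@le_trans _ _ (6 * (12 * K))); last by lia.
  apply: ler_pM; rewrite ?mnorm_ge0 //; apply: le_trans (mnorm_mul _ _) _.
  rewrite (_ : 12 * K = (2 * K) * 6); last by lia.
  apply: ler_pM; rewrite ?mnorm_ge0 //; apply: le_trans (mnorm_mul _ _) _.
  by apply: ler_pM; rewrite ?mnorm_ge0.
apply: le_trans (msize_le _) _.
by rewrite ler_pM2l // lerXn2r ?nnegrE ?mnorm_ge0 // mulr_ge0.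
Qed.

Lemma det1P3 h : h \in P3 -> mdet h = 1.
Proof. by move: h; apply: in_P3. Qed.
Lemma det1P6 h : h \in P6 -> mdet h = 1.
Proof. by move: h; apply: in_P6. Qed.

Lemma SbdP3 : exists B : int -> int, forall M h, h \in P3 -> mdet M != 0 -> attracting (cj h M) ->
  msize (mmul (refl h) M) <= Num.max (msize M) (B `|mdet M|).
Proof.
exists (fun n => 3 * (72 * (12 * n)) ^+ 2) => M h hP D0 A.
have D := det1P3 hP.
have Dc := mdet_cj M D.
have E := msize_P3 M hP.
have [F|F] := lerP (excess 2 1 2 (cj h M)) 0; last first.
  by rewrite le_max; apply/orP; left; move: E; lia.
rewrite le_max; apply/orP; right; rewrite -Dc.
apply: msize_refl_bound => //; first by move: (h) hP; apply: in_P3.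
by apply: (excess_bound _ A _ F); rewrite ?Dc // !inE eqxx.
Qed.
Lemma SbdP6 : exists B : int -> int, forall M h, h \in P6 -> mdet M != 0 -> attracting (cj h M) ->
  msize (mmul (refl h) M) <= Num.max (msize M) (B `|mdet M|).
Proof.
exists (fun n => 3 * (72 * (12 * n)) ^+ 2) => M h hP D0 A.
have D := det1P6 hP.
have Dc := mdet_cj M D.
have fin X Y Z : (X, Y, Z) \in [:: (2, 1, 2); (6, 3, 2); (2, 3, 6)] ->
    msize M - msize (mmul (refl h) M) = 6 * excess X Y Z (cj h M) ->
    msize (mmul (refl h) M) <= Num.max (msize M) (3 * (72 * (12 * `|mdet M|)) ^+ 2).
  move=> XYZ E.
  have [F|F] := lerP (excess X Y Z (cj h M)) 0; last first.
    by rewrite le_max; apply/orP; left; move: E; lia.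
  rewrite le_max; apply/orP; right; rewrite -Dc.
  apply: msize_refl_bound => //; first by move: (h) hP; apply: in_P6.
  by apply: (excess_bound XYZ A _ F); rewrite ?Dc.
by case: (msize_P6 M hP); apply: fin.
Qed.
Definition sink3 := exists_sink det1P3 pingP3 qincP3 SbdP3 msize_fin.
Definition sink6 := exists_sink det1P6 pingP6 qincP6 SbdP6 msize_fin.

(** * Elliptic sinks and sinks of trace zero *)

(* In the doubled Selling coordinates (2c - a + d, -2b - a + d, a - d) of M, the
   fixed point of an elliptic M is inside (full) or on the boundary (half) of the polygon. *)
Definition full3 (x y z : int) := [&& 0 < x, 0 < y & 0 < z].
Definition half3 (x y z : int) :=
  [|| [&& x == 0, 0 < y & 0 < z], [&& 0 < x, y == 0 & 0 < z] | [&& 0 < x, 0 < y & z == 0]].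
Definition full6 (x y z : int) :=
  [&& 0 < x + 2 * y, 0 < y + 2 * x, 0 < x + 2 * z, 0 < z + 2 * x, 0 < y + 2 * z & 0 < z + 2 * y].
Definition thin (x y z : int) := [&& x + 2 * y == 0, y < 0 & 0 < z + 2 * y].
Definition half6 (x y z : int) :=
  [|| thin x y z, thin y x z, thin x z y, thin z x y, thin y z x | thin z y x].
Definition onsel (f : int -> int -> int -> bool) (M : mat) : bool :=
  let: (a, b, c, d) := M in f (2 * c - a + d) (- 2 * b - a + d) (a - d).
Definition tr0 (M : mat) := let: (a, b, c, d) := M in a + d == 0.

(** The determinant of (v, M v): the binary quadratic form whose zeros are the fixed points of
    [M]. *)
Definition mval (M : mat) (v : vec) : int := v.1 * (mapp M v).2 - v.2 * (mapp M v).1.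
Definition V3 : seq vec := [:: (1, 0); (1, 1); (0, 1)].
Definition V6 : seq vec := [:: (1, 0); (2, 1); (1, 1); (1, 2); (0, 1); (-1, 1)].

Lemma sinkE3 M : onsel full3 M || onsel half3 M -> sink P3 M.
Proof. case: M => [[[a b] c] d]; rewrite /onsel /full3 /half3 /sink /attracting /cj /=. lia. Qed.
Lemma sinkE6 M : onsel full6 M || onsel half6 M -> sink P6 M.
Proof. case: M => [[[a b] c] d]; rewrite /onsel /full6 /half6 /thin /sink /attracting /cj /=. lia. Qed.
Lemma neut_full3 M h : h \in P3 -> onsel full3 M -> ~~ neutral h M.
Proof. case: M => [[[a b] c] d]; move: h; apply: in_P3; rewrite /onsel /full3 /half3 /neutral /attracting /cj /=; lia. Qed.
Lemma neut_full6 M h : h \in P6 -> onsel full6 M -> ~~ neutral h M.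
Proof. case: M => [[[a b] c] d]; move: h; apply: in_P6; rewrite /onsel /full6 /half6 /neutral /attracting /cj /=; lia. Qed.

Lemma count1P (T : eqType) (p : pred T) (s : seq T) : count p s = 1%N ->
  exists2 h, (h \in s) && p h & forall h', h' \in s -> p h' -> h' = h.
Proof.
elim: s => // x s IH /=; case px: (p x) => /= E.
  exists x; first by rewrite inE eqxx.
  move=> h'; rewrite inE => /orP[/eqP//|hs ph].
  have /hasPn/(_ h' hs) : ~~ has p s by rewrite has_count; move: E; rewrite add1n => -[->].
  by rewrite ph.
have [h /andP[hs ph] U] := IH E; exists h; first by rewrite inE hs orbT.
by move=> h'; rewrite inE => /orP[/eqP->|/U//]; rewrite px.
Qed.
Lemma countP3 (p : pred mat) : count p P3 = addn (p (1,1,0,1)) (addn (p (1,0,1,1)) (addn (p (0,-1,1,0)) (0%N))).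
Proof. by []. Qed.
Lemma countP6 (p : pred mat) : count p P6 = addn (p (1,2,0,1)) (addn (p (2,1,1,1)) (addn (p (1,1,1,2)) (addn (p (1,0,2,1)) (addn (p (0,-1,1,1)) (addn (p (-1,-1,1,0)) (0%N)))))).
Proof. by []. Qed.
Ltac neutvals a b c d :=
  repeat match goal with
  | |- context [neutral ?h (a, b, c, d)] =>
     first [rewrite (_ : neutral h (a, b, c, d) = false); [|by rewrite /neutral /attracting /cj /=; lia]
           |rewrite (_ : neutral h (a, b, c, d) = true); [|by rewrite /neutral /attracting /cj /=; lia]]
  end.
Lemma neut_half3 M : onsel half3 M -> count (fun h => neutral h M) P3 = 1%N.
Proof.
case: M => [[[a b] c] d]; rewrite /onsel /half3 countP3.
by case/or3P=> /and3P[H1 H2 H3]; neutvals a b c d.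
Qed.
Lemma neut_half6 M : onsel half6 M -> count (fun h => neutral h M) P6 = 1%N.
Proof.
case: M => [[[a b] c] d]; rewrite /onsel /half6 /thin countP6.
by case/or3P=> [||/or4P[]] /and3P[H1 H2 H3]; neutvals a b c d.
Qed.
(** The trace of [mmul (refl h) M] is the difference of the diagonal entries of [cj h M], which
    vanishes when the fixed point of [M] lies on the side [h]. *)
Lemma tr0_half3 h M : h \in P3 -> onsel half3 M -> neutral h M -> tr0 (mmul (refl h) M).
Proof. case: M => [[[a b] c] d]; move: h; apply: in_P3; rewrite /onsel /half3 /neutral /attracting /cj /tr0 /refl /=; lia. Qed.
Lemma tr0_half6 h M : h \in P6 -> onsel half6 M -> neutral h M -> tr0 (mmul (refl h) M).
Proof.
move=> hP H; move: h hP; case: M H => [[[a b] c] d]; rewrite /onsel /half6 /thin.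
case/or3P=> [||/or4P[]] /and3P[H1 H2 H3]; apply: in_P6; rewrite /neutral /attracting /cj /tr0 /refl /=; lia.
Qed.

Definition nocusp (V : seq vec) N := all (fun v => mval N v != 0) V.
Definition chg (x y : int) := (0 < x) != (0 < y).
Lemma tr0P N : tr0 N -> exists a b c, N = (a, b, c, - a).
Proof. by case: N => [[[a b] c] d] /= /eqP; exists a, b, c; congr (_, _, _, _); lia. Qed.

(** A matrix of trace zero and negative determinant acts as the reflection in the geodesic joining
    the zeros of [mval]. A side is neutral when this axis crosses it, that is, when [mval] changes
    sign between its ends; c' and -b' are the values at the two ends. *)
Lemma neutral_tr0 a b c h : mdet h = 1 -> mdet (a, b, c, - a) < 0 ->
  let: (a', b', c', d') := cj h (a, b, c, - a) in
  a' + d' = 0 -> b' != 0 -> c' != 0 -> neutral h (a, b, c, - a) = chg c' (- b').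
Proof.
move=> D; rewrite -(mdet_cj _ D) /neutral; case: (cj _ _) => [[[a' b'] c'] d'] /= H.
have {}H : 0 < b' /\ c' < 0 \/ b' < 0 /\ 0 < c' -> a' + d' = 0 -> a' != 0.
  move=> C _; apply: contraTneq H => a0; rewrite -leNgt a0 mul0r sub0r oppr_ge0.
  by case: C => -[x y]; [apply: mulr_ge0_le0|apply: mulr_le0_ge0]; apply: ltW.
rewrite /chg; lia.
Qed.

Lemma neutrals3 a b c : mdet (a, b, c, - a) < 0 -> nocusp V3 (a, b, c, - a) ->
  let p := c in let s := - b in let t := c - 2 * a - b in
  [/\ neutral (1,1,0,1) (a,b,c,-a) = chg p t, neutral (1,0,1,1) (a,b,c,-a) = chg t s
    & neutral (0,-1,1,0) (a,b,c,-a) = chg s p].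
Proof.
rewrite /nocusp /mval /= => D H.
by split; match goal with |- neutral ?h _ = _ => have := @neutral_tr0 a b c h (erefl _) D; rewrite /cj /= => -> end; clear D; rewrite /chg; lia.
Qed.
(** Here p, s, t are the values of [mval] at (1,0), (0,1), (1,1), and p', s', t' those at the
    opposite vertices (1,2), (2,1), (-1,1) of the hexagon, by the parallelogram law. *)
Lemma neutrals6 a b c : mdet (a, b, c, - a) < 0 -> nocusp V6 (a, b, c, - a) ->
  let p := c in let s := - b in let t := c - 2 * a - b in
  let p' := 2 * s + 2 * t - p in let s' := 2 * p + 2 * t - s in let t' := 2 * p + 2 * s - t in
  [/\ neutral (1,2,0,1) (a,b,c,-a) = chg p s', neutral (2,1,1,1) (a,b,c,-a) = chg s' t,
     neutral (1,1,1,2) (a,b,c,-a) = chg t p' &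
  [/\ neutral (1,0,2,1) (a,b,c,-a) = chg p' s, neutral (0,-1,1,1) (a,b,c,-a) = chg s t'
    & neutral (-1,-1,1,0) (a,b,c,-a) = chg t' p]].
Proof.
rewrite /nocusp /mval /= => D H.
split; [..|split]; match goal with |- neutral ?h _ = _ => have := @neutral_tr0 a b c h (erefl _) D; rewrite /cj /= => -> end; clear D; rewrite /chg; lia.
Qed.
Ltac por := match goal with |- is_true (_ || _) => first [apply/orP; left; por | apply/orP; right; por] | _ => lia end.

Lemma tr0_neutral_step3 h N : h \in P3 -> tr0 N -> mdet N < 0 -> nocusp V3 N -> neutral h N ->
  onsel half3 (mmul (refl h) N) || onsel half3 (mopp (mmul (refl h) N)).
Proof.
move=> hP /tr0P[a [b [c ->]]] D nc; have := neutrals3 D nc; move: nc hP {D}; rewrite /nocusp /mval /=.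
move=> nc hP [E1 E2 E3]; move: h hP; apply: in_P3; rewrite ?E1 ?E2 ?E3 /chg /onsel /half3 /refl /mopp /=; clear E1 E2 E3;
have [c1|c1] := ltrP 0 c; have [b1|b1] := ltrP 0 (- b); have [t1|t1] := ltrP 0 (c - 2 * a - b) => //= _; por.
Qed.
Definition thk k (x y z : int) := nth false [:: thin x y z; thin y x z; thin x z y; thin z x y; thin y z x; thin z y x] k.
Lemma thk_or k M : onsel (thk k) M || onsel (thk k) (mopp M) -> onsel half6 M || onsel half6 (mopp M).
Proof.
case: M => [[[a b] c] d]; rewrite /onsel /mopp /thk /half6.
by case: k => [|[|[|[|[|[|[|k]]]]]]] //= /orP[] ->; rewrite ?orbT.
Qed.
Lemma tr0_neutral_step6 h N : h \in P6 -> tr0 N -> mdet N < 0 -> nocusp V6 N -> neutral h N ->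
  onsel half6 (mmul (refl h) N) || onsel half6 (mopp (mmul (refl h) N)).
Proof.
move=> hP /tr0P[a [b [c ->]]] D nc; have := neutrals6 D nc; move: nc hP {D}; rewrite /nocusp /mval /=.
move=> nc hP [E1 E2 E3 [E4 E5 E6]]; move: h hP; apply: in_P6; rewrite ?(E1, E2, E3, E4, E5, E6) /chg => H;
 [apply: (@thk_or 3)|apply: (@thk_or 1)|apply: (@thk_or 0)|apply: (@thk_or 5)|apply: (@thk_or 4)|apply: (@thk_or 2)];
 clear E1 E2 E3 E4 E5 E6; rewrite /thk /onsel /refl /mopp /thin /=; lia.
Qed.
Lemma tr0_neutral_count3 N : tr0 N -> mdet N < 0 -> nocusp V3 N -> count (fun h => neutral h N) P3 \in [:: 0; 2]%N.
Proof.
move=> /tr0P[a [b [c ->]]] D nc; have [E1 E2 E3] := neutrals3 D nc.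
by rewrite countP3 E1 E2 E3 /chg; case: (0 < c); case: (0 < - b); case: (0 < _ - _).
Qed.
(** The number of sign changes around the polygon is even; the parallelogram law rules out four and
    six. The axis thus crosses no side or two. *)
Lemma chg6 (p s t : int) : let p' := 2 * s + 2 * t - p in let s' := 2 * p + 2 * t - s in let t' := 2 * p + 2 * s - t in
  [&& p != 0, s != 0, t != 0, p' != 0, s' != 0 & t' != 0] ->
  addn (chg p s') (addn (chg s' t) (addn (chg t p') (addn (chg p' s) (addn (chg s t') (addn (chg t' p) 0%N))))) \in [:: 0; 2]%N.
Proof.
move=> p' s' t' /and5P[? ? ? ? /andP[? ?]]; rewrite /chg !inE.
have [p1|p1] := ltrP 0 p; have [s1|s1] := ltrP 0 s; have [t1|t1] := ltrP 0 t;
have [?|?] := ltrP 0 p'; have [?|?] := ltrP 0 s'; have [?|?] := ltrP 0 t' => //; lia.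
Qed.
Lemma tr0_neutral_count6 N : tr0 N -> mdet N < 0 -> nocusp V6 N -> count (fun h => neutral h N) P6 \in [:: 0; 2]%N.
Proof.
move=> /tr0P[a [b [c ->]]] D nc; have [E1 E2 E3 [E4 E5 E6]] := neutrals6 D nc.
rewrite countP6 E1 E2 E3 E4 E5 E6; apply: chg6; move: nc; rewrite /nocusp /mval /=; clear; lia.
Qed.

(** The discriminant tr^2 - 4 det of [mval], expressed in the doubled Selling coordinates, is minus
    their second elementary symmetric function. *)
Lemma sel_det (a b c d : int) : 4 * (a * d - b * c) = (a + d) ^+ 2 + ((2 * c - a + d) * (- 2 * b - a + d)
   + (- 2 * b - a + d) * (a - d) + (a - d) * (2 * c - a + d)).
Proof. by ring. Qed.

(** If the axis crosses no side, [mval] has one sign at all vertices; in a sink the Selling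
    coordinates then have one sign as well, and [sel_det] would make the determinant nonnegative. *)
Lemma tr0_sink_neutral3 N : tr0 N -> mdet N < 0 -> nocusp V3 N -> sink P3 N -> has (fun h => neutral h N) P3.
Proof.
move=> /tr0P[a [b [c ->]]] D nc sN; apply: contraLR D; rewrite -leNgt => nh.
have := sel_det a b c (- a); rewrite subrr expr2 mul0r add0r => E.
rewrite -(pmulr_rge0 (x := 4)) //= E.
have S : [&& 0 <= 2 * c - a + - a, 0 <= - 2 * b - a + - a & 0 <= a - - a] ||
  [&& 2 * c - a + - a <= 0, - 2 * b - a + - a <= 0 & a - - a <= 0].
  move: nc sN nh {E}; rewrite /nocusp /mval /sink /neutral /attracting /cj /=.
  by have [c1|c1] := ltrP 0 c; have [b1|b1] := ltrP 0 (- b); lia.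
move: S; move: (2 * c - a + - a) (- 2 * b - a + - a) (a - - a) => x y z; clear.
case/orP=> /and3P[x0 y0 z0]; [by rewrite !addr_ge0 // mulr_ge0|by rewrite !addr_ge0 // mulr_le0].
Qed.
Lemma hex_e2_ge0 (u v w : int) : [&& 0 <= u + 2 * v, 0 <= v + 2 * u, 0 <= u + 2 * w, 0 <= w + 2 * u, 0 <= v + 2 * w & 0 <= w + 2 * v] ->
  0 <= u * v + v * w + w * u.
Proof.
  have G (p q r : int) : r <= 0 -> 0 <= p + 2 * r -> 0 <= q + 2 * r -> 0 <= p * q + q * r + r * p.
    move=> r0 pr qr; have r0' : 0 <= - r by rewrite oppr_ge0.
    (* The triple (p + 2r, q + 2r, -r) is the image of (p, q, r) under the reflection in a side of
       the triangle; it has the same value of e, and no negative entry. *)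
    rewrite (_ : _ + r * p = (p + 2 * r) * (q + 2 * r) + (p + 2 * r) * - r + (q + 2 * r) * - r); last by ring.
    by rewrite !addr_ge0 ?mulr_ge0.
  case/and5P=> h1 h2 h3 h4 /andP[h5 hurwitz6].
  have [w0|w0] := ltrP w 0; first by apply: G => //; apply: ltW.
  have [u0|u0] := ltrP u 0; first by rewrite -addrA addrC; apply: G => //; apply: ltW.
  have [v0|v0] := ltrP v 0; last by rewrite !addr_ge0 ?mulr_ge0.
  by rewrite addrC addrA; apply: G => //; apply: ltW.
Qed.
Lemma tr0_sink_neutral6 N : tr0 N -> mdet N < 0 -> nocusp V6 N -> sink P6 N -> has (fun h => neutral h N) P6.
Proof.
move=> /tr0P[a [b [c ->]]] D nc sN; have [E1 E2 E3 [E4 E5 E6]] := neutrals6 D nc.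
apply: contraLR D; rewrite -leNgt => nh.
have := sel_det a b c (- a); rewrite subrr expr2 mul0r add0r => E.
rewrite -(pmulr_rge0 (x := 4)) //= E {E}.
move: nh; rewrite has_count countP6 E1 E2 E3 E4 E5 E6 {E1 E2 E3 E4 E5 E6} => nh.
have S : let x := 2 * c - a + - a in let y := - 2 * b - a + - a in let z := a - - a in
  let q x y z := [&& 0 <= x + 2 * y, 0 <= y + 2 * x, 0 <= x + 2 * z, 0 <= z + 2 * x, 0 <= y + 2 * z & 0 <= z + 2 * y] in
  q x y z \/ q (- x) (- y) (- z).
  move=> x y z q; rewrite /q /x /y /z {q x y z}.
  move: nc sN; rewrite /nocusp /mval /= => nc.
  have {nc}nh : [&& 0 < c, 0 < 4 * c - 4 * a - b, 0 < c - 2 * a - b, 0 < c - 4 * a - 4 * b, 0 < - b & 0 < c + 2 * a - b] ||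
   [&& c < 0, 4 * c - 4 * a - b < 0, c - 2 * a - b < 0, c - 4 * a - 4 * b < 0, - b < 0 & c + 2 * a - b < 0].
    move: nc nh; rewrite /chg; clear.
    by have [c1|c1] := ltrP 0 c; have [b1|b1] := ltrP 0 (- b); lia.
  rewrite /sink /= /attracting /cj /= => /and5P[s1 s2 s3 s4 /and3P[s5 s6 _]].
  by case/orP: nh => /and5P[n1 n2 n3 n4 /andP[n5 n6]]; [left|right];
    ((apply/and5P; split; last apply/andP; try split);
    [clear s1 s2 s4 s5 s6|clear s1 s3 s4 s5 s6|clear s1 s2 s3 s4 s5|clear s2 s3 s4 s5 s6|clear s1 s2 s3 s4 s6|clear s1 s2 s3 s5 s6]; lia).
move: S => /=; move: (2 * c - a + - a) (- 2 * b - a + - a) (a - - a) => x y z; clear.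
by case=> /hex_e2_ge0 //; rewrite !mulrNN.
Qed.

(** * Attracting cusps and the classification of sinks *)

(** The second eigenvalue det / l is smaller than l in absolute value, so the cusp v is the
    attracting fixed point. *)
Definition dominant_eigen (M : mat) (v : vec) (l : int) := mapp M v = (l * v.1, l * v.2) /\ `|mdet M| < l ^+ 2.

Lemma eig_cj h M v l : mdet h = 1 -> dominant_eigen M v l -> dominant_eigen (cj h M) (mapp (madj h) v) l.
Proof.
move=> D [E lt]; split; last by rewrite mdet_cj.
rewrite /cj !mapp_mul -[mapp h _]mapp_mul mmul_adj // mapp1 E.
by case: (madj h) => [[[? ?] ?] ?] /=; congr (_, _); ring.
Qed.

Lemma eig_core (a b c d x y l : int) : x != 0 -> a * x + b * y = l * x -> c * x + d * y = l * y ->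
  `|a * d - b * c| < l ^+ 2 -> `|a + d - l| < `|l|.
Proof.
move=> x0 E1 E2; apply: contraTT; rewrite -!leNgt => le.
have E : (a * d - b * c) = l * (a + d - l).
  apply: (mulfI x0); apply/eqP; rewrite -subr_eq0.
  rewrite (_ : _ - _ = (d - l) * (a * x + b * y - l * x) - b * (c * x + d * y - l * y)); last by ring.
  by rewrite E1 E2 !subrr !mulr0 subrr.
by rewrite E normrM -[l ^+ 2](real_normK (num_real l)) expr2 ler_wpM2l.
Qed.
Lemma eig_core' (a b c d x y l : int) : y != 0 -> a * x + b * y = l * x -> c * x + d * y = l * y ->
  `|a * d - b * c| < l ^+ 2 -> `|a + d - l| < `|l|.
Proof.
move=> y0 E1 E2 lt; rewrite (addrC a); apply: (@eig_core d c b a y x l) => //.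
- by rewrite -E2; ring.
- by rewrite -E1; ring.
by rewrite (mulrC d) (mulrC c).
Qed.

Lemma att_eig_pos M x y l : 0 < x -> y < 0 -> dominant_eigen M (x, y) l -> attracting (mmul Rm M).
Proof.
case: M => [[[a b] c] d] x0 y0 [[E1 E2]] /= lt.
have := eig_core (lt0r_neq0 x0) E1 E2 lt.
have F1 : (l - a) * x = b * y by rewrite mulrBl -E1; ring.
have F2 : (l - d) * y = c * x by rewrite mulrBl -E2; ring.
have b1 : 0 <= b -> l <= a by move=> b0; rewrite -subr_le0 -(pmulr_lle0 _ x0) F1 mulr_ge0_le0 // ltW.
have b2 : b <= 0 -> a <= l by move=> b0; rewrite -subr_ge0 -(pmulr_lge0 _ x0) F1 mulr_le0 // ltW.
have c1 : 0 <= c -> l <= d by move=> b0; rewrite -subr_le0 -(nmulr_lge0 _ y0) F2 mulr_ge0 // ltW.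
have c2 : c <= 0 -> d <= l by move=> b0; rewrite -subr_ge0 -(nmulr_lle0 _ y0) F2 mulr_le0_ge0 // ltW.
move: b1 b2 c1 c2; clear; lia.
Qed.
Lemma eig_opp M v l : dominant_eigen M v l -> dominant_eigen M (- v.1, - v.2) l.
Proof.
case: M => [[[a b] c] d] [[E1 E2] lt]; split => //=.
by rewrite !mulrN -!opprD E1 E2.
Qed.
(** A cusp that attracts from the polygon's side of an edge makes this edge point inwards; by
    [att_eig0] a cusp at an end of a side gives no outgoing edge across it. *)
Lemma att_eig M v l : negv v -> dominant_eigen M v l -> attracting (mmul Rm M).
Proof.
case: v => x y; rewrite /negv /= => /orP[] /andP[x0 y0] E; first exact: att_eig_pos E.
by have := eig_opp E => /=; apply: att_eig_pos; lia.
Qed.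
Lemma att_eig0 M v l : v.1 * v.2 = 0 -> v != (0, 0) -> dominant_eigen M v l -> ~~ attracting M.
Proof.
case: v => x y /= /eqP; rewrite mulf_eq0 => /orP[] /eqP-> ne; case: M => [[[a b] c] d] [[E1 E2]] /= lt.
  have y0 : y != 0 by apply: contraNneq ne => ->.
  have := eig_core' y0 E1 E2 lt.
  have -> : d = l by apply: (mulIf y0); move: E2; rewrite mulr0 add0r.
  have -> : b = 0 by apply: (mulIf y0); move: E1; rewrite !mulr0 mul0r add0r.
  clear; lia.
have x0 : x != 0 by apply: contraNneq ne => ->.
have := eig_core x0 E1 E2 lt.
have -> : a = l by apply: (mulIf x0); move: E1; rewrite mulr0 addr0.
have -> : c = 0 by apply: (mulIf x0); move: E2; rewrite !mulr0 mul0r addr0.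
clear; lia.
Qed.

Definition nonsquare (n : int) := forall k : int, k ^+ 2 != n.
Lemma nsq0 n : nonsquare n -> n != 0.
Proof. by move=> /(_ 0); rewrite expr0n eq_sym. Qed.

Lemma eigI M v l m : mapp M v = (l * v.1, l * v.2) -> mdet M = l * m -> `|m| < `|l| -> dominant_eigen M v l.
Proof.
move=> E D lt; split=> //; rewrite D normrM -[l ^+ 2](real_normK (num_real l)) expr2 ltr_pM2l //.
by apply: le_lt_trans lt.
Qed.
Lemma nsq_abs (a d : int) : nonsquare `|a * d| -> `|a| != `|d|.
Proof. by move=> q; apply: contraNneq (q `|a|) => E; rewrite normrM E expr2. Qed.

Lemma even_sq (t X : int) : 4 * X = t ^+ 2 -> exists k, t = 2 * k.
Proof.
move=> E; exists (t %/ 2)%Z; set k := (t %/ 2)%Z.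
have [//|D] : t = 2 * k \/ t = 2 * k + 1 by rewrite /k; lia.
by move: E; rewrite D (_ : _ ^+ 2 = 4 * (k * k + k) + 1); [lia|ring].
Qed.
Definition ell3 M := onsel full3 M || onsel half3 M.
Definition ell6 M := onsel full6 M || onsel half6 M.

(** If two Selling coordinates vanished, [sel_det] would make the determinant a square, so at most
    one is zero. *)
Lemma sel_ell3 M : nonsquare `|mdet M| ->
  (let: (a, b, c, d) := M in [&& 0 <= 2 * c - a + d, 0 <= - 2 * b - a + d & 0 <= a - d]) -> ell3 M.
Proof.
case: M => [[[a b] c] d] q; rewrite /ell3 /onsel => /and3P[x0 y0 z0].
have F (u v w : int) : u = 0 -> v = 0 -> 4 * (a * d - b * c) != (a + d) ^+ 2 + (u * v + v * w + w * u).
  move=> -> ->; rewrite !mulr0 !mul0r !addr0; apply/eqP => E.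
  have [k Ek] : exists k, a + d = 2 * k.
    by apply: (@even_sq _ (a * d - b * c)).
  move: (q k) => /eqP; apply; rewrite ger0_norm; rewrite /mdet; last by have := sqr_ge0 (a + d); rewrite -E; lia.
  by apply: (mulfI (_ : 4 != 0)) => //; rewrite E Ek; ring.
have := sel_det a b c d.
move: F x0 y0 z0; move: (2 * c - a + d) (- 2 * b - a + d) (a - d) => x y z F x0 y0 z0 E.
have Fxy : ~~ ((x == 0) && (y == 0)) by apply/negP=> /andP[/eqP X /eqP Y]; have /eqP := F x y z X Y; apply.
have Fyz : ~~ ((y == 0) && (z == 0)) by apply/negP=> /andP[/eqP X /eqP Y]; have /eqP := F y z x X Y; apply; rewrite E; ring.
have Fzx : ~~ ((z == 0) && (x == 0)) by apply/negP=> /andP[/eqP X /eqP Y]; have /eqP := F z x y X Y; apply; rewrite E; ring.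
by move: Fxy Fyz Fzx x0 y0 z0; clear; rewrite /full3 /half3; lia.
Qed.

(** If [mval] vanishes at a vertex, this vertex carries an eigenvalue, and when that is the smaller
    one the sink conditions force the other eigenvector to be a vertex too. Otherwise the signs of
    [mval] at the vertices leave Selling coordinates of one sign, or trace zero. *)
Lemma sink3_cases M : sink P3 M -> nonsquare `|mdet M| ->
  [\/ ell3 M \/ ell3 (mopp M), tr0 M /\ mdet M < 0 | exists v l, v \in V3 /\ dominant_eigen M v l].
Proof.
case: M => [[[a b] c] d] s q.
have [c0|c0] := eqVneq c 0.
  constructor 3; rewrite c0 /= mulr0 subr0 in q s *; have := nsq_abs q.
  rewrite neq_lt => /orP[] lt; last first.
    by exists (1, 0), a; split => //; apply: (@eigI _ _ _ d); rewrite /= ?subr0 ?mulr0 ?addr0 ?mul0r.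
  have [b0|b0] : b = 0 \/ a + b = d by move: s lt; rewrite /sink /attracting /cj /=; clear; lia.
    exists (0, 1), d; split => //; apply: (@eigI _ _ _ a) => //=; first by rewrite b0; congr (_, _); ring.
    by rewrite mulr0 subr0 mulrC.
  exists (1, 1), d; split => //; apply: (@eigI _ _ _ a) => //=; first by congr (_, _); rewrite -?b0; ring.
  by rewrite mulr0 subr0 mulrC.
have [b0|b0] := eqVneq b 0.
  constructor 3; rewrite b0 /= mul0r subr0 in q s *; have := nsq_abs q.
  rewrite neq_lt => /orP[] lt.
    exists (0, 1), d; split => //; apply: (@eigI _ _ _ a) => //=; first by congr (_, _); ring.
    by rewrite mul0r subr0 mulrC.
  have {c0}c0 : c + d = a by move: s lt c0; rewrite /sink /attracting /cj /=; clear; lia.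
  exists (1, 1), a; split => //; apply: (@eigI _ _ _ d) => //=; first by congr (_, _); rewrite -?c0; ring.
  by rewrite mul0r subr0.
have [t0|t0] := eqVneq (a + b) (c + d).
  constructor 3; have E : a * d - b * c = (c + d) * (a - c).
    by rewrite (_ : b = c + d - a); [ring|rewrite -t0; ring].
  rewrite /= E in q; have := nsq_abs q.
  have lt : ~ `|c + d| < `|a - c|.
    by move: s t0 b0 c0; rewrite /sink /attracting /cj /=; clear; lia.
  rewrite neq_lt => /orP[//|lt'].
  by exists (1, 1), (c + d); split => //; apply: (@eigI _ _ _ (a - c)) => //=; rewrite !mulr1 t0.
have [S|[S|[S C]]] : [&& 0 <= 2 * c - a + d, 0 <= - 2 * b - a + d & 0 <= a - d] \/
  [&& 2 * c - a + d <= 0, - 2 * b - a + d <= 0 & a - d <= 0] \/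
   (a + d == 0 /\ ((0 < c) != (0 < - b)) || ((0 < c) != (0 < c + d - a - b))).
- move: s b0 c0 t0; rewrite /sink /attracting /cj /=; clear.
  have [c1|c1] := ltrP 0 c; have [b1|b1] := ltrP 0 (- b); have [t1|t1] := ltrP 0 (c + d - a - b); lia.
- by constructor 1; left; apply: sel_ell3.
- constructor 1; right; apply: sel_ell3.
    by move: q; rewrite /= mulrNN mulrNN.
  by move: S; rewrite /mopp; clear; lia.
constructor 2; split => //=.
have -> : d = - a by move: S; clear; lia.
have {}t0 : c - 2 * a - b != 0 by move: t0 S; clear; lia.
(* With t = c - 2a - b the determinant is ct - (c - a)^2 and also -a^2 - bc. Were it nonnegative, c,
   -b and t would have the same sign, against C. *)
have Q : c * (c - 2 * a - b) - (c - a) ^+ 2 = a * - a - b * c by ring.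
rewrite ltNge; apply/negP => D; move: C; rewrite -Q in D.
have cb : b * c <= 0.
  have : a * - a - b * c = - (a ^+ 2) - b * c by ring.
  by rewrite -Q; have := sqr_ge0 a; move: D; clear; lia.
have ct : 0 <= c * (c - 2 * a - b) by have := sqr_ge0 (c - a); move: D; clear; lia.
have -> : c + d - a - b = c - 2 * a - b by move: S; clear; lia.
have [c1|c1] : 0 < c \/ c < 0 by move: c0; clear; lia.
  by move: cb ct; rewrite pmulr_lle0 // pmulr_rge0 // c1; move: b0 t0; clear; lia.
by move: cb ct; rewrite nmulr_lle0 // nmulr_rge0 //; move: c1 b0 t0; clear; lia.
Qed.

Definition refl_conj (h M : mat) := mmul (mmul (refl h) M) (refl h).

(** The hexagon consists of the triangle and its mirror images. A hexagon sink that leaves the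
    triangle across [h] is a sink for the mirror image in [h], and conjugating by the reflection
    brings this image back to the triangle. This reduces the hexagon sinks to the triangle sinks. *)
Lemma sink6_conj h M : h \in P3 -> sink P6 M -> attracting (cj h M) -> sink P3 (refl_conj h M).
Proof.
move=> hP; rewrite /sink [X in X -> _]/= => /and5P[s1 s2 s3 s4 /and3P[s5 s6 _]].
move: h hP; case: M s1 s2 s3 s4 s5 s6 => [[[a b] c] d] s1 s2 s3 s4 s5 s6.
apply: in_P3 => A; rewrite /sink /=; (apply/and4P; split; last by []);
[clear s1 s2 s3 s4 s5 s6|clear s1 s3 s4 s5 s6|clear s2 s3 s4 s5 s6
|clear s1 s2 s4 s5 s6|clear s1 s2 s3 s4 s5 s6|clear s1 s2 s3 s5 s6
|clear s1 s2 s3 s4 s5|clear s1 s2 s3 s4 s6|clear s1 s2 s3 s4 s5 s6];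
 move: A; try move: s1; try move: s2; try move: s3; try move: s4; try move: s5; try move: s6; rewrite /attracting /cj /refl_conj /refl /=; lia.
Qed.

Lemma sinkP (P : seq mat) M : sink P M \/ exists2 h, h \in P & attracting (cj h M).
Proof.
case: (boolP (sink P M)) => [|/allPn[h hP]]; first by left.
by rewrite negbK; right; exists h.
Qed.
Lemma refl2 h : mdet h = 1 -> mmul (refl h) (refl h) = m1.
Proof. by move=> D; rewrite -[X in mmul _ X]mmulm1 reflK. Qed.
Lemma conjK h M : mdet h = 1 -> refl_conj h (refl_conj h M) = M.
Proof.
by move=> /refl2; rewrite /refl_conj; move: (refl h) => r E; rewrite !mmulA E mmul1m -mmulA E mmulm1.
Qed.
Lemma mdet_opp M : mdet (mopp M) = mdet M.
Proof. by case: M => [[[a b] c] d] /=; ring. Qed.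
Lemma mdet_conj h M : mdet h = 1 -> mdet (refl_conj h M) = mdet M.
Proof. by move=> D; rewrite /refl_conj !mdetM mdet_adj D (_ : mdet Rm = -1) //; ring. Qed.
Lemma ell3_6 M : ell3 M -> ell6 M.
Proof.
case: M => [[[a b] c] d]; rewrite /ell3 /ell6 /onsel; move: (2 * c - a + d) (- 2 * b - a + d) (a - d) => x y z; clear.
rewrite /full3 /half3; move=> H; apply/orP; left; move: H; rewrite /full6; lia.
Qed.
Lemma selconj h M : h \in P3 -> let: (a, b, c, d) := M in let: (a', b', c', d') := refl_conj h M in
  let x := 2 * c - a + d in let y := - 2 * b - a + d in let z := a - d in
  let t := (2 * c' - a' + d', - 2 * b' - a' + d', a' - d') in
  [\/ t = (- (x + 2 * z), - (y + 2 * z), z), t = (- (x + 2 * y), y, - (z + 2 * y))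
   | t = (x, - (y + 2 * x), - (z + 2 * x))].
Proof.
case: M => [[[a b] c] d]; move: h; apply: in_P3 => /=;
 by (constructor 1; congr (_, _, _); lia) || (constructor 2; congr (_, _, _); lia) || (constructor 3; congr (_, _, _); lia).
Qed.
Lemma ell3_conj h M : h \in P3 -> (ell3 (refl_conj h M) -> ell6 (mopp M)) /\ (ell3 (mopp (refl_conj h M)) -> ell6 M).
Proof.
move=> hP; have := selconj M hP.
case: M => [[[a b] c] d]; case: (refl_conj _ _) => [[[a' b'] c'] d'] /= S.
rewrite /ell6 /ell3 /onsel /mopp.
have E (u v w : int) : 2 * - w - - u + - v = - (2 * w - u + v) by ring.
have E' (u v w : int) : - 2 * - w - - u + - v = - (- 2 * w - u + v) by ring.
have E'' (u v : int) : - u - - v = - (u - v) by ring.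
rewrite !E !E' !E''.
have F (x y z x' y' z' : int) : [\/ (x', y', z') = (- (x + 2 * z), - (y + 2 * z), z), (x', y', z') = (- (x + 2 * y), y, - (z + 2 * y))
   | (x', y', z') = (x, - (y + 2 * x), - (z + 2 * x))] -> full3 (- x') (- y') (- z') || half3 (- x') (- y') (- z') -> full6 x y z || half6 x y z.
  rewrite /full3 /half3 /full6 /half6 /thin; clear.
  case=> -[-> -> ->] /orP[/and3P[h1 h2 h3]|/or3P[]/and3P[h1 h2 h3]]; por.
split; last by apply: F S.
rewrite -[a' - d']opprK -[2 * c' - _ + _]opprK -[- 2 * b' - _ + _]opprK.
apply: F; case: S => -[-> -> ->]; [constructor 1|constructor 2|constructor 3]; congr (_, _, _); ring.
Qed.
Definition eqv (v w : vec) := v = w \/ v = (- w.1, - w.2).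
Lemma V3_refl h v : h \in P3 -> v \in V3 -> exists2 w, w \in V6 & eqv (mapp (refl h) v) w.
Proof.
move=> hP; rewrite !inE => /or3P[] /eqP->; move: h hP; apply: in_P3; rewrite /eqv.
- by exists (1, 0) => //; first [by left | by right].
- by exists (1, 2) => //; first [by left | by right].
- by exists (1, 0) => //; first [by left | by right].
- by exists (1, 1) => //; first [by left | by right].
- by exists (1, 1) => //; first [by left | by right].
- by exists (-1, 1) => //; first [by left | by right].
- by exists (2, 1) => //; first [by left | by right].
- by exists (0, 1) => //; first [by left | by right].
- by exists (0, 1) => //; first [by left | by right].
Qed.
Lemma V3_6 v : v \in V3 -> v \in V6.
Proof. by rewrite !inE => /or3P[] /eqP->. Qed.
Lemma sink6_cases M : sink P6 M -> nonsquare `|mdet M| ->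
  [\/ ell6 M \/ ell6 (mopp M), tr0 M /\ mdet M < 0 | exists v l, v \in V6 /\ dominant_eigen M v l].
Proof.
move=> s q; have [s3|[h hP A]] := sinkP P3 M.
  case: (sink3_cases s3 q) => [[E|E]|T|[v [l [vV E]]]].
  - by constructor 1; left; apply: ell3_6.
  - by constructor 1; right; apply: ell3_6.
  - by constructor 2.
  - by constructor 3; exists v, l; split=> //; apply: V3_6.
have D := det1P3 hP; have [C1 C2] := ell3_conj M hP.
have q' : nonsquare `|mdet (refl_conj h M)| by rewrite mdet_conj.
case: (sink3_cases (sink6_conj hP s A) q') => [[E|E]|[T lt]|[v [l [vV [E lt]]]]].
- by constructor 1; right; apply: C1.
- by constructor 1; left; apply: C2.
- rewrite mdet_conj // in lt; constructor 2; split => //; move: T.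
  by case: (M) => [[[a b] c] d]; move: h hP {s A D C1 C2 q q' lt}; apply: in_P3; rewrite /refl_conj /refl /=; lia.
constructor 3; have [w wV W] := V3_refl hP vV; exists w, l; split => //.
have E' : dominant_eigen M (mapp (refl h) v) l.
  split; last by rewrite mdet_conj in lt.
  move: (conjK M D) (refl2 D) E; rewrite {1}/refl_conj; move: (refl h) (refl_conj h M) => r K <- r2 E.
  rewrite !mapp_mul -(mapp_mul r r) r2 mapp1 E.
  by case: r {r2 W} => [[[? ?] ?] ?] /=; congr (_, _); ring.
case: W => W; first by rewrite -W.
by have := eig_opp E'; rewrite W /= !opprK; case: (w).
Qed.

Arguments act : simpl never.
Lemma moppK M : mopp (mopp M) = M.
Proof. by case: M => [[[a b] c] d] /=; rewrite !opprK. Qed.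
Lemma mmul_opp A M : mmul A (mopp M) = mopp (mmul A M).
Proof. by case: A => [[[? ?] ?] ?]; case: M => [[[? ?] ?] ?] /=; congr (_, _, _, _); ring. Qed.
Lemma act_opp w M : act w (mopp M) = mopp (act w M).
Proof. by elim: w M => // h w IH M; rewrite !act_cons mmul_opp IH. Qed.
Lemma opp_mmul A M : mmul (mopp A) M = mopp (mmul A M).
Proof. by case: A => [[[? ?] ?] ?]; case: M => [[[? ?] ?] ?] /=; congr (_, _, _, _); ring. Qed.
Lemma cj_opp h M : cj h (mopp M) = mopp (cj h M).
Proof. by rewrite /cj opp_mmul mmul_opp. Qed.
Lemma attracting_opp M : attracting (mopp M) = attracting M.
Proof. by case: M => [[[a b] c] d] /=; lia. Qed.
Lemma sink_opp P M : sink P (mopp M) = sink P M.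
Proof. by apply: eq_all => h; rewrite cj_opp attracting_opp. Qed.
Lemma neutral_opp h M : neutral h (mopp M) = neutral h M.
Proof. by rewrite /neutral cj_opp mmul_opp !attracting_opp. Qed.
Lemma neutral_refl h M : mdet h = 1 -> neutral h (mmul (refl h) M) = neutral h M.
Proof. by move=> D; rewrite /neutral cj_refl // RmK andbC. Qed.
Lemma act_cat w1 w2 M : act (w1 ++ w2) M = act w2 (act w1 M).
Proof. by rewrite /act foldl_cat. Qed.
Lemma eig_mval M v l : dominant_eigen M v l -> mval M v = 0.
Proof. by case=> E _; rewrite /mval E /=; ring. Qed.
(** Two independent eigenvectors give det = l l', whereas |det| is smaller than both l^2 and
    l'^2. *)
Lemma eig_par M v v' l l' : dominant_eigen M v l -> dominant_eigen M v' l' -> v.1 * v'.2 = v.2 * v'.1.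
Proof.
case=> E lt [E' lt']; apply/eqP; rewrite -subr_eq0; apply/negPn/negP => ne.
have : mdet M = l * l'.
  apply: (mulIf ne); case: M E E' {lt lt'} => [[[a b] c] d] /= [E1 E2] [E3 E4].
  transitivity ((a * v.1 + b * v.2) * (c * v'.1 + d * v'.2) - (c * v.1 + d * v.2) * (a * v'.1 + b * v'.2)); first by ring.
  by rewrite E1 E2 E3 E4; ring.
move=> D; have : `|mdet M| * `|mdet M| < l ^+ 2 * l' ^+ 2 by apply: ltr_pM.
by rewrite D -expr2 real_normK ?num_real // exprMn ltxx.
Qed.
(** For trace zero a rational eigenvalue k makes the determinant -k^2. *)
Lemma nsq_nocusp M : tr0 M -> nonsquare `|mdet M| -> nocusp V6 M /\ nocusp V3 M.
Proof.
move=> /tr0P[a [b [c ->]]] q.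
have F k : a ^+ 2 + b * c <> k ^+ 2.
  move=> E; move: (q k) => /eqP; apply; rewrite -E /= -normrN.
  by rewrite (_ : - _ = a ^+ 2 + b * c); [rewrite E ger0_norm // sqr_ge0|ring].
suff H : nocusp V6 (a, b, c, - a).
  by split => //; apply/allP => v /V3_6; apply/allP: v.
rewrite /nocusp /mval /=; apply/and5P; split; [| | | |apply/and3P; split => //]; apply/eqP => E.
- apply: (F a); have -> : c = 0 by move: E; clear; lia.
  by ring.
- apply: (F (a - 2 * c)); have -> : b = 4 * c - 4 * a by move: E; clear; lia.
  by ring.
- apply: (F (a + b)); have -> : c = 2 * a + b by move: E; clear; lia.
  by ring.
- apply: (F (a + 2 * b)); have -> : c = 4 * a + 4 * b by move: E; clear; lia.
  by ring.
- apply: (F a); have -> : b = 0 by move: E; clear; lia.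
  by ring.
- apply: (F (a + c)); have -> : b = 2 * a + c by move: E; clear; lia.
  by ring.
Qed.

(** * The sinks of a coset *)

Section Cosets.
Variables (P : seq mat) (V : seq vec) (full half : int -> int -> int -> bool).
Let ell M := onsel full M || onsel half M.
Hypothesis det1 : forall h, h \in P -> mdet h = 1.
Hypothesis Puniq : uniq P.
Hypothesis nest : forall h h' M, h \in P -> h' \in P -> h != h' ->
  attracting (cj h M) -> attracting (mmul Rm (cj h' M)).
Hypothesis exsink : forall M, mdet M != 0 -> exists2 w, inw P w & sink P (act w M).
Hypothesis sinkE : forall M, ell M -> sink P M.
Hypothesis nfull : forall M h, h \in P -> onsel full M -> ~~ neutral h M.
Hypothesis nhalf : forall M, onsel half M -> count (fun h => neutral h M) P = 1%N.
Hypothesis thalf : forall h M, h \in P -> onsel half M -> neutral h M -> tr0 (mmul (refl h) M).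
Hypothesis Za : forall h N, h \in P -> tr0 N -> mdet N < 0 -> nocusp V N -> neutral h N ->
  onsel half (mmul (refl h) N) || onsel half (mopp (mmul (refl h) N)).
Hypothesis Zb : forall N, tr0 N -> mdet N < 0 -> nocusp V N -> sink P N -> has (fun h => neutral h N) P.
Hypothesis Zc : forall N, tr0 N -> mdet N < 0 -> nocusp V N -> count (fun h => neutral h N) P \in [:: 0; 2]%N.
Hypothesis cl : forall M, sink P M -> nonsquare `|mdet M| ->
  [\/ ell M \/ ell (mopp M), tr0 M /\ mdet M < 0 | exists v l, v \in V /\ dominant_eigen M v l].
Hypothesis ncusp : forall M, tr0 M -> nonsquare `|mdet M| -> nocusp V M.
Hypothesis vert : forall h v, h \in P -> v \in V -> let u := mapp (madj h) v in
  negv u \/ [/\ u.1 * u.2 = 0, u != (0, 0) & eqv (mapp (refl h) v) v].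
Hypothesis ellval : forall M v, v \in V -> ell M -> 0 < mval M v.

(** Matrices are taken up to sign since the elliptic conditions select one of [M] and [mopp M]. *)
Definition same_coset M M' := exists2 w, inw P w & M' = act w M \/ M' = mopp (act w M).

Lemma coset_refl M : same_coset M M.
Proof. by exists [::] => //; left. Qed.
Lemma coset_opp M M' : same_coset M M' -> same_coset M (mopp M').
Proof. by case=> w wP [] ->; exists w; rewrite ?moppK //; [right|left]. Qed.
Lemma act_rev w M : inw P w -> act (rev w) (act w M) = M.
Proof.
elim: w M => // h w IH M /= /andP[hP wP].
by rewrite rev_cons -cats1 act_cat (act_cons h w) IH // act_cons reflK //; apply: det1.
Qed.
Lemma coset_trans M1 M M' : same_coset M M1 -> same_coset M M' -> same_coset M1 M'.
Proof.
case=> w1 w1P E1 [w wP E]; exists (rev w1 ++ w).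
  by rewrite /inw all_cat all_rev; apply/andP.
case: E1 => ->; rewrite act_cat ?act_opp act_rev //; case: E => ->; rewrite ?act_opp ?moppK; auto.
Qed.
Lemma coset_reduced M M' : same_coset M M' -> exists2 w, inw P w /\ reduced w & M' = act w M \/ M' = mopp (act w M).
Proof. by case=> w wP E; have [w' H EE] := reduceP det1 wP; exists w' => //; rewrite EE. Qed.
Lemma coset_det M M' : same_coset M M' -> `|mdet M'| = `|mdet M|.
Proof. by case=> w wP [] ->; rewrite ?mdet_opp (mdet_act det1). Qed.
Lemma coset_step h M M' : h \in P -> same_coset M M' -> same_coset M (mmul (refl h) M').
Proof.
move=> hP [w wP E]; exists (rcons w h); first by rewrite /inw all_rcons; apply/andP.
by rewrite -cats1 act_cat; case: E => ->; [left|right; rewrite mmul_opp].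
Qed.
Hypothesis elldet : forall M, ell M -> 0 <= mdet M.
Hypothesis ellopp : forall M, ell M -> ~~ ell (mopp M).

Lemma eig_opp_mat M v l : dominant_eigen M v l -> dominant_eigen (mopp M) v (- l).
Proof.
case=> E lt; split; last by rewrite mdet_opp sqrrN.
by move: E; case: (M) => [[[a b] c] d] [E1 E2] /=; rewrite !mulNr -E1 -E2; congr (_, _); ring.
Qed.
Lemma eig_sink M v l : v \in V -> dominant_eigen M v l -> sink P M.
Proof.
move=> vV E; apply/allP => h hP; have := eig_cj (det1 hP) E; case: (vert hP vV) => [n|[u0 un _]] E'.
  by rewrite -[cj h M]RmK; apply: attracting_flip; apply: att_eig n E'.
exact: att_eig0 E'.
Qed.
(** By [att_eig] a neutral side must contain the attracting vertex v, so the reflection fixes v up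
    to sign and v stays dominant. *)
Lemma eig_step h M v l : h \in P -> v \in V -> dominant_eigen M v l -> neutral h M -> exists l', dominant_eigen (mmul (refl h) M) v l'.
Proof.
move=> hP vV E /andP[_ nR]; have E' := eig_cj (det1 hP) E.
case: (vert hP vV) => [n|[_ _ e]]; first by rewrite (att_eig n E') in nR.
have lt : `|mdet (mmul (refl h) M)| < l ^+ 2 by rewrite mdetM (mdet_refl (det1 hP)) mulN1r normrN; case: E.
case: e => e; [exists l|exists (- l)]; (split; last by rewrite ?sqrrN);
  rewrite mapp_mul; case: E => -> _; move: e; case: (refl h) => [[[a b] c] d] /=; case: (v) => x y /= [e1 esym2].
  by congr (_, _); [rewrite -[in RHS]e1|rewrite -[in RHS]esym2]; ring.
by congr (_, _); rewrite mulNr -mulrN; [rewrite -[in RHS]e1|rewrite -[in RHS]esym2]; ring.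
Qed.
Lemma eig_path w M v l : inw P w -> reduced w -> v \in V -> dominant_eigen M v l -> sink P (act w M) -> exists l', dominant_eigen (act w M) v l'.
Proof.
elim: w M l => [|h w IH] M l wP rw vV E s; first by exists l.
have [n s'] := sink_step det1 nest wP rw (eig_sink vV E) s.
case/andP: wP => hP wP; have [l' E'] := eig_step hP vV E n.
by apply: (IH _ l') => //; apply: path_sorted rw.
Qed.

(** With its fixed point inside the polygon, [M1] has no neutral edge, so it is the only sink of its
    tree. *)
Lemma coset_full M1 M' : onsel full M1 -> same_coset M1 M' -> sink P M' -> M' = M1 \/ M' = mopp M1.
Proof.
move=> F /coset_reduced[w [wP rw] E] s.
have {}s : sink P (act w M1) by case: E s => ->; rewrite ?sink_opp.
case: w wP rw E s => [|h w] wP rw E s; first by [].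
have sM : sink P M1 by apply: sinkE; rewrite /ell F.
have [n _] := sink_step det1 nest wP rw sM s.
by case/andP: wP => hP _; move: (nfull hP F); rewrite n.
Qed.

Lemma coset_eig M1 M' v l : v \in V -> dominant_eigen M1 v l -> same_coset M1 M' -> sink P M' -> exists l', dominant_eigen M' v l'.
Proof.
move=> vV E1 /coset_reduced[w [wP rw] E] s.
have {}s : sink P (act w M1) by case: E s => ->; rewrite ?sink_opp.
have [l' E'] := eig_path wP rw vV E1 s.
by case: E => ->; [exists l'|exists (- l'); apply: eig_opp_mat].
Qed.

(** The fixed point of [M1] lies on the side h, its only neutral edge. Beyond this edge is N, a
    reflection whose axis crosses the polygon through h and one further side h'; reflecting in h'
    gives [M3], whose only neutral edge leads back. The path [M1], N, [M3] therefore contains all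
    sinks. *)
Lemma coset_half M1 : onsel half M1 -> nonsquare `|mdet M1| -> 0 < mdet M1 ->
  exists M3, [/\ onsel half M3, M3 <> M1, same_coset M1 M3 &
   forall M', same_coset M1 M' -> sink P M' -> nocusp V M' /\ mdet M' < 0 \/ [\/ M' = M1, M' = mopp M1, M' = M3 | M' = mopp M3]].
Proof.
move=> H1 q D1.
have sM1 : sink P M1 by apply: sinkE; rewrite /ell H1 orbT.
have [h /andP[hP n1] u1] := count1P (nhalf H1).
have D := det1 hP.
pose N := mmul (refl h) M1.
have tN : tr0 N by apply: thalf.
have dN : mdet N < 0 by rewrite /N mdetM mdet_refl // mulN1r oppr_lt0.
have qN : nonsquare `|mdet N| by rewrite /N mdetM mdet_refl // mulN1r normrN.
have nN : neutral h N by rewrite neutral_refl.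
have cN := ncusp tN qN.
have := Zc tN dN cN; rewrite !inE => /orP[/eqP c0|/eqP c2].
  have : has (fun h => neutral h N) P by apply/hasP; exists h.
  by rewrite has_count c0.
have c1 : count (fun j => neutral j N) (rem h P) = 1%N by rewrite count_rem hP nN c2.
have [h' /andP[h'P n'] u'] := count1P c1.
have hh' : h' != h by move: h'P; rewrite mem_rem_uniq // inE => /andP[].
have {}h'P : h' \in P by apply: mem_rem h'P.
have uN j : j \in P -> neutral j N -> j != h -> j = h'.
  by move=> jP nj jh; apply: u' => //; rewrite mem_rem_uniq // inE jh.
have cN1 : same_coset M1 N by apply: coset_step => //; apply: coset_refl.
pose N2 := mmul (refl h') N.
have c3 : same_coset M1 N2 by apply: coset_step.
have n2 : neutral h' N2 by rewrite neutral_refl ?det1.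
have [M3 [H3 E3]] : exists M3, onsel half M3 /\ (M3 = N2 \/ M3 = mopp N2).
  by case/orP: (Za h'P tN dN cN n') => ?; [exists N2|exists (mopp N2)]; auto.
have c3' : same_coset M1 M3 by case: E3 => -> //; apply: coset_opp.
have n3 : neutral h' M3 by case: E3 => ->; rewrite ?neutral_opp.
have u3 j : j \in P -> neutral j N2 -> j = h'.
  have [k _ uk] := count1P (nhalf H3).
  move=> jP nj; transitivity k; last by symmetry; apply: uk.
  by apply: uk => //; case: E3 => ->; rewrite ?neutral_opp.
exists M3; split => //.
  by move=> E; move: hh'; rewrite (u1 h') ?eqxx // -E.
move=> M' /coset_reduced[w [wP rw] E] s.
have {}s : sink P (act w M1) by case: E s => ->; rewrite ?sink_opp.
case: w wP rw E s => [|h1 w] wP rw E s; first by right; case: E; [constructor 1|constructor 2].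
have [na sa] := sink_step det1 nest wP rw sM1 s.
have h1h : h1 = h by case/andP: wP => ? _; apply: u1.
subst h1.
case: w wP rw E s => [|h2 w] wP rw E s.
  left; have NN : tr0 (mopp N) by case: (N) tN => [[[a b] c] d] /=; clear; lia.
  by case: E => ->; rewrite ?mdet_opp -[act _ _]/N; split => //; apply: ncusp; rewrite ?mdet_opp.
have [nb sb] := sink_step det1 nest (proj2 (andP wP)) (path_sorted rw) sa s.
have h2h : h2 = h'.
  apply: uN => //; first by case/and3P: wP.
  by move: rw => /= /andP[]; rewrite eq_sym.
subst h2.
case: w wP rw E s => [|h3 w] wP rw E s.
  by right; case: E E3 => -> [] ->; rewrite -[act _ _]/N2 ?moppK; [constructor 3|constructor 4|constructor 4|constructor 3].
have wP3 : inw P (h3 :: w) by case/and3P: wP.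
have [nc _] := sink_step det1 nest wP3 (path_sorted (path_sorted rw)) sb s.
have h3h : h3 = h' by apply: u3 => //; case/andP: wP3.
by move: rw; rewrite h3h /= eqxx !andbF.
Qed.

(** Classification by the subtree of sinks: one elliptic matrix with fixed point inside, a path with
    two elliptic matrices at its ends and a reflection in the middle, or matrices that share one
    attracting vertex. A sink of trace zero belongs to the second kind, since its axis crosses some
    side. *)
Theorem coset_sinks M0 : nonsquare `|mdet M0| ->
  [\/ exists M1, [/\ same_coset M0 M1, onsel full M1 &
         forall M', same_coset M0 M' -> (ell M' -> M' = M1) /\ (forall v l, v \in V -> ~ dominant_eigen M' v l)],
      exists M1 M3, [/\ same_coset M0 M1 /\ same_coset M0 M3, onsel half M1 /\ onsel half M3, M3 <> M1 &
         forall M', same_coset M0 M' -> (ell M' -> M' = M1 \/ M' = M3) /\ (forall v l, v \in V -> ~ dominant_eigen M' v l)]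
    | exists M1 v l, [/\ same_coset M0 M1, v \in V, dominant_eigen M1 v l &
         forall M', same_coset M0 M' -> ~~ ell M' /\ (forall v' l', v' \in V -> dominant_eigen M' v' l' -> v.1 * v'.2 = v.2 * v'.1)]].
Proof.
move=> q.
have ell_case M1 : same_coset M0 M1 -> ell M1 -> 0 < mdet M1 -> onsel full M1 \/ onsel half M1.
  by move=> _ /orP[]; [left|right].
have eno M1 : ell M1 -> forall v l, v \in V -> ~ dominant_eigen M1 v l.
  by move=> eM v l vV /eig_mval E; have := ellval vV eM; rewrite E ltxx.
have eno' M1 : ell M1 -> forall v l, v \in V -> ~ dominant_eigen (mopp M1) v l.
  by move=> eM v l vV /eig_opp_mat; rewrite moppK; apply: eno.
have main M1 : same_coset M0 M1 -> ell M1 -> 0 < mdet M1 ->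
  [\/ exists M1, [/\ same_coset M0 M1, onsel full M1 &
         forall M', same_coset M0 M' -> (ell M' -> M' = M1) /\ (forall v l, v \in V -> ~ dominant_eigen M' v l)],
      exists M1 M3, [/\ same_coset M0 M1 /\ same_coset M0 M3, onsel half M1 /\ onsel half M3, M3 <> M1 &
         forall M', same_coset M0 M' -> (ell M' -> M' = M1 \/ M' = M3) /\ (forall v l, v \in V -> ~ dominant_eigen M' v l)]
    | exists M1 v l, [/\ same_coset M0 M1, v \in V, dominant_eigen M1 v l &
         forall M', same_coset M0 M' -> ~~ ell M' /\ (forall v' l', v' \in V -> dominant_eigen M' v' l' -> v.1 * v'.2 = v.2 * v'.1)]].
  move=> c1 e1 D1; case: (ell_case _ c1 e1 D1) => F.
    constructor 1; exists M1; split => // M' c'; have c1' := coset_trans c1 c'; split.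
      by move=> eM'; case: (coset_full F c1' (sinkE eM')) => // E; move: (ellopp e1); rewrite -E eM'.
    move=> v l vV E; case: (coset_full F c1' (eig_sink vV E)) => EM; rewrite EM in E.
      exact: eno e1 _ _ vV E.
    exact: eno' e1 _ _ vV E.
  have q1 : nonsquare `|mdet M1| by rewrite (coset_det c1).
  have [M3 [H3 ne c3 U]] := coset_half F q1 D1.
  have e3 : ell M3 by rewrite /ell H3 orbT.
  constructor 2; exists M1, M3; split => //.
    split=> //; have [w wP E] := c3; have [w1 w1P E1] := c1.
    exists (w1 ++ w); first by rewrite /inw all_cat; apply/andP.
    by rewrite act_cat; case: E1 E => -> [] ->; rewrite ?act_opp ?moppK; auto.
  move=> M' c'; have c1' := coset_trans c1 c'; split.
    move=> eM'; case: (U _ c1' (sinkE eM')) => [[_ D]|[] E]; auto.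
    - by move: (elldet eM'); rewrite leNgt D.
    - by move: (ellopp e1); rewrite -E eM'.
    by move: (ellopp e3); rewrite -E eM'.
  move=> v l vV E; case: (U _ c1' (eig_sink vV E)) => [[/allP/(_ v vV) nc _]|[] EM].
    by rewrite (eig_mval E) eqxx in nc.
  - by rewrite EM in E; apply: eno e1 _ _ vV E.
  - by rewrite EM in E; apply: eno' e1 _ _ vV E.
  - by rewrite EM in E; apply: eno e3 _ _ vV E.
  - by rewrite EM in E; apply: eno' e3 _ _ vV E.
have [w wP s] := exsink (M := M0) ltac:(by rewrite -normr_eq0; apply: nsq0).
pose M := act w M0; have cM : same_coset M0 M by exists w => //; left.
have qM : nonsquare `|mdet M| by rewrite (coset_det cM).
have posd M1 : same_coset M0 M1 -> ell M1 -> 0 < mdet M1.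
  move=> c1 e1; rewrite lt_neqAle elldet // andbT eq_sym -normr_eq0 (coset_det c1); exact: nsq0.
case: (cl s qM) => [[e|e]|[t D]|[v [l [vV E]]]].
- by apply: (main M) => //; apply: posd.
- by apply: (main (mopp M)) => //; first exact: coset_opp; apply: posd => //; apply: coset_opp.
- have nc := ncusp t qM; have /hasP[h hP n] := Zb t D nc s.
  have c' := coset_step hP cM.
  by case/orP: (Za hP t D nc n) => H; [apply: (main (mmul (refl h) M))|apply: (main (mopp (mmul (refl h) M)))] => //;
    rewrite ?/ell ?H ?orbT //; try apply: posd; rewrite ?/ell ?H ?orbT //; apply: coset_opp.
constructor 3; exists M, v, l; split => // M' c'; have c1' := coset_trans cM c'; split.
  apply/negP => e; have [l' E'] := coset_eig vV E c1' (sinkE e).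
  exact: eno e _ _ vV E'.
move=> v' l' v'V E'; have [l2 E2] := coset_eig vV E c1' (eig_sink v'V E').
exact: eig_par E2 E'.
Qed.
End Cosets.

Definition eqvb (v w : vec) := (v == w) || (v == (- w.1, - w.2)).
Lemma eqvP v w : eqvb v w -> eqv v w.
Proof. by case/orP=> /eqP; [left|right]. Qed.
Lemma vertP (P : seq mat) (V : seq vec) :
  all (fun h => all (fun v => let u := mapp (madj h) v in
     negv u || [&& u.1 * u.2 == 0, u != (0, 0) & eqvb (mapp (refl h) v) v]) V) P ->
  forall h v, h \in P -> v \in V -> let u := mapp (madj h) v in
  negv u \/ [/\ u.1 * u.2 = 0, u != (0, 0) & eqv (mapp (refl h) v) v].
Proof.
move=> /allP H h v hP vV; have /allP/(_ v vV)/orP := H h hP.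
by case=> [|/and3P[/eqP ? ? /eqvP]]; [left|right].
Qed.
Lemma ell3val M v : v \in V3 -> ell3 M -> 0 < mval M v.
Proof.
case: M => [[[a b] c] d]; rewrite !inE /ell3 /onsel /full3 /half3 /mval.
by case/or3P=> /eqP-> /=; clear; lia.
Qed.
Lemma ell6val M v : v \in V6 -> ell6 M -> 0 < mval M v.
Proof.
case: M => [[[a b] c] d]; rewrite !inE /ell6 /onsel /mval.
move=> vV H.
have {}H : [|| full6 (2 * c - a + d) (-2 * b - a + d) (a - d), thin (2 * c - a + d) (-2 * b - a + d) (a - d)
  , thin (-2 * b - a + d) (2 * c - a + d) (a - d), thin (2 * c - a + d) (a - d) (-2 * b - a + d)
  , thin (a - d) (2 * c - a + d) (-2 * b - a + d), thin (-2 * b - a + d) (a - d) (2 * c - a + d)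
  | thin (a - d) (-2 * b - a + d) (2 * c - a + d)].
  by move: H; rewrite /half6 orbA.
move: vV; do ![case/orP]; move=> /eqP-> /=; move: H; rewrite /full6 /thin; clear; lia.
Qed.
Lemma ell3det M : ell3 M -> 0 <= mdet M.
Proof.
case: M => [[[a b] c] d] e; rewrite -(pmulr_rge0 (x := 4)) // /mdet sel_det addr_ge0 ?sqr_ge0 //.
move: e; rewrite /ell3 /onsel /full3 /half3; move: (2 * c - a + d) (- 2 * b - a + d) (a - d) => x y z; clear => H.
have [? [? ?]] : 0 <= x /\ 0 <= y /\ 0 <= z by lia.
by rewrite !addr_ge0 ?mulr_ge0.
Qed.
Lemma ell6det M : ell6 M -> 0 <= mdet M.
Proof.
case: M => [[[a b] c] d] e; rewrite -(pmulr_rge0 (x := 4)) // /mdet sel_det addr_ge0 ?sqr_ge0 //.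
move: e; rewrite /ell6 /onsel /full6 /half6 /thin; move: (2 * c - a + d) (- 2 * b - a + d) (a - d) => x y z; clear => H.
apply: hex_e2_ge0; move: H; do ![case/orP]; lia.
Qed.
Lemma ell3opp M : ell3 M -> ~~ ell3 (mopp M).
Proof.
case: M => [[[a b] c] d]; rewrite /ell3 /onsel /full3 /half3 /mopp /=; clear; lia.
Qed.
Lemma ell6opp M : ell6 M -> ~~ ell6 (mopp M).
Proof.
move=> e; apply/negP => e'; have v0 : (1, 0) \in V6 by [].
have := ell6val v0 e; have := ell6val v0 e'; case: (M) => [[[a b] c] d]; rewrite /mval /=; clear; lia.
Qed.
Definition coset3 := coset_sinks det1P3 isT attracting_nest3 sink3 sinkE3 neut_full3 neut_half3 tr0_half3
  tr0_neutral_step3 tr0_sink_neutral3 tr0_neutral_count3 sink3_cases (fun M t q => (nsq_nocusp t q).2) (@vertP P3 V3 isT) ell3val ell3det ell3opp.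
Definition coset6 := coset_sinks det1P6 isT attracting_nest6 sink6 sinkE6 neut_full6 neut_half6 tr0_half6
  tr0_neutral_step6 tr0_sink_neutral6 tr0_neutral_count6 sink6_cases (fun M t q => (nsq_nocusp t q).1) (@vertP P6 V6 isT) ell6val ell6det ell6opp.

(** * Congruence modulo 2 and triangular representatives *)

Definition cong_id_mod2 (M : mat) : bool := let: (a, b, c, d) := M in
  [&& (a %% 2 == 1)%Z, (b %% 2 == 0)%Z, (c %% 2 == 0)%Z & (d %% 2 == 1)%Z].
(* M (-1, 1) is proportional to (-1, 1) modulo 3. *)
Definition fixes_mod3 (M : mat) : bool := let: (a, b, c, d) := M in (3 %| b - a + d - c)%Z.

Lemma par_refl3 h M : h \in P3 -> cong_id_mod2 M -> cong_id_mod2 (mmul (refl h) M).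
Proof. by case: M => [[[a b] c] d]; move: h; apply: in_P3; rewrite /cong_id_mod2 /refl /=; clear; lia. Qed.
Lemma par_conj3 h M : h \in P3 -> cong_id_mod2 M -> cong_id_mod2 (mmul M (refl h)).
Proof. by case: M => [[[a b] c] d]; move: h; apply: in_P3; rewrite /cong_id_mod2 /refl /=; clear; lia. Qed.
Lemma par_opp M : cong_id_mod2 (mopp M) = cong_id_mod2 M.
Proof. by case: M => [[[a b] c] d] /=; lia. Qed.
Lemma par_act w M : inw P3 w -> cong_id_mod2 M -> cong_id_mod2 (act w M).
Proof. by elim: w M => // h w IH M /= /andP[hP wP] p; rewrite act_cons; apply: IH => //; apply: par_refl3. Qed.
Lemma par_cos M M' : same_coset P3 M M' -> cong_id_mod2 M -> cong_id_mod2 M'.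
Proof. by case=> w wP [] -> p; rewrite ?par_opp par_act. Qed.
Lemma fx_opp M : fixes_mod3 (mopp M) = fixes_mod3 M.
Proof. by case: M => [[[a b] c] d] /=; lia. Qed.
Lemma fx_refl6 h M : h \in P6 -> fixes_mod3 M -> fixes_mod3 (mmul (refl h) M).
Proof. by case: M => [[[a b] c] d]; move: h; apply: in_P6; rewrite /fixes_mod3 /refl /=; clear; lia. Qed.
Lemma fx_act6 w M : inw P6 w -> fixes_mod3 M -> fixes_mod3 (act w M).
Proof. by elim: w M => // h w IH M /= /andP[hP wP] p; rewrite act_cons; apply: IH => //; apply: fx_refl6. Qed.

Lemma coset3_trans M1 M M' : same_coset P3 M M1 -> same_coset P3 M M' -> same_coset P3 M1 M'.
Proof. exact: (coset_trans det1P3). Qed.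
Lemma coset3_sym M M' : same_coset P3 M M' -> same_coset P3 M' M.
Proof. by move=> c; apply: coset3_trans c (coset_refl P3 _). Qed.
Lemma coset3_chain M1 M M' : same_coset P3 M M1 -> same_coset P3 M1 M' -> same_coset P3 M M'.
Proof. by move=> /coset3_sym; apply: coset3_trans. Qed.

Definition hR : mat := (0, -1, 1, 0).
Definition hT : mat := (1, 1, 0, 1).
Lemma reflR a b c d : mmul (refl hR) (a, b, c, d) = (- a, - b, c, d).
Proof. by rewrite /=; congr (_, _, _, _); lia. Qed.
Lemma reflT a b c d : mmul (refl hT) (a, b, c, d) = (a - 2 * c, b - 2 * d, - c, - d).
Proof. by rewrite /=; congr (_, _, _, _); lia. Qed.

Lemma coset_triangular M : cong_id_mod2 M -> mdet M != 0 -> exists a b d, same_coset P3 M (a, b, 0, d).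
Proof.
case: M => [[[a b] c] d]; have [m] := ubnP `|qp (a, c)|%N.
elim: m a b c d => // m IH a b c d lt p D.
have [/hasP[h hP pv]|np] := boolP (has (fun h => posv (mapp (madj h) (a, c))) P3); last first.
  (* A column outside all open arcs is a multiple of a vertex; an odd first and an even second entry
     leave only the vertex oo. *)
  have c0 : c = 0.
    move: np p D; rewrite /posv /= /mdet; clear => np p D.
    have : ~~ ((a == 0) && (c == 0)).
      by apply: contraNN D => /andP[/eqP-> /eqP->]; rewrite mul0r mulr0 subrr.
    by move: np p; clear; lia.
  by exists a, b, d; rewrite c0; apply: coset_refl.
have D1 := det1P3 hP.
pose N := mmul (refl h) (a, b, c, d).
have uE : mapp N (1, 0) = mapp (refl h) (a, c).
  by rewrite /N; case: (refl h) => [[[x y] z] t] /=; congr (_, _); ring.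
have lt1 : qp (mapp (refl h) (a, c)) < qp (a, c).
  rewrite -[X in _ < qp X]mapp1 -(refl2 D1) mapp_mul; apply: qincP3 => //.
  rewrite -mapp_mul /refl !mmulA madj_mul // mmul1m mapp_mul.
  by move: pv; case: (mapp _ _) => x y; rewrite /posv /negv /=; lia.
have pN : cong_id_mod2 N by apply: par_refl3.
have dN : mdet N != 0 by rewrite /N mdetM mdet_refl // mulN1r oppr_eq0.
have cN : same_coset P3 (a, b, c, d) N by apply: coset_step => //; apply: coset_refl.
have q0 x y : 0 <= qp (x, y).
  rewrite -(pmulr_rge0 (x := 2)) // (_ : _ * _ = (x - y) ^+ 2 + x ^+ 2 + y ^+ 2) ?addr_ge0 ?sqr_ge0 //.
  by rewrite /qp /=; ring.
move: uE lt1 (q0 a c); case E : N pN dN cN => [[[a' b'] c'] d'] pN dN cN uE lt1 q1.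
have {}uE : (a', c') = mapp (refl h) (a, c) by rewrite -uE /=; congr (_, _); lia.
have [|||x [y [z cz]]] := IH a' b' c' d' => //.
  by rewrite uE; move: lt lt1 q1 (q0 a' c'); rewrite uE; clear; lia.
by exists x, y, z; apply: coset3_chain cN cz.
Qed.

Lemma coset3_step h M M' : h \in P3 -> same_coset P3 M M' -> same_coset P3 M (mmul (refl h) M').
Proof. exact: coset_step. Qed.
(** The sides [hR] and [hT] meet at oo, and the product of their reflections is the translation by
    2. *)
Lemma coset_translate a b d (j : int) : same_coset P3 (a, b, 0, d) (a, b + 2 * j * d, 0, d).
Proof.
have down b1 (k : nat) : same_coset P3 (a, b1, 0, d) (a, b1 - 2 * k%:Z * d, 0, d).
  elim: k => [|k IH]; first by rewrite mulr0 mul0r subr0; apply: coset_refl.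
  apply: coset3_chain IH _.
  have := coset_opp (@coset3_step hR _ _ isT (@coset3_step hT _ _ isT (coset_refl P3 (a, b1 - 2 * k%:Z * d, 0, d)))).
  rewrite reflT reflR /=; congr (same_coset _ _ (_, _, _, _)); rewrite ?intS; ring.
case: j => k; last by rewrite NegzE mulrN mulNr; apply: down.
by apply: coset3_sym; have := down (b + 2 * k%:Z * d) k; rewrite addrK.
Qed.

(** * Cosets and Hermite forms *)

Definition hermite_reps (n : nat) : seq mat :=
  [seq (((n %/ p.1)%N)%:Z, 2 * (p.2 : nat)%:Z, 0, (p.1 : nat)%:Z) | p <- [seq (d, b) | d <- divisors n, b <- iota 0 d]].
Lemma hermiteP n a b c d : (0 < n)%N -> reflect [/\ c = 0, 0 < d, a * d = n%:Z & exists b', [/\ b = 2 * b', 0 <= b' & b' < d]]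
   ((a, b, c, d) \in hermite_reps n).
Proof.
move=> n0; apply: (iffP mapP) => [[[d' b'] /allpairsPdep[x [y [xn yb [-> ->]]]]] [-> -> -> ->]|].
  move: xn yb; rewrite -dvdn_divisors // mem_iota => xn yb.
  have x0 : (0 < x)%N by apply: dvdn_gt0 xn.
  split; rewrite //= -?PoszM ?divnK //.
  by exists y%:Z; split => //; move: yb; clear; lia.
case=> -> d0 ad [b' [-> b0 bd]]; exists (`|d|%N, `|b'|%N) => /=.
  apply/allpairsPdep; exists `|d|%N, `|b'|%N; split => //; last by rewrite mem_iota; lia.
  by rewrite -dvdn_divisors //; apply/dvdnP; exists `|a|%N; move: ad; rewrite -abszM => ->.
have ad' : n = (`|a| * `|d|)%N by rewrite -abszM ad.
have a0 : 0 <= a by rewrite -(pmulr_lge0 _ d0) ad.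
by rewrite ad' mulnK ?absz_gt0 ?gt_eqF //; congr (_, _, _, _); lia.
Qed.
Lemma herm_uniq n : (0 < n)%N -> uniq (hermite_reps n).
Proof.
move=> n0; rewrite map_inj_in_uniq; last by move=> [d b] [d' b'] _ _ /= [_ E ->]; congr (_, _); lia.
by apply: allpairs_uniq_dep => // [|d _|[d b] [d' b'] _ _ /= [-> ->]]; rewrite ?divisors_uniq ?iota_uniq.
Qed.
Lemma size_herm n : size (hermite_reps n) = sigma n.
Proof.
rewrite /hermite_reps size_map size_allpairs_dep sumnE big_map.
by apply: eq_bigr => d _; rewrite size_iota.
Qed.

Lemma coset3_det M M' : same_coset P3 M M' -> `|mdet M'| = `|mdet M|.
Proof. exact: (coset_det det1P3). Qed.

Lemma hermite_exists n M : (0 < n)%N -> cong_id_mod2 M -> `|mdet M| = n%:Z -> exists2 k, k \in hermite_reps n & same_coset P3 k M.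
Proof.
move=> n0 p D; have D0 : mdet M != 0 by rewrite -normr_eq0 D; lia.
have [a [b [d c0]]] := coset_triangular p D0.
have [a1 [b1 [d1 [c1 ad d0]]]] : exists a b d, [/\ same_coset P3 M (a, b, 0, d), a * d = n%:Z & 0 < d].
  have := coset3_det c0; rewrite D /= mulr0 subr0 => ad.
  have : a * d = n%:Z \/ - a * d = n%:Z by rewrite mulNr; lia.
  have c1 : same_coset P3 M (- a, - b, 0, d) by rewrite -reflR; apply: coset3_step.
  have d0 : d != 0 by apply: contraTneq n0 => d0; move: ad; rewrite d0 mulr0; lia.
  have dd (x y : int) : same_coset P3 M (x, y, 0, d) -> x * d = n%:Z -> exists a b d, [/\ same_coset P3 M (a, b, 0, d), a * d = n%:Z & 0 < d].
    move=> c xd; have [dp|dn] := ltrP 0 d; first by exists x, y, d.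
    exists (- x), (- y), (- d); split; last by move: d0 dn; clear; lia.
      by have := coset_opp c; rewrite /= oppr0.
    by rewrite mulrNN.
  by case=> E; [apply: (dd a b)|apply: (dd (- a) (- b))].
have p1 := par_cos c1 p; exists (a1, (b1 %% (2 * d1))%Z, 0, d1).
  apply/hermiteP => //; split => //; have p2 : (b1 %% 2 == 0)%Z by case/and4P: p1.
  have E := divz_eq b1 (2 * d1); exists ((b1 %% (2 * d1))%Z %/ 2)%Z.
  have m0 : 0 <= (b1 %% (2 * d1))%Z by apply: modz_ge0; lia.
  have m1 : (b1 %% (2 * d1))%Z < 2 * d1 by apply: ltz_pmod; lia.
  have ev : ((b1 %% (2 * d1))%Z %% 2 == 0)%Z.
    have -> : (b1 %% (2 * d1))%Z = 2 * ((b1 %/ 2)%Z - (b1 %/ (2 * d1))%Z * d1).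
      move: E; set r := (_ %% (2 * d1))%Z; set q := (_ %/ (2 * d1))%Z => E.
      have b2 : b1 = 2 * (b1 %/ 2)%Z by move: p2; clear; lia.
      by rewrite mulrBr -b2 {1}E; ring.
    by clear; lia.
  by move: m0 m1 ev; clear; move: (b1 %% _)%Z => x *; split; lia.
apply: coset3_sym; apply: coset3_chain c1 _.
have := coset_translate a1 b1 d1 (- (b1 %/ (2 * d1))%Z).
by congr (same_coset _ _ (_, _, _, _)); rewrite {1}(divz_eq b1 (2 * d1)); ring.
Qed.

Lemma par_m1 w : inw P3 w -> cong_id_mod2 (act w m1).
Proof. by move=> wP; apply: par_act. Qed.

(** The group element joining two triangular matrices is triangular with diagonal entries of
    absolute value 1 and even upper right entry; a nonzero one would shift b' by a multiple of d. *)
Lemma hermite_unique n k k' : (0 < n)%N -> k \in hermite_reps n -> k' \in hermite_reps n -> same_coset P3 k k' -> k = k'.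
Proof.
move=> n0; case: k => [[[a b] c] d] /(hermiteP _ _ _ _ n0)[-> d0 ad [b1 [-> b10 b1d]]].
case: k' => [[[a' b'] c'] d'] /(hermiteP _ _ _ _ n0)[-> d'0 ad' [b2 [-> b20 b2d]]].
case=> w wP; rewrite act_mul; have := mdet_act det1P3 m1 wP; have := par_m1 wP.
case: (act w m1) => [[[x y] z] t] p D E.
have a0 : 0 < a by rewrite -(pmulr_lgt0 _ d0) ad; lia.
have a'0 : 0 < a' by rewrite -(pmulr_lgt0 _ d'0) ad'; lia.
have [e [e1 [Ea Eb Ec Ed]]] : exists e : int, (e = 1 \/ e = -1) /\ [/\ a' = e * (x * a), 2 * b2 = e * (x * (2 * b1) + y * d), 0 = e * (z * a) & d' = e * (z * (2 * b1) + t * d)].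
  case: E => -[E1 E2 E3 E4]; [exists 1; split; first by left|exists (-1); split; first by right];
    by split; [rewrite [LHS]E1|rewrite [LHS]E2|rewrite [LHS]E3|rewrite [LHS]E4]; ring.
have z0 : z = 0.
  move: Ec => /eqP; rewrite eq_sym !mulf_eq0 (gt_eqF a0) orbF.
  by case: e1 => -> /=; rewrite ?oppr_eq0 /= => /eqP.
rewrite z0 /= !mulr0 subr0 mulr1 subr0 normr1 in D.
rewrite z0 mul0r add0r in Ed.
have [xe te] : e * x = 1 /\ e * t = 1.
  have D' : x * t = 1 \/ x * t = -1 by move: D; clear; lia.
  have ex0 : 0 < e * x by rewrite -(pmulr_lgt0 _ a0) -mulrA -Ea.
  have et0 : 0 < e * t by rewrite -(pmulr_lgt0 _ d0) -mulrA -Ed.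
  have P : (e * x) * (e * t) = x * t.
    by case: e1 => ->; ring.
  have {}P : (e * x) * (e * t) = 1 by rewrite P; case: D' => // DD; move: (mulr_gt0 ex0 et0); rewrite P DD.
  by move: ex0 et0 P; clear; move: (e * x) (e * t) => u v; nia.
have Ea' : a' = a by rewrite Ea mulrA xe mul1r.
have Ed' : d' = d by rewrite Ed mulrA te mul1r.
have Eb' : 2 * b2 = 2 * b1 + (e * y) * d by rewrite Eb mulrDr mulrA xe mul1r mulrA.
have [y2 Ey] : exists y2, e * y = 2 * y2.
  case/and4P: p => _ yy _ _; exists (e * (y %/ 2)%Z); rewrite {1}(divz_eq y 2) (eqP yy) addr0; ring.
have Eb2 : b2 = b1 + y2 * d by move: Eb'; rewrite Ey; clear; lia.
congr (_, _, _, _) => //; congr (2 * _); rewrite Ed' in b2d.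
have : y2 = 0; last by move=> y0; rewrite Eb2 y0 mul0r addr0.
by move: Eb2 b1d b2d b10 b20 d0; clear; nia.
Qed.

(** * The hexagon group as a stabilizer modulo 3 *)

Definition det_prime3 (M : mat) := ~~ (3 %| mdet M)%Z.
Lemma unit3_cos M M' : same_coset P3 M M' -> det_prime3 M -> det_prime3 M'.
Proof.
move=> c; have E := coset3_det c; rewrite /det_prime3 !dvdzE.
by have -> : `|mdet M'|%N = `|mdet M|%N by move: E; clear; lia.
Qed.
Lemma unit3_fx M : det_prime3 M -> let: (a, b, c, d) := M in ~~ ((3 %| b - a)%Z && (3 %| d - c)%Z).
Proof.
case: M => [[[a b] c] d]; rewrite /det_prime3 /mdet; apply: contraNN => /andP[/dvdzP[x Ex] /dvdzP[y Ey]].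
apply/dvdzP; exists (a * y - x * c).
have -> : b = x * 3 + a by rewrite -Ex subrK.
have -> : d = y * 3 + c by rewrite -Ey subrK.
by ring.
Qed.
(** P^1(F_3) consists of the three vertices and -1. The reflection in a side fixes its two ends and
    exchanges -1 with the opposite vertex. So if M maps -1 to a vertex, the reflection in the side
    opposite to it moves the image to -1. *)
Lemma fx_ex M : det_prime3 M -> fixes_mod3 M \/ exists2 h, h \in P3 & fixes_mod3 (mmul (refl h) M).
Proof.
move/unit3_fx => u; suff : [|| fixes_mod3 M, fixes_mod3 (mmul (refl (1,1,0,1)) M), fixes_mod3 (mmul (refl (1,0,1,1)) M) | fixes_mod3 (mmul (refl (0,-1,1,0)) M)].
  by case/or4P; [left|right; exists (1,1,0,1)|right; exists (1,0,1,1)|right; exists (0,-1,1,0)].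
by case: M u => [[[a b] c] d]; rewrite /fixes_mod3 /refl /=; clear; lia.
Qed.
Lemma fx_leaf h M : h \in P3 -> det_prime3 M -> fixes_mod3 M -> ~~ fixes_mod3 (mmul (refl h) M).
Proof.
move=> hP /unit3_fx; move: h hP; case: M => [[[a b] c] d]; apply: in_P3; rewrite /fixes_mod3 /refl /=; clear; lia.
Qed.
Lemma fx_cos M : det_prime3 M -> exists2 M0, fixes_mod3 M0 & same_coset P3 M M0.
Proof.
move=> u; case: (fx_ex u) => [f|[h hP f]]; first by exists M => //; apply: coset_refl.
by exists (mmul (refl h) M) => //; apply: coset3_step => //; apply: coset_refl.
Qed.

(** The sides of the hexagon are the mirror images in [h] of the other sides [j] of the triangle. *)
Lemma refl6E h j : h \in P3 -> j \in P3 -> h != j -> exists2 g, g \in P6 &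
  mmul (refl h) (mmul (refl j) (refl h)) = mopp (refl g).
Proof.
move=> hP jP; move: h hP j jP; apply: in_P3; apply: in_P3 => // _.
- by exists (2,1,1,1).
- by exists (1,2,0,1).
- by exists (1,1,1,2).
- by exists (1,0,2,1).
- by exists (-1,-1,1,0).
- by exists (0,-1,1,1).
Qed.
Lemma refl6E' g : g \in P6 -> exists h j, [/\ h \in P3, j \in P3 & refl g = mopp (mmul (refl h) (mmul (refl j) (refl h)))].
Proof.
move: g; apply: in_P6.
- by exists (1,1,0,1), (0,-1,1,0).
- by exists (1,1,0,1), (1,0,1,1).
- by exists (1,0,1,1), (1,1,0,1).
- by exists (1,0,1,1), (0,-1,1,0).
- by exists (0,-1,1,0), (1,0,1,1).
- by exists (0,-1,1,0), (1,1,0,1).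
Qed.
Lemma coset6_coset3 M M' : same_coset P6 M M' -> same_coset P3 M M'.
Proof.
suff H w N : inw P6 w -> same_coset P3 N (act w N).
  by case=> w wP [] ->; [apply: H|apply: coset_opp; apply: H].
elim: w N => [|g w IH] N; first by move=> _; apply: coset_refl.
case/andP=> gP wP; rewrite act_cons; apply: coset3_chain (IH _ wP).
have [h [j [hP jP ->]]] := refl6E' gP; rewrite opp_mmul; apply: coset_opp.
move: (refl h) (fun M => @coset3_step h N M hP) (refl j) (fun M => @coset3_step j N M jP) => r Hr r' Hr'.
by rewrite -!mmulA; apply: (Hr _); apply: (Hr' _); apply: (Hr _); apply: coset_refl.
Qed.
(** The identity and the three reflections are a transversal of the hexagon group in the triangle
    group; a letter either leads back to the identity or is absorbed by [refl6E]. *)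
Lemma schreier w M : inw P3 w -> exists2 N, same_coset P6 M N & act w M = N \/ exists2 h, h \in P3 & act w M = mmul (refl h) N.
Proof.
elim/last_ind: w => [|w j IH]; first by exists M; [apply: coset_refl|left].
rewrite /inw all_rcons => /andP[jP /IH[N c]]; rewrite -cats1 act_cat act_cons.
case=> [->|[h hP ->]]; first by exists N => //; right; exists j.
have [<-|ne] := eqVneq h j.
  by exists N => //; left; rewrite /act /= reflK // det1P3.
have [g gP E] := refl6E hP jP ne.
exists (mopp (mmul (refl g) N)); first by apply: coset_opp; apply: coset_step.
right; exists h => //; rewrite -opp_mmul -E /act [foldl _ _ _]/=.
have := reflK (mmul (refl j) (mmul (refl h) N)) (det1P3 hP); move: (refl h) (refl j) => r r' K.
by rewrite -!mmulA K.
Qed.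
Lemma coset3_coset6 M M' : det_prime3 M -> fixes_mod3 M -> fixes_mod3 M' -> same_coset P3 M M' -> same_coset P6 M M'.
Proof.
move=> u f f' [w wP E]; have [N c EN] := schreier M wP.
have fN : fixes_mod3 N by case: c => weight6 w6P [] ->; rewrite ?fx_opp fx_act6.
have uN : det_prime3 N by apply: unit3_cos u; apply: coset6_coset3.
have EM : act w M = N.
  case: EN => // -[h hP EN]; move: (fx_leaf hP uN fN); rewrite -EN.
  by case: E f' => ->; rewrite ?fx_opp => ->.
by case: E => ->; rewrite EM //; apply: coset_opp.
Qed.

(** * Weights of elliptic matrices *)

Lemma big_one (T : eqType) (s : seq T) (p : pred T) (F : T -> nat) x : uniq s -> x \in s -> p =1 pred1 x ->
  (\sum_(i <- s | p i) F i = F x)%N.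
Proof.
move=> us xs pE; rewrite (eq_bigl _ _ pE) -big_filter.
by rewrite filter_pred1_uniq // big_seq1.
Qed.
Lemma big_two (T : eqType) (s : seq T) (p : pred T) (F : T -> nat) x y : uniq s -> x \in s -> y \in s -> x != y ->
  p =1 pred2 x y -> (\sum_(i <- s | p i) F i = F x + F y)%N.
Proof.
move=> us xs ys xy pE; rewrite (bigID (pred1 x)) /=; congr addn; apply: big_one => // z; rewrite pE /=.
  by case: (z == x); rewrite ?andbF ?andbT.
by have [->|] := eqVneq z x; rewrite ?(negbTE xy) //= ?andbT ?orbF.
Qed.

(** Each coset has total 2: a fixed point inside counts 2, each of two fixed points on sides counts
    1, an attracting vertex counts 2. *)
Lemma trichotomy_count (bx : seq mat) (R full half : pred mat) (V : seq vec) (at_ : pred vec) :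
  uniq bx -> uniq V -> (forall M, full M -> ~~ half M) ->
  [\/ exists M1, [/\ M1 \in bx, R M1, full M1, forall M, R M -> full M || half M -> M = M1 & forall v, v \in V -> ~~ at_ v],
   exists M1 M3, [/\ [/\ M1 \in bx, R M1 & half M1], [/\ M3 \in bx, R M3 & half M3], M3 != M1,
     forall M, R M -> full M || half M -> M = M1 \/ M = M3 & forall v, v \in V -> ~~ at_ v]
   | exists v, [/\ v \in V, at_ v, forall v', v' \in V -> at_ v' -> v' = v & forall M, R M -> ~~ (full M || half M)]] ->
  (\sum_(M <- bx | R M && (full M || half M)) ((full M).*2 + half M) + 2 * \sum_(v <- V) at_ v = 2)%N.
Proof.
move=> ub uV fh [[M1 [b1 R1 f1 U n]]|[M1 [M3 [[b1 R1 h1] [b3 R3 h3] ne U n]]]|[v [vV av U n]]].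
- rewrite [X in (2 * X)%N]big_seq_cond [X in (2 * X)%N]big1 => [|v /andP[vV _]]; last by rewrite (negbTE (n _ vV)).
  rewrite (@big_one _ _ _ _ M1) // ?f1 ?(negbTE (fh _ f1)) // => M /=.
  apply/andP/eqP => [[r e]|->]; first exact: U.
  by rewrite R1 f1.
- rewrite [X in (2 * X)%N]big_seq_cond [X in (2 * X)%N]big1 => [|v /andP[vV _]]; last by rewrite (negbTE (n _ vV)).
  have fnorm M : half M -> full M = false by move=> h; apply/negbTE/negP => /fh; rewrite h.
  rewrite (@big_two _ _ _ _ M1 M3) // ?h1 ?h3 ?fnorm // 1?eq_sym // => M /=.
  apply/andP/orP => [[r e]|[/eqP->|/eqP->]]; first by case: (U _ r e) => ->; rewrite eqxx; auto.
    by rewrite R1 h1 orbT.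
  by rewrite R3 h3 orbT.
rewrite big1 => [|M /andP[rM eM]]; last by rewrite (negbTE (n _ rM)) in eM.
rewrite -(big_mkcond _ (fun=> 1%N)) -big_filter.
rewrite (_ : [seq _ <- _ | _] = [:: v]) ?big_seq1 //.
rewrite -(filter_pred1_uniq uV vV); apply: eq_in_filter => v' v'V.
by apply/idP/eqP => [/U->|->].
Qed.

Definition weight3 (M : mat) : nat := (onsel full3 M).*2 + onsel half3 M.
Definition weight6 (M : mat) : nat := (onsel full6 M).*2 + onsel half6 M.
(** Agrees with w on nonzero triples without negative entries, and vanishes if an entry is
    negative. *)
Definition selling_weight3 (x y z : int) : nat := (full3 x y z).*2 + half3 x y z.
Definition selling_weight6 (x y z : int) : nat := (full6 x y z).*2 + half6 x y z.
Lemma pw3_neg x y z : (x < 0) || (y < 0) || (z < 0) -> selling_weight3 x y z = 0%N.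
Proof. by rewrite /selling_weight3 /full3 /half3; lia. Qed.
Lemma pw6_bad x y z : (x + 2 * y < 0) || (y + 2 * x < 0) || (x + 2 * z < 0) || (z + 2 * x < 0) || (y + 2 * z < 0) || (z + 2 * y < 0) ->
  selling_weight6 x y z = 0%N.
Proof.
move=> H; rewrite /selling_weight6 (_ : full6 x y z = false); last by rewrite /full6; lia.
by rewrite /half6; do 6 (rewrite (_ : thin _ _ _ = false); last by rewrite /thin; lia).
Qed.
(** The hexagon is cut into four triangles: a point inside one of them counts 2 there, a point on an
    inner side counts 1 in each of two triangles, a point on an outer side counts 1 in one. *)
Lemma pw6E x y z : selling_weight6 x y z = (selling_weight3 x y z + (selling_weight3 (x + 2 * z) (y + 2 * z) (- z)
  + (selling_weight3 (x + 2 * y) (- y) (z + 2 * y) + selling_weight3 (- x) (y + 2 * x) (z + 2 * x))))%N.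
Proof.
have [H|H] := boolP ((x + 2 * y < 0) || (y + 2 * x < 0) || (x + 2 * z < 0) || (z + 2 * x < 0) || (y + 2 * z < 0) || (z + 2 * y < 0)).
  by rewrite pw6_bad // !pw3_neg //; lia.
have [z0|z0] := ltrP z 0.
  rewrite (@pw3_neg x y z) ?(@pw3_neg _ (- y)) ?(@pw3_neg (- x)) ?addn0 ?add0n; try lia.
  by rewrite /selling_weight6 /selling_weight3 /full6 /full3 /half6 /half3 /thin; lia.
have [y0|y0] := ltrP y 0.
  rewrite (@pw3_neg x y z) ?(@pw3_neg _ _ (- z)) ?(@pw3_neg (- x)) ?addn0 ?add0n; try lia.
  by rewrite /selling_weight6 /selling_weight3 /full6 /full3 /half6 /half3 /thin; lia.
have [x0|x0] := ltrP x 0.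
  rewrite (@pw3_neg x y z) ?(@pw3_neg _ _ (- z)) ?(@pw3_neg _ (- y)) ?addn0 ?add0n; try lia.
  by rewrite /selling_weight6 /selling_weight3 /full6 /full3 /half6 /half3 /thin; lia.
clear H.
have P6 : selling_weight6 x y z = ((1 < (0 < x)%R + (0 < y)%R + (0 < z)%R).*2)%N.
  rewrite /selling_weight6 /half6; do 6 (rewrite (_ : thin _ _ _ = false); last by rewrite /thin; lia).
  by rewrite addn0 /full6; congr (nat_of_bool _).*2; clear -x0 y0 z0; lia.
have fl u v w : 0 <= u -> 0 <= v -> 0 <= w -> selling_weight3 (u + 2 * w) (v + 2 * w) (- w) = ([&& w == 0, 0 < u & 0 < v] : nat).
  by move=> u0 v0 w0; rewrite /selling_weight3 /full3 /half3; clear -u0 v0 w0; lia.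
have rot u v w : selling_weight3 u v w = selling_weight3 v w u by rewrite /selling_weight3 /full3 /half3; clear; lia.
rewrite P6 fl // (rot (x + 2 * y)) (rot (- y)) (rot (- x)) (fl y z x) // (_ : selling_weight3 (z + 2 * y) _ _ = ([&& y == 0, 0 < z & 0 < x] : nat)) ?fl //.
by rewrite /selling_weight3 /full3 /half3; clear -x0 y0 z0; lia.
Qed.

Lemma pw3_bd x y z K : (0 < selling_weight3 x y z)%N -> x * y + y * z + z * x <= K -> [/\ `|x| <= K, `|y| <= K & `|z| <= K].
Proof.
rewrite /selling_weight3 /full3 /half3 => H.
have [x0 [y0 z0]] : 0 <= x /\ 0 <= y /\ 0 <= z by lia.
have [[xy yz] zx] := (mulr_ge0 x0 y0, mulr_ge0 y0 z0, mulr_ge0 z0 x0).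
have B (u v : int) : 0 <= u -> 0 < v -> u <= u * v by move=> u0 v0; rewrite ler_peMr //; lia.
have B' (u v : int) : 0 <= u -> 0 < v -> u <= v * u by rewrite mulrC; apply: B.
move=> le; rewrite !ger0_norm //.
have [[x1 y1]|[[y1 z1]|[z1 x1]]] : (0 < x /\ 0 < y) \/ (0 < y /\ 0 < z) \/ (0 < z /\ 0 < x) by lia.
- by have := B _ _ x0 y1; have := B' _ _ y0 x1; have := B' _ _ z0 y1; move: le xy yz zx; clear; split; lia.
- by have := B _ _ y0 z1; have := B' _ _ z0 y1; have := B _ _ x0 y1; move: le xy yz zx; clear; split; lia.
- by have := B _ _ z0 x1; have := B' _ _ x0 z1; have := B _ _ y0 z1; move: le xy yz zx; clear; split; lia.
Qed.
Lemma pw6_bd x y z K : (0 < selling_weight6 x y z)%N -> x * y + y * z + z * x <= K -> [/\ `|x| <= 3 * K, `|y| <= 3 * K & `|z| <= 3 * K].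
Proof.
have O (p q r s : nat) : (0 < p + (q + (r + s)))%N -> [|| 0 < p, 0 < q, 0 < r | 0 < s]%N by lia.
rewrite pw6E => /O/or4P[] /pw3_bd B le.
- by case: (B K le) => ? ? ?; split; lia.
- by case: (B K); [apply: le_trans le; rewrite le_eqVlt; apply/orP; left; apply/eqP; ring|move=> ? ? ?; split; lia].
- by case: (B K); [apply: le_trans le; rewrite le_eqVlt; apply/orP; left; apply/eqP; ring|move=> ? ? ?; split; lia].
- by case: (B K); [apply: le_trans le; rewrite le_eqVlt; apply/orP; left; apply/eqP; ring|move=> ? ? ?; split; lia].
Qed.
Lemma w6_pw a b c d : weight6 (a, b, c, d) = selling_weight6 (2 * c - a + d) (- 2 * b - a + d) (a - d).
Proof. by []. Qed.
Lemma w3_pw a b c d : weight3 (a, b, c, d) = selling_weight3 (2 * c - a + d) (- 2 * b - a + d) (a - d).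
Proof. by []. Qed.
(** As e >= 0, [sel_det] gives tr^2 <= 4n. A trace of at most 4n and doubled Selling coordinates of
    at most 12n keep every entry below 16n. *)
Lemma elliptic_box (n : nat) M : mdet M = n%:Z -> (0 < weight3 M)%N || (0 < weight6 M)%N -> M \in box (16 * n).
Proof.
case: M => [[[a b] c] d]; rewrite w6_pw w3_pw => D H.
have E := sel_det a b c d; rewrite -/(mdet (a, b, c, d)) D in E.
rewrite mem_box; move: H E; move X : (2 * c - a + d) => x; move Y : (- 2 * b - a + d) => y; move Z : (a - d) => z H E.
have t2 := sqr_ge0 (a + d).
have tb : `|a + d| <= 4 * n%:Z.
  have esym2 : 0 <= x * y + y * z + z * x.
    case/orP: H; last first.
      rewrite /selling_weight6 addn_gt0 double_gt0 !lt0b => H; apply: hex_e2_ge0.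
      by move: H; rewrite /full6 /half6 /thin; clear; do ![case/orP]; lia.
    rewrite /selling_weight3 /full3 /half3 => H; have [? [? ?]] : 0 <= x /\ 0 <= y /\ 0 <= z by move: H; clear; lia.
    by rewrite !addr_ge0 ?mulr_ge0.
  have le : (a + d) ^+ 2 <= 4 * n%:Z by move: E esym2; clear; lia.
  by move: le; clear; move: (a + d) => t; nia.
have [x1 y1 z1] : [/\ `|x| <= 3 * (4 * n%:Z), `|y| <= 3 * (4 * n%:Z) & `|z| <= 3 * (4 * n%:Z)].
  have le : x * y + y * z + z * x <= 4 * n%:Z by move: E t2; clear; lia.
  by case/orP: H => H; [case: (pw3_bd H le) => ? ? ?; split; lia|apply: pw6_bd H le].
by move: tb x1 y1 z1; rewrite -X -Y -Z; clear; lia.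
Qed.
Lemma uniq_box B : uniq (box B).
Proof.
have U : uniq (irange B) by rewrite map_inj_uniq ?iota_uniq // => i j; lia.
by rewrite /box; do 3 (apply: allpairs_uniq => //; last by case=> ? ? [? ?]).
Qed.

(** * Summation over the cosets *)

Definition attr3 (v : vec) (k : mat) : bool := `[< exists M l, same_coset P3 k M /\ dominant_eigen M v l >].
Definition attr6 (v : vec) (k : mat) : bool := `[< exists M l, [/\ same_coset P3 k M, fixes_mod3 M & dominant_eigen M v l] >].
Definition cosb (k M : mat) : bool := `[< same_coset P3 k M >].
Lemma full_half3 M : onsel full3 M -> ~~ onsel half3 M.
Proof. by case: M => [[[a b] c] d]; rewrite /onsel /full3 /half3; clear; lia. Qed.
Lemma full_half6 M : onsel full6 M -> ~~ onsel half6 M.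
Proof.
case: M => [[[a b] c] d]; rewrite /onsel /full6 /half6 /thin => H.
do 5 (rewrite negb_or; apply/andP; split; first by move: H; clear; lia).
by move: H; clear; lia.
Qed.
Lemma V6_par v v' : v \in V6 -> v' \in V6 -> v.1 * v'.2 = v.2 * v'.1 -> v' = v.
Proof.
move=> vV v'V; have : all (fun v => all (fun v' => (v.1 * v'.2 == v.2 * v'.1) ==> (v' == v)) V6) V6 by [].
by move/allP/(_ v vV)/allP/(_ v' v'V)/implyP => H /eqP/H/eqP.
Qed.

Section Count.
Variable n : nat.
Hypotheses (n0 : (0 < n)%N) (q : nonsquare n%:Z) (u3 : ~~ (3 %| n)%N) (n2 : odd n).

Lemma herm_det k : k \in hermite_reps n -> mdet k = n%:Z.
Proof. by case: k => [[[a b] c] d] /(hermiteP _ _ _ _ n0)[-> _ <- _]; rewrite /= mulr0 subr0. Qed.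
Lemma herm_par k : k \in hermite_reps n -> cong_id_mod2 k.
Proof.
case: k => [[[a b] c] d] /(hermiteP _ _ _ _ n0)[-> d0 ad [b' [-> _ _]]].
have : odd (`|a| * `|d|)%N by rewrite -abszM ad.
by rewrite oddM /cong_id_mod2; clear; lia.
Qed.
Lemma herm_unit3 k : k \in hermite_reps n -> det_prime3 k.
Proof. by move/herm_det; rewrite /det_prime3 => ->; rewrite dvdzE. Qed.
Let bx := box (16 * n).

Lemma cos_det_n k M : k \in hermite_reps n -> same_coset P3 k M -> `|mdet M| = n%:Z.
Proof. by move=> kH c; rewrite (coset3_det c) herm_det // ger0_norm. Qed.
Lemma ellb3 k M : k \in hermite_reps n -> same_coset P3 k M -> ell3 M -> mdet M = n%:Z /\ M \in bx.
Proof.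
move=> kH c e; have D : mdet M = n%:Z by rewrite -(cos_det_n kH c) ger0_norm // ell3det.
split => //; apply: elliptic_box => //; apply/orP; left.
by move: e; rewrite /ell3 /weight3; case: (onsel full3 M); case: (onsel half3 M).
Qed.
Lemma ellb6 k M : k \in hermite_reps n -> same_coset P3 k M -> ell6 M -> mdet M = n%:Z /\ M \in bx.
Proof.
move=> kH c e; have D : mdet M = n%:Z by rewrite -(cos_det_n kH c) ger0_norm // ell6det.
split => //; apply: elliptic_box => //; apply/orP; right.
by move: e; rewrite /ell6 /weight6; case: (onsel full6 M); case: (onsel half6 M).
Qed.

Lemma coset_count3 k : k \in hermite_reps n ->
  (\sum_(M <- bx | (cosb k M && (mdet M == n%:Z)) && ell3 M) weight3 M + 2 * \sum_(v <- V3) attr3 v k = 2)%N.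
Proof.
move=> kH; apply: (@trichotomy_count bx (fun M => cosb k M && (mdet M == n%:Z)) (onsel full3) (onsel half3)) => //.
- exact: uniq_box.
- exact: full_half3.
have qk : nonsquare `|mdet k| by rewrite herm_det.
have na : (forall M', same_coset P3 k M' -> forall v l, v \in V3 -> ~ dominant_eigen M' v l) -> forall v, v \in V3 -> ~~ attr3 v k.
  by move=> H v vV; apply/negP => /asboolP[M [l [c e]]]; apply: H c v l vV e.
case: (coset3 qk) => [[M1 [c1 f1 U]]|[M1 [M3 [[c1 c3] [h1 h3] ne U]]]|[M1 [v [l [c1 vV e1 U]]]]].
- have [D1 b1] := ellb3 kH c1 ltac:(by rewrite /ell3 f1).
  constructor 1; exists M1; split => //; first by rewrite /cosb asboolT // D1 eqxx.
    by move=> M /andP[/asboolP c /eqP D] e; apply: (U M c).1.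
  by apply: na => M' c'; case: (U M' c').
- have [D1 b1] := ellb3 kH c1 ltac:(by rewrite /ell3 h1 orbT).
  have [D3 b3] := ellb3 kH c3 ltac:(by rewrite /ell3 h3 orbT).
  constructor 2; exists M1, M3; split => //; [by rewrite /cosb asboolT // D1 eqxx|by rewrite /cosb asboolT // D3 eqxx|exact/eqP| |].
    by move=> M /andP[/asboolP c /eqP D] e; apply: (U M c).1.
  by apply: na => M' c'; case: (U M' c').
constructor 3; exists v; split => //.
- by apply/asboolP; exists M1, l.
- move=> v' v'V /asboolP[M [l' [c e]]]; apply: V6_par; [exact: V3_6|exact: V3_6|].
  by case: (U M c) => _ H; apply: H e.
by move=> M /andP[/asboolP c _]; case: (U M c).
Qed.
End Count.

Lemma mdet_reflM h M : mdet h = 1 -> mdet (mmul (refl h) M) = - mdet M.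
Proof. by move/mdet_refl; move: (refl h) => r E; rewrite mdetM E mulN1r. Qed.
Lemma mdet_Mrefl h M : mdet h = 1 -> mdet (mmul M (refl h)) = - mdet M.
Proof. by move/mdet_refl; move: (refl h) => r E; rewrite mdetM E mulrN1. Qed.
(** M is invertible modulo 3 and fixes v, so it maps -1 either to -1 or to one of the other two
    vertices. In the latter case the reflection that moves this image to -1 belongs to a side
    through v and keeps v dominant. *)
Lemma cusp_fx v M l : det_prime3 M -> v \in V3 -> dominant_eigen M v l ->
  exists M' l', [/\ fixes_mod3 M', dominant_eigen M' v l' & same_coset P3 M M'].
Proof.
move=> u vV e.
have St h : h \in P3 -> eqv (mapp (refl h) v) v -> exists l', dominant_eigen (mmul (refl h) M) v l'.
  move=> hP E; case: e => E1 lt.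
  have D : `|mdet (mmul (refl h) M)| = `|mdet M| by rewrite (mdet_reflM _ (det1P3 hP)) normrN.
  case: E => E2; [exists l|exists (- l)]; rewrite /dominant_eigen ?sqrrN D; split => //; clear -E1 E2;
   move: (refl h) E2 => r E2; rewrite mapp_mul E1; move: E2; case: r => [[[x y] z] t]; case: (v) => p q [/= E3 E4]; congr (_, _).
  - by rewrite mulrCA [y * _]mulrCA -mulrDr E3.
  - by rewrite mulrCA [t * _]mulrCA -mulrDr E4.
  - by rewrite mulrCA [y * _]mulrCA -mulrDr E3 mulrN mulNr.
  - by rewrite mulrCA [t * _]mulrCA -mulrDr E4 mulrN mulNr.
have S h : h \in P3 -> eqv (mapp (refl h) v) v -> fixes_mod3 (mmul (refl h) M) -> exists M' l', [/\ fixes_mod3 M', dominant_eigen M' v l' & same_coset P3 M M'].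
  move=> hP E f; have [l' e'] := St h hP E; exists (mmul (refl h) M), l'; split => //.
  exact: coset3_step (coset_refl _ _).
suff : fixes_mod3 M \/ exists h, [/\ h \in P3, eqv (mapp (refl h) v) v & fixes_mod3 (mmul (refl h) M)].
  by case=> [f|[h [hP E f]]]; [exists M, l; split => //; apply: coset_refl|apply: S f].
clear S St; case: M u e => [[[a b] c] d] u [E _]; move: u E; rewrite /det_prime3 /=.
move: vV; rewrite !inE => /or3P[] /eqP-> /= u [].
- rewrite !mulr1 !mulr0 !addr0 => El c0.
  have nd : ~~ (3 %| d)%Z by apply: contraNN u; rewrite c0 mulr0 subr0; apply: dvdz_mull.
  have : [|| fixes_mod3 (a, b, c, d), fixes_mod3 (mmul (refl hT) (a, b, c, d)) | fixes_mod3 (mmul (refl hR) (a, b, c, d))].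
    by rewrite reflT reflR /= c0; move: nd; clear; lia.
  case/or3P => f; [by left| |]; right; [exists hT|exists hR]; split => //; first [by left|by right].
- rewrite !mulr1 => E1 E2.
  have nd : ~~ (3 %| d - b)%Z.
    apply: contraNN u; have -> : a * d - b * c = l * (d - b); last exact: dvdz_mull.
    have -> : a = l - b by rewrite -E1; ring. have -> : c = l - d by rewrite -E2; ring. by ring.
  have : [|| fixes_mod3 (a, b, c, d), fixes_mod3 (mmul (refl hT) (a, b, c, d)) | fixes_mod3 (mmul (refl (1,0,1,1)) (a, b, c, d))].
    by rewrite reflT /refl /=; move: nd E1 E2; clear; lia.
  case/or3P => f; [by left| |]; right; [exists hT|exists (1,0,1,1)]; split => //; first [by left|by right].
rewrite !mulr1 !mulr0 !add0r => b0 El.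
have nd : ~~ (3 %| a)%Z by apply: contraNN u; rewrite b0 mul0r subr0; apply: dvdz_mulr.
have : [|| fixes_mod3 (a, b, c, d), fixes_mod3 (mmul (refl (1,0,1,1)) (a, b, c, d)) | fixes_mod3 (mmul (refl hR) (a, b, c, d))].
  by rewrite reflR /refl /= b0; move: nd; clear; lia.
case/or3P => f; [by left| |]; right; [exists (1,0,1,1)|exists hR]; split => //; first [by left|by right].
Qed.

Lemma attr63 v k : det_prime3 k -> v \in V3 -> attr6 v k = attr3 v k.
Proof.
move=> u vV; apply/asboolP/asboolP => [[M [l [c _ e]]]|[M [l [c e]]]]; first by exists M, l.
have [M' [l' [f e' c']]] := cusp_fx (unit3_cos c u) vV e.
by exists M', l'; split => //; apply: coset3_chain c'.
Qed.

Lemma cos_mulr R M M' : same_coset P3 M M' -> same_coset P3 (mmul M R) (mmul M' R).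
Proof.
case=> w wP E; exists w => //; rewrite act_mul mmulA -act_mul.
by case: E => ->; [left|right; rewrite opp_mmul].
Qed.
Lemma eig_conj h M v l : mdet h = 1 -> dominant_eigen M v l -> dominant_eigen (refl_conj h M) (mapp (refl h) v) l.
Proof.
move=> D [E lt]; split; last by rewrite mdet_conj.
move: (refl2 D); rewrite /refl_conj; move: (refl h) => r r2.
rewrite !mapp_mul -(mapp_mul r r) r2 mapp1 E.
by case: r {r2} => [[[? ?] ?] ?] /=; congr (_, _); ring.
Qed.
Lemma eig_eqv M v v' l : eqv v v' -> dominant_eigen M v l -> dominant_eigen M v' l.
Proof.
case=> [->//|->] /eig_opp; rewrite /= !opprK; by case: v'.
Qed.
Lemma cos_conj h k M : h \in P3 -> same_coset P3 k M -> same_coset P3 (mmul k (refl h)) (refl_conj h M).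
Proof.
move=> hP c; rewrite /refl_conj; have := @coset3_step h _ _ hP (@cos_mulr (refl h) _ _ c).
by move: (refl h) => r; rewrite mmulA.
Qed.

(** Used for the hexagon vertices that are mirror images of triangle vertices. They reduce to -1
    modulo 3, so a matrix with such an eigenvector satisfies [fixes_mod3], and conjugation by the
    reflection carries the vertex to a vertex of the triangle. *)
Lemma attr6_conj h v0 v k : h \in P3 -> eqv (mapp (refl h) v0) v -> eqv (mapp (refl h) v) v0 ->
  (forall M l, dominant_eigen M v l -> fixes_mod3 M) -> attr6 v k = attr3 v0 (mmul k (refl h)).
Proof.
move=> hP E E' F; have D := det1P3 hP; apply/asboolP/asboolP => [[M [l [c _ e]]]|[M [l [c e]]]].
  exists (refl_conj h M), l; split; first exact: cos_conj.
  by apply: eig_eqv E' _; apply: eig_conj.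
have e' : dominant_eigen (refl_conj h M) v l by apply: eig_eqv E _; apply: eig_conj.
exists (refl_conj h M), l; split; [|exact: F e'|by []].
have := cos_conj hP c; move: (refl2 D); move: (refl h) => r r2.
by rewrite -mmulA r2 mmulm1.
Qed.

Section Tot.
Variable n : nat.
Hypotheses (n0 : (0 < n)%N) (q : nonsquare n%:Z) (u3 : ~~ (3 %| n)%N) (n2 : odd n).
Let bx := box (16 * n).

Lemma coset_count6 k : k \in hermite_reps n ->
  (\sum_(M <- bx | (cosb k M && fixes_mod3 M && (mdet M == n%:Z)) && ell6 M) weight6 M + 2 * \sum_(v <- V6) attr6 v k = 2)%N.
Proof.
move=> kH; apply: (@trichotomy_count bx (fun M => cosb k M && fixes_mod3 M && (mdet M == n%:Z)) (onsel full6) (onsel half6)) => //.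
- exact: uniq_box.
- exact: full_half6.
have uk := herm_unit3 n0 u3 kH.
have [M0 f0 c0] := fx_cos uk; have u0 := unit3_cos c0 uk.
have to6 M : same_coset P3 k M -> fixes_mod3 M -> same_coset P6 M0 M by move=> c f; apply: coset3_coset6 => //; apply: coset3_trans c0 c.
have of6 M : same_coset P6 M0 M -> same_coset P3 k M /\ fixes_mod3 M.
  move=> c; split; first exact: coset3_chain c0 (coset6_coset3 c).
  by case: c => w wP [] ->; rewrite ?fx_opp fx_act6.
have qk : nonsquare `|mdet M0| by rewrite (coset3_det c0) (herm_det n0 kH) ger0_norm.
have na : (forall M', same_coset P6 M0 M' -> forall v l, v \in V6 -> ~ dominant_eigen M' v l) -> forall v, v \in V6 -> ~~ attr6 v k.
  by move=> H v vV; apply/negP => /asboolP[M [l [c f e]]]; apply: H (to6 _ c f) v l vV e.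
case: (coset6 qk) => [[M1 [c1 f1 U]]|[M1 [M3 [[c1 c3] [h1 h3] ne U]]]|[M1 [v [l [c1 vV e1 U]]]]].
- have [c1' g1] := of6 _ c1; have [D1 b1] := ellb6 n0 kH c1' ltac:(by rewrite /ell6 f1).
  constructor 1; exists M1; split => //; first by rewrite /cosb asboolT // g1 D1 eqxx.
    by move=> M /andP[/andP[/asboolP c f] /eqP D] e; apply: (U M (to6 _ c f)).1.
  by apply: na => M' c'; case: (U M' c').
- have [c1' g1] := of6 _ c1; have [D1 b1] := ellb6 n0 kH c1' ltac:(by rewrite /ell6 h1 orbT).
  have [c3' g3] := of6 _ c3; have [D3 b3] := ellb6 n0 kH c3' ltac:(by rewrite /ell6 h3 orbT).
  constructor 2; exists M1, M3; split => //; [by rewrite /cosb asboolT // g1 D1 eqxx|by rewrite /cosb asboolT // g3 D3 eqxx|exact/eqP| |].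
    by move=> M /andP[/andP[/asboolP c f] /eqP D] e; apply: (U M (to6 _ c f)).1.
  by apply: na => M' c'; case: (U M' c').
have [c1' g1] := of6 _ c1; constructor 3; exists v; split => //.
- by apply/asboolP; exists M1, l.
- move=> v' v'V /asboolP[M [l' [c f e]]]; apply: V6_par => //.
  by case: (U M (to6 _ c f)) => _ H; apply: H e.
by move=> M /andP[/andP[/asboolP c f] _]; case: (U M (to6 _ c f)).
Qed.

Lemma coset_sum (R : pred mat) (F : mat -> nat) :
  (\sum_(k <- hermite_reps n) \sum_(M <- bx | (cosb k M && (mdet M == n%:Z)) && R M) F M =
   \sum_(M <- bx | (cong_id_mod2 M && (mdet M == n%:Z)) && R M) F M)%N.
Proof.
under eq_bigr do rewrite big_mkcond.
rewrite exchange_big [RHS]big_mkcond; apply: eq_bigr => M _.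
rewrite -[LHS]big_mkcond; case: ifP => [/andP[/andP[p /eqP D] r]|H].
  have [k kH c] := hermite_exists n0 p (ltac:(by rewrite D) : `|mdet M| = n%:Z).
  rewrite big_seq_cond (@big_one _ _ _ (fun=> F M) k) // ?herm_uniq // => k'; rewrite D eqxx r !andbT.
  apply/andP/eqP => [[k'H /asboolP c']|->]; last by rewrite /cosb asboolT.
  by apply: (hermite_unique n0) => //; apply: coset3_chain c' (coset3_sym c).
rewrite big_seq_cond big1 // => k /andP[kH /andP[/andP[/asboolP c D] r]].
by move: H; rewrite (par_cos c (herm_par n0 n2 kH)) D r.
Qed.

(** Right multiplication commutes with the left action of the group and preserves the congruence
    modulo 2, so it permutes the cosets. *)
Lemma herm_shift h (p : pred mat) : h \in P3 -> (forall k k', same_coset P3 k k' -> p k = p k') ->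
  (\sum_(k <- hermite_reps n) p (mmul k (refl h)) = \sum_(k <- hermite_reps n) p k)%N.
Proof.
move=> hP pc; have D := det1P3 hP.
pose g k := nth k (hermite_reps n) (find (fun k' => cosb k' (mmul k (refl h))) (hermite_reps n)).
have gP k : k \in hermite_reps n -> g k \in hermite_reps n /\ same_coset P3 (g k) (mmul k (refl h)).
  move=> kH; have : has (fun k' => cosb k' (mmul k (refl h))) (hermite_reps n).
    have [||k' k'H c] := @hermite_exists n (mmul k (refl h)) n0; last by apply/hasP; exists k' => //; apply/asboolP.
      by apply: par_conj3 => //; apply: herm_par kH.
    by rewrite mdet_Mrefl // normrN (herm_det n0 kH) ger0_norm.
  move=> H; split; first by rewrite /g mem_nth // -has_find.
  by have /asboolP := nth_find k H.
transitivity (\sum_(k <- map g (hermite_reps n)) p k)%N.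
  by rewrite big_map big_seq [RHS]big_seq; apply: eq_bigr => k /gP[_ c]; rewrite (pc _ _ c).
have ug : uniq (map g (hermite_reps n)).
  rewrite map_inj_in_uniq ?herm_uniq // => k k' kH k'H E; apply: (hermite_unique n0) => //.
  have [_ c] := gP k kH; have [_ c'] := gP k' k'H; rewrite -E in c'.
  have := @cos_mulr (refl h) _ _ (coset3_trans c c'); move: (refl2 D); move: (refl h) => r r2.
  by rewrite -!mmulA r2 !mmulm1.
apply: perm_big; apply: uniq_perm => //; first exact: herm_uniq.
have sub : {subset map g (hermite_reps n) <= hermite_reps n} by move=> k /mapP[k' /gP[k1 _] ->].
by case: (uniq_min_size ug sub); rewrite ?size_map.
Qed.

Lemma attr3_cos v k k' : same_coset P3 k k' -> attr3 v k = attr3 v k'.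
Proof.
move=> c; apply/asboolP/asboolP => -[M [l [d e]]]; exists M, l; split => //.
  exact: coset3_trans c d.
exact: coset3_chain c d.
Qed.

(** The vertices of the triangle contribute as before by [attr63]; (2,1), (1,2) and (-1,1)
    contribute like their mirror images (0,1), (1,0) and (1,1). *)
Lemma attr_double : (\sum_(k <- hermite_reps n) \sum_(v <- V6) attr6 v k = 2 * \sum_(k <- hermite_reps n) \sum_(v <- V3) attr3 v k)%N.
Proof.
pose S v := (\sum_(k <- hermite_reps n) attr3 v k)%N.
have A v : v \in V3 -> (\sum_(k <- hermite_reps n) attr6 v k = \sum_(k <- hermite_reps n) attr3 v k)%N.
  move=> vV; rewrite big_seq [RHS]big_seq; apply: eq_bigr => k kH.
  by rewrite attr63 // (herm_unit3 n0 u3).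
have B h v0 v : h \in P3 -> eqv (mapp (refl h) v0) v -> eqv (mapp (refl h) v) v0 ->
  (forall M l, dominant_eigen M v l -> fixes_mod3 M) -> (\sum_(k <- hermite_reps n) attr6 v k = \sum_(k <- hermite_reps n) attr3 v0 k)%N.
  move=> hP E E' F; rewrite -(@herm_shift h (attr3 v0) hP (attr3_cos v0)); apply: eq_bigr => k _.
  by rewrite (attr6_conj _ hP E E' F).
rewrite exchange_big [X in (2 * X)%N]exchange_big !big_cons !big_nil (A (1, 0)) // (A (1, 1)) // (A (0, 1)) //.
rewrite (B hT (0, 1) (2, 1)) ?(B (1,0,1,1) (1, 0) (1, 2)) ?(B hR (1, 1) (-1, 1)) //; try (by left); try (by right);
  try by (move=> [[[a b] c] d] l [[/= E1 E2] _]; move: E1 E2; clear; lia).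
rewrite -/(S (1, 0)) -/(S (1, 1)) -/(S (0, 1)); clear; move: S => S /=; lia.
Qed.

Definition weight3_total : nat := (\sum_(M <- bx | cong_id_mod2 M && (mdet M == n%:Z)) weight3 M)%N.
Definition weight6_total : nat := (\sum_(M <- bx | (cong_id_mod2 M && (mdet M == n%:Z)) && fixes_mod3 M) weight6 M)%N.
(** With A the number of attracting vertices over all cosets, the two counts read weight3 + 2 A = 2
    sigma and weight6 + 4 A = 2 sigma; eliminate A. *)
Lemma triangle_hexagon_count : (weight6_total + 2 * sigma n = 2 * weight3_total)%N.
Proof.
have e3 : weight3_total = (\sum_(M <- bx | (cong_id_mod2 M && (mdet M == n%:Z)) && ell3 M) weight3 M)%N.
  rewrite /weight3_total [RHS]big_mkcondr; apply: eq_bigr => M _; rewrite /weight3 /ell3.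
  by case: (onsel full3 M); case: (onsel half3 M).
have e6 : weight6_total = (\sum_(M <- bx | (cong_id_mod2 M && (mdet M == n%:Z)) && (fixes_mod3 M && ell6 M)) weight6 M)%N.
  rewrite /weight6_total [LHS]big_mkcondr [RHS]big_mkcondr; apply: eq_bigr => M _; rewrite /weight6 /ell6.
  by case: (fixes_mod3 M); case: (onsel full6 M); case: (onsel half6 M).
have s (F G : mat -> nat) : (forall k, k \in hermite_reps n -> F k + 2 * G k = 2)%N ->
    (\sum_(k <- hermite_reps n) F k + 2 * \sum_(k <- hermite_reps n) G k = 2 * sigma n)%N.
  move=> H; rewrite big_distrr -big_split /= big_seq (eq_bigr (fun=> 2%N)) // -big_seq.
  by rewrite big_const_seq count_predT iter_addn_0 size_herm.
have := s _ _ (coset_count3 n0 q); rewrite -/bx (coset_sum ell3 weight3) -e3.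
have := s _ _ coset_count6; rewrite [X in (X + _)%N](_ : _ = weight6_total); last first.
  rewrite e6 -(coset_sum (fun M => fixes_mod3 M && ell6 M) weight6); apply: eq_bigr => k _; apply: eq_bigl => M.
  by rewrite [cosb _ _ && fixes_mod3 _]andbC -!andbA; bool_congr.
rewrite attr_double; lia.
Qed.
End Tot.

(** * Triangles against hexagons *)

(** The bijection is required only where the summand is nonzero; this absorbs the different sizes of
    the boxes. *)
Lemma sum_bij (S T : eqType) (s : seq S) (t : seq T) (P : pred S) (Q : pred T) (F : S -> nat) (G : T -> nat) f g :
  uniq s -> uniq t ->
  (forall x, x \in s -> P x -> (0 < F x)%N -> [/\ f x \in t, Q (f x), G (f x) = F x & g (f x) = x]) ->
  (forall y, y \in t -> Q y -> (0 < G y)%N -> [/\ g y \in s, P (g y), F (g y) = G y & f (g y) = y]) ->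
  (\sum_(x <- s | P x) F x = \sum_(y <- t | Q y) G y)%N.
Proof.
move=> us ut A B.
have R (I : eqType) (l : seq I) (p : pred I) (H : I -> nat) :
    (\sum_(x <- l | p x) H x = \sum_(x <- [seq x <- l | p x && (0 < H x)%N]) H x)%N.
  rewrite big_filter [LHS](bigID (fun x => (0 < H x)%N)) /= [X in (_ + X)%N]big1 ?addn0 // => x /andP[_].
  by rewrite lt0n negbK => /eqP.
rewrite [LHS]R [RHS]R; set s' := filter _ s; set t' := filter _ t.
have A' x : x \in s' -> [/\ f x \in t', G (f x) = F x & g (f x) = x].
  rewrite mem_filter => /andP[/andP[p F0] xs]; have [ft q e gf] := A x xs p F0.
  by rewrite mem_filter ft q e F0.
have B' y : y \in t' -> [/\ g y \in s', F (g y) = G y & f (g y) = y].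
  rewrite mem_filter => /andP[/andP[p F0] xs]; have [ft q e gf] := B y xs p F0.
  by rewrite mem_filter ft q e F0.
transitivity (\sum_(y <- map f s') G y)%N.
  by rewrite big_map big_seq [RHS]big_seq; apply: eq_bigr => x /A'[].
apply: perm_big; apply: uniq_perm; last 1 first.
- move=> y; apply/mapP/idP => [[x /A'[fixes_mod3 _ _] ->] //|yt].
  by exists (g y); case: (B' y yt).
- rewrite map_inj_in_uniq ?filter_uniq // => x x' /A'[_ _ e] /A'[_ _ e'] E.
  by rewrite -e -e' E.
by rewrite filter_uniq.
Qed.

Definition esym2 (t : int * int * int) : int := let: (x, y, z) := t in x * y + y * z + z * x.
Definition par3 (t : int * int * int) : bool := let: (x, y, z) := t in (2 %| x - y)%Z && (2 %| y - z)%Z.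
Definition p3 (t : int * int * int) : nat := let: (x, y, z) := t in selling_weight3 x y z.
Definition hex_weight (t : int * int * int) : nat := let: (x, y, z) := t in selling_weight6 x y z.
Definition sum3 (t : int * int * int) : bool := let: (x, y, z) := t in (3 %| x + y + z)%Z.
Definition cond (n : nat) (q : mat) := (q.2 ^+ 2 + esym2 q.1 == n%:Z) && par3 q.1.
(** The identity and, up to a common sign, the conjugations by the reflections in the three sides,
    in Selling coordinates. *)
Definition flip (i : 'I_4) (t : int * int * int) : int * int * int := let: (x, y, z) := t in
  match val i with 0%N => (x, y, z) | 1%N => (x + 2 * z, y + 2 * z, - z) | 2%N => (x + 2 * y, - y, z + 2 * y) | _ => (- x, y + 2 * x, z + 2 * x) end.
Lemma p6E t : hex_weight t = (\sum_i p3 (flip i t))%N.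
Proof. by case: t => [[x y] z]; rewrite /hex_weight pw6E !big_ord_recl big_ord0 /= addn0. Qed.
Lemma flipK i t : flip i (flip i t) = t.
Proof. by case: t => [[x y] z]; case: i => [[|[|[|[|?]]]] ?] //=; congr (_, _, _); ring. Qed.
Lemma e2_flip i t : esym2 (flip i t) = esym2 t.
Proof. by case: t => [[x y] z]; case: i => [[|[|[|[|?]]]] ?] //=; ring. Qed.
Lemma par3_flip i t : par3 (flip i t) = par3 t.
Proof. by case: t => [[x y] z]; case: i => [[|[|[|[|?]]]] ?] //=; lia. Qed.

Definition toM (q : mat) : mat := let: (x, y, z, r) := q in (r + z, - (y + z), x + z, r - z).
Definition toQ (M : mat) : mat := let: (a, b, c, d) := M in
  (c - ((a - d) %/ 2)%Z, - b - ((a - d) %/ 2)%Z, ((a - d) %/ 2)%Z, ((a + d) %/ 2)%Z).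
Lemma toMK q : toQ (toM q) = q.
Proof. by case: q => [[[x y] z] r] /=; congr (_, _, _, _); lia. Qed.
Lemma toQK M : cong_id_mod2 M -> toM (toQ M) = M.
Proof. by case: M => [[[x y] z] r] /= p; congr (_, _, _, _); lia. Qed.
Lemma mdet_toM q : mdet (toM q) = q.2 ^+ 2 + esym2 q.1.
Proof. by case: q => [[[x y] z] r] /=; ring. Qed.
Lemma pw3_2 x y z : selling_weight3 (2 * x) (2 * y) (2 * z) = selling_weight3 x y z.
Proof. by rewrite /selling_weight3 /full3 /half3 !pmulr_rgt0 // !mulf_eq0. Qed.
Lemma w3_toM q : weight3 (toM q) = p3 q.1.
Proof.
case: q => [[[x y] z] r]; rewrite /toM w3_pw.
rewrite (_ : 2 * (x + z) - (r + z) + (r - z) = 2 * x); last by ring.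
rewrite (_ : -2 * - (y + z) - (r + z) + (r - z) = 2 * y); last by ring.
rewrite (_ : r + z - (r - z) = 2 * z); last by ring.
exact: pw3_2.
Qed.
Lemma pw6_2 x y z : selling_weight6 (2 * x) (2 * y) (2 * z) = selling_weight6 x y z.
Proof.
have E (x1 y1 z1 x2 y2 z2 : int) : 2 * x1 = x2 -> 2 * y1 = y2 -> 2 * z1 = z2 -> selling_weight3 x2 y2 z2 = selling_weight3 x1 y1 z1.
  by move=> <- <- <-; exact: pw3_2.
rewrite (pw6E (2 * x)) (pw6E x).
have EE x2 y2 z2 x1 y1 z1 : [/\ 2 * x1 = x2, 2 * y1 = y2 & 2 * z1 = z2] -> selling_weight3 x2 y2 z2 = selling_weight3 x1 y1 z1 by case; apply: E.
rewrite (EE (2 * x) (2 * y) (2 * z) x y z) //.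
rewrite (EE (2 * x + 2 * (2 * z)) _ _ (x + 2 * z) (y + 2 * z) (- z)); last by split; ring.
rewrite (EE (2 * x + 2 * (2 * y)) _ _ (x + 2 * y) (- y) (z + 2 * y)); last by split; ring.
by rewrite (EE (- (2 * x)) _ _ (- x) (y + 2 * x) (z + 2 * x)) //; split; ring.
Qed.
Lemma w6_toM q : weight6 (toM q) = hex_weight q.1.
Proof.
case: q => [[[x y] z] r]; rewrite /toM w6_pw.
rewrite (_ : 2 * (x + z) - (r + z) + (r - z) = 2 * x); last by ring.
rewrite (_ : -2 * - (y + z) - (r + z) + (r - z) = 2 * y); last by ring.
rewrite (_ : r + z - (r - z) = 2 * z); last by ring.
exact: pw6_2.
Qed.
Lemma fx_toM q : fixes_mod3 (toM q) = sum3 q.1.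
Proof. by case: q => [[[x y] z] r] /=; lia. Qed.
Lemma sq_mod2 (r : int) : exists k, r ^+ 2 = r + 2 * k.
Proof.
have := divz_eq r 2; move: (r %/ 2)%Z (r %% 2)%Z (@modz_ge0 r 2 isT) (@ltz_pmod r 2 isT) => u v v0 v1 ->.
have [->|->] : v = 0 \/ v = 1 by lia.
  by exists (2 * u ^+ 2 - u); ring.
by exists (2 * u ^+ 2 + u); ring.
Qed.
Lemma par_toM n q : odd n -> cond n q -> cong_id_mod2 (toM q).
Proof.
case: q => [[[x y] z] r] on /andP[/eqP E /andP[/dvdzP[u Eu] /dvdzP[v Ev]]] /=.
have Ey : y = v * 2 + z by rewrite -Ev subrK.
have Ex : x = u * 2 + v * 2 + z by rewrite -addrA -Ey -Eu subrK.
have : (n%:Z %% 2)%Z = 1 by move: on; clear; lia.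
(* Modulo 2 one has x = y = z and n = r^2 + 3 z^2 = r + z, so an odd n makes the diagonal entries
   odd. *)
have : exists k, n%:Z = r + z + 2 * k.
  rewrite -E /= Ex Ey; have [k Ek] := sq_mod2 r; have [m Em] := sq_mod2 z.
  exists (k + m + m + m + z + (u + v) * v * 2 + (u + v) * z + v * z + v * z + z * (u + v)).
  rewrite Ek; apply/eqP; rewrite -subr_eq0; apply/eqP.
  transitivity (3 * (z ^+ 2 - z - 2 * m)); first by ring.
  by rewrite Em; ring.
by case=> k -> ; rewrite Ex Ey; clear; lia.
Qed.
Lemma par3_toQ M : cong_id_mod2 M -> par3 (toQ M).1.
Proof. by case: M => [[[x y] z] r] /=; lia. Qed.
Lemma p3_bd n (q : mat) : (0 < p3 q.1)%N -> q.2 ^+ 2 + esym2 q.1 = n%:Z -> q \in box n.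
Proof.
case: q => [[[x y] z] r] /= H E; rewrite mem_box.
have r0 := sqr_ge0 r.
have [? ? ?] := pw3_bd H (ltac:(by move: E r0; clear; lia) : x * y + y * z + z * x <= n%:Z).
apply/and4P; split => //.
have e20 : 0 <= x * y + y * z + z * x.
  have [? [? ?]] : 0 <= x /\ 0 <= y /\ 0 <= z by move: H; rewrite /selling_weight3 /full3 /half3; clear; lia.
  by rewrite !addr_ge0 ?mulr_ge0.
have : r ^+ 2 <= n%:Z by lia.
by clear; nia.
Qed.

Lemma box_mono m n q : (m <= n)%N -> q \in box m -> q \in box n.
Proof. by case: q => [[[x y] z] r] le; rewrite !mem_box; lia. Qed.
Lemma e2_hex t : (0 < hex_weight t)%N -> 0 <= esym2 t.
Proof.
case: t => [[x y] z]; rewrite /hex_weight /selling_weight6 addn_gt0 double_gt0 !lt0b => H; apply: hex_e2_ge0.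
by move: H; rewrite /full6 /half6 /thin; clear; do ![case/orP]; lia.
Qed.
Lemma sq_le (r : int) (n : nat) : r ^+ 2 <= n%:Z -> `|r| <= n%:Z.
Proof. by nia. Qed.
Lemma p6_bd n (q : mat) : (0 < hex_weight q.1)%N -> q.2 ^+ 2 + esym2 q.1 = n%:Z -> q \in box (3 * n).
Proof.
case: q => [[[x y] z] r] H E; rewrite mem_box; have e0 := e2_hex H; move: H E e0 => /= H E e0.
have r0 := sqr_ge0 r.
have [? ? ?] := pw6_bd H (ltac:(by move: E r0; clear; lia) : x * y + y * z + z * x <= n%:Z).
by have := @sq_le r n (ltac:(by move: E e0; clear; lia)); lia.
Qed.
Lemma res3 (x : int) : exists u v, x = 3 * u + v /\ [\/ v = 0, v = 1 | v = -1].
Proof.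
exists ((x + 1) %/ 3)%Z, (((x + 1) %% 3)%Z - 1); split; first by have := divz_eq (x + 1) 3; clear; lia.
have : ((x + 1) %% 3 = 0 \/ (x + 1) %% 3 = 1 \/ (x + 1) %% 3 = 2)%Z by clear; lia.
by case=> [->|[->|->]]; [constructor 3|constructor 1|constructor 2].
Qed.
(** Counts the fixed points on P^1(F_3) of the matrix of q, one flip for each point. The
    discriminant 4 (r^2 - n) is r^2 + 1 modulo 3: a nonzero square if 3 divides r, a nonsquare
    otherwise. *)
Lemma sum3_flip n (q : mat) : (n %% 3 = 2)%N -> q.2 ^+ 2 + esym2 q.1 = n%:Z ->
  (\sum_(i < 4) sum3 (flip i q.1) = 2 * (3 %| q.2)%Z)%N.
Proof.
case: q => [[[x y] z] r] n3 /=.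
have [xu [xv [-> Hx]]] := res3 x; have [yu [yv [-> Hy]]] := res3 y.
have [zu [zv [-> Hz]]] := res3 z; have [ru [rv [-> Hr]]] := res3 r => E.
have {}E : exists k, n%:Z = rv ^+ 2 + (xv * yv + yv * zv + zv * xv) + 3 * k.
  exists (3 * ru ^+ 2 + 2 * ru * rv + 3 * (xu * yu + yu * zu + zu * xu) + xu * (yv + zv) + yu * (xv + zv) + zu * (xv + yv)).
  by rewrite -E; ring.
rewrite !big_ord_recl big_ord0 /=; case: E => k E.
by case: Hx Hy Hz Hr E => -> [] -> [] -> [] ->; rewrite ?mulr0 ?mul0r ?mulr1 ?mul1r ?mulrN1 ?mulN1r ?expr0n ?expr1n ?sqrrN ?expr1n ?opprK /=; move: n3; clear; lia.
Qed.

Section HalfSum.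
Variable n : nat.
Hypotheses (n0 : (0 < n)%N) (n3 : (n %% 3 = 2)%N) (n2 : odd n).
Let bx := box (3 * n).

Lemma nsq2 : nonsquare n%:Z.
Proof.
move=> k; apply/eqP => E; have [u [v [Ek H]]] := res3 k.
have {}E : n%:Z = v ^+ 2 + 3 * (3 * u ^+ 2 + 2 * u * v) by rewrite -E Ek; ring.
by move: E; case: H => ->; rewrite ?expr0n ?sqrrN ?expr1n /=; move: n3; clear; lia.
Qed.

Lemma T3_sum : weight3_total n = (\sum_(q <- bx | cond n q) p3 q.1)%N.
Proof.
apply: (@sum_bij _ _ _ _ _ _ _ _ toQ toM); rewrite ?uniq_box //.
- move=> M _ /andP[p /eqP D]; rewrite -{1}(toQK p) w3_toM => F0.
  have E : (toQ M).2 ^+ 2 + esym2 (toQ M).1 = n%:Z by rewrite -mdet_toM toQK.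
  split; [by apply: box_mono (p3_bd F0 E); lia|by rewrite /cond E eqxx par3_toQ|by rewrite -w3_toM toQK|exact: toQK].
move=> q _ C F0; have /andP[/eqP E _] := C.
have p := par_toM n2 C; have D : mdet (toM q) = n%:Z by rewrite mdet_toM.
split; [by apply: elliptic_box => //; rewrite w3_toM F0|by rewrite p D eqxx|exact: w3_toM|exact: toMK].
Qed.
Lemma T6_sum : weight6_total n = (\sum_(q <- bx | cond n q && sum3 q.1) hex_weight q.1)%N.
Proof.
apply: (@sum_bij _ _ _ _ _ _ _ _ toQ toM); rewrite ?uniq_box //.
- move=> M _ /andP[/andP[p /eqP D] f]; rewrite -{1}(toQK p) w6_toM => F0.
  have E : (toQ M).2 ^+ 2 + esym2 (toQ M).1 = n%:Z by rewrite -mdet_toM toQK.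
  split; [exact: p6_bd|by rewrite /cond E eqxx par3_toQ // -fx_toM toQK|by rewrite -w6_toM toQK|exact: toQK].
move=> q _ /andP[C f] F0; have /andP[/eqP E _] := C.
have p := par_toM n2 C; have D : mdet (toM q) = n%:Z by rewrite mdet_toM.
split; [by apply: elliptic_box => //; rewrite w6_toM F0 orbT|by rewrite p D eqxx fx_toM|exact: w6_toM|exact: toMK].
Qed.
Lemma flip_sum (i : 'I_4) :
  (\sum_(q <- bx | cond n q && sum3 q.1) p3 (flip i q.1) = \sum_(q <- bx | cond n q && sum3 (flip i q.1)) p3 q.1)%N.
Proof.
apply: (@sum_bij _ _ _ _ _ _ _ _ (fun q : mat => (flip i q.1, q.2)) (fun q : mat => (flip i q.1, q.2))); rewrite ?uniq_box //.
- move=> [t r] _ /= /andP[/andP[/eqP /= E p] s] F0; rewrite /cond /= flipK e2_flip par3_flip p s E eqxx.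
  by split => //; apply: box_mono (@p3_bd n (flip i t, r) F0 _); rewrite /= ?e2_flip //; lia.
move=> [t r] _ /= /andP[/andP[/eqP /= E p] s] F0; rewrite /cond /= flipK e2_flip par3_flip p s E eqxx.
have H : hex_weight (flip i t) = (\sum_i0 p3 (flip i0 (flip i t)))%N by apply: p6E.
split => //; apply: (@p6_bd n (flip i t, r)); rewrite /= ?e2_flip // H (bigD1 i) //= flipK addn_gt0 F0 //.
Qed.
(** Splitting the hexagon weight into four triangles and moving the flip to the condition [sum3],
    the hexagon sum becomes twice the part of the triangle sum with 3 | r. In
    [triangle_hexagon_count] this cancels exactly that part. *)
Lemma sum_selling_weight : (\sum_(q <- bx | cond n q && ~~ (3 %| q.2)%Z) p3 q.1 = sigma n)%N.
Proof.
have u3 : ~~ (3 %| n)%N by rewrite /dvdn n3.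
have := triangle_hexagon_count n0 nsq2 u3 n2; rewrite T3_sum T6_sum.
under eq_bigr do rewrite p6E.
rewrite exchange_big /=; under eq_bigr do rewrite flip_sum big_mkcondr.
rewrite exchange_big /= [in X in (X + _)%N](eq_bigr (fun q : mat => 2 * ((3 %| q.2)%Z * p3 q.1))%N); last first.
  move=> q /andP[/eqP E _]; rewrite mulnA -(sum3_flip n3 E) big_distrl /=; apply: eq_bigr => i _.
  by case: (sum3 _); rewrite ?mul1n ?mul0n.
rewrite -big_distrr /= [in RHS](bigID (fun q : mat => (3 %| q.2)%Z)) /=.
rewrite (_ : \sum_(q <- bx | cond n q) (3 %| q.2)%Z * p3 q.1 = \sum_(q <- bx | cond n q && (3 %| q.2)%Z) p3 q.1)%N; first by lia.
by rewrite [RHS]big_mkcondr; apply: eq_bigr => q _; case: ifP; rewrite ?mul1n ?mul0n.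
Qed.
End HalfSum.

(** * The quaternion order *)

(* (x, y, z, t) stands for (x + y w) + (z + t w) j with w = exp(i pi / 3), j^2 = -1
   and j u = (conjugate of u) j. *)
Definition qmul (p q : mat) : mat :=
  let: (a1, a2, b1, b2) := p in let: (c1, c2, d1, d2) := q in
  (a1 * c1 - a2 * c2 - b1 * (d1 + d2) - b2 * d2, a1 * c2 + a2 * c1 + a2 * c2 + b1 * d2 - b2 * d1,
   a1 * d1 - a2 * d2 + b1 * (c1 + c2) + b2 * c2, a1 * d2 + a2 * d1 + a2 * d2 - b1 * c2 + b2 * c1).
Definition qconj (p : mat) : mat := let: (a1, a2, b1, b2) := p in (a1 + a2, - a2, - b1, - b2).
Definition enorm (x y : int) : int := x ^+ 2 + x * y + y ^+ 2.
Definition qnorm (p : mat) : int := let: (a1, a2, b1, b2) := p in enorm a1 a2 + enorm b1 b2.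
Definition qz (k : int) (p : mat) : mat := let: (a1, a2, b1, b2) := p in (k * a1, k * a2, k * b1, k * b2).
Definition qadd (p q : mat) : mat :=
  let: (a1, a2, b1, b2) := p in let: (c1, c2, d1, d2) := q in (a1 + c1, a2 + c2, b1 + d1, b2 + d2).
Definition q1 : mat := (1, 0, 0, 0).
Definition q0 : mat := (0, 0, 0, 0).
Definition qdvd (m : int) (p : mat) : bool := let: (a1, a2, b1, b2) := p in [&& (m %| a1)%Z, (m %| a2)%Z, (m %| b1)%Z & (m %| b2)%Z].

Lemma eq4 (a b c d a' b' c' d' : int) : a = a' -> b = b' -> c = c' -> d = d' -> (a, b, c, d) = (a', b', c', d').
Proof. by move=> -> -> -> ->. Qed.
Lemma qmulA p q r : qmul p (qmul q r) = qmul (qmul p q) r.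
Proof. by case: p => [[[? ?] ?] ?]; case: q => [[[? ?] ?] ?]; case: r => [[[? ?] ?] ?]; rewrite /qmul; apply: eq4; ring. Qed.
Lemma qnM p q : qnorm (qmul p q) = qnorm p * qnorm q.
Proof. by case: p => [[[? ?] ?] ?]; case: q => [[[? ?] ?] ?]; rewrite /qmul /qnorm /enorm; ring. Qed.
Lemma qn_conj p : qnorm (qconj p) = qnorm p.
Proof. by case: p => [[[? ?] ?] ?]; rewrite /qconj /qnorm /enorm; ring. Qed.
Lemma qconjK p : qconj (qconj p) = p.
Proof. by case: p => [[[? ?] ?] ?]; rewrite /qconj; apply: eq4; ring. Qed.
Lemma qmul_conj p : qmul p (qconj p) = qz (qnorm p) q1.
Proof. by case: p => [[[? ?] ?] ?]; rewrite /qmul /qnorm /qz /enorm /=; apply: eq4; ring. Qed.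
Lemma qconj_mul p : qmul (qconj p) p = qz (qnorm p) q1.
Proof. by case: p => [[[? ?] ?] ?]; rewrite /qmul /qnorm /qz /enorm /=; apply: eq4; ring. Qed.
Lemma qmul1q p : qmul q1 p = p.
Proof. by case: p => [[[? ?] ?] ?]; rewrite /qmul /=; apply: eq4; ring. Qed.
Lemma qmulq1 p : qmul p q1 = p.
Proof. by case: p => [[[? ?] ?] ?]; rewrite /qmul /=; apply: eq4; ring. Qed.
Lemma qmulzl k p q : qmul (qz k p) q = qz k (qmul p q).
Proof. by case: p => [[[? ?] ?] ?]; case: q => [[[? ?] ?] ?]; rewrite /qmul /qz; apply: eq4; ring. Qed.
Lemma qmulzr k p q : qmul p (qz k q) = qz k (qmul p q).
Proof. by case: p => [[[? ?] ?] ?]; case: q => [[[? ?] ?] ?]; rewrite /qmul /qz; apply: eq4; ring. Qed.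
Lemma qn_z k p : qnorm (qz k p) = k ^+ 2 * qnorm p.
Proof. by case: p => [[[? ?] ?] ?]; rewrite /qnorm /qz /enorm; ring. Qed.
Lemma qmulDl p q r : qmul (qadd p q) r = qadd (qmul p r) (qmul q r).
Proof. by case: p => [[[? ?] ?] ?]; case: q => [[[? ?] ?] ?]; case: r => [[[? ?] ?] ?]; rewrite /qmul /qadd; apply: eq4; ring. Qed.
Lemma en4 x y : 4 * enorm x y = (2 * x + y) ^+ 2 + 3 * y ^+ 2.
Proof. by rewrite /enorm; ring. Qed.
Lemma en_ge0 x y : 0 <= enorm x y.
Proof. have := en4 x y; have := sqr_ge0 (2 * x + y); have := sqr_ge0 y; move: (_ ^+ 2) ((2 * x + y) ^+ 2); clear; lia. Qed.
Lemma enC x y : enorm x y = enorm y x.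
Proof. by rewrite /enorm; ring. Qed.
Lemma en_bd x y (n : nat) : enorm x y <= n%:Z -> `|x| <= (2 * n)%N%:Z /\ `|y| <= (2 * n)%N%:Z.
Proof.
have B u v : enorm u v <= n%:Z -> `|v| <= (2 * n)%N%:Z.
  move=> le; have := en4 u v; have := sqr_ge0 (2 * u + v) => s0 E.
  have le2 : 3 * v ^+ 2 <= 4 * n%:Z by move: le s0 E; clear; lia.
  suff : `|v| <= v ^+ 2 by move: le2; clear; lia.
  by rewrite -[v ^+ 2](real_normK (num_real v)) expr2; have [->|] := eqVneq v 0; [rewrite normr0|move=> h; rewrite ler_peMr //; move: h; clear; lia].
by move=> le; split; [apply: (B y); rewrite enC|apply: B le].
Qed.
Lemma en_eq0 x y : enorm x y = 0 -> x = 0 /\ y = 0.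
Proof. by move=> E; have := @en_bd x y 0%N; rewrite E => /(_ isT); lia. Qed.
Lemma qn_ge0 p : 0 <= qnorm p.
Proof. by case: p => [[[? ?] ?] ?]; rewrite /qnorm addr_ge0 ?en_ge0. Qed.
Lemma qn_eq0 p : qnorm p = 0 -> p = q0.
Proof.
case: p => [[[a b] c] d]; rewrite /qnorm => E; have := en_ge0 a b; have := en_ge0 c d => h1 h2.
have [-> ->] : a = 0 /\ b = 0 by apply: en_eq0; lia.
by have [-> ->] : c = 0 /\ d = 0 by apply: en_eq0; lia.
Qed.
Lemma qn_gt0 p : p != q0 -> 0 < qnorm p.
Proof. by move=> h; rewrite lt0r qn_ge0 andbT; apply: contraNneq h => /qn_eq0 ->. Qed.

Lemma round1 (A M : int) : 0 < M -> exists q, 2 * `|A - M * q| <= M.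
Proof.
move=> M0; have M2 : 0 < 2 * M by lia.
exists ((2 * A + M) %/ (2 * M))%Z.
have := divz_eq (2 * A + M) (2 * M); have := @modz_ge0 (2 * A + M) (2 * M) (lt0r_neq0 M2).
have := @ltz_pmod (2 * A + M) (2 * M) M2.
move: ((2 * A + M) %/ (2 * M))%Z ((2 * A + M) %% (2 * M))%Z => q r h1 h2 E.
have {}E : 2 * (A - M * q) = r - M.
  by transitivity (2 * A + M - q * (2 * M) - M); [ring|rewrite E; ring].
by move: h1 h2 E; move: (A - M * q) => u; clear; lia.
Qed.
Lemma sq_norm_le (u m : int) : `|u| <= m -> u ^+ 2 <= m ^+ 2.
Proof. by move=> h; rewrite -(real_normK (num_real u)) lerXn2r ?nnegrE ?normr_ge0 // (le_trans _ h). Qed.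
(* Rounding y first and then x + y / 2 gives 7/16 < 1/2, so that two copies of Z[w]
   form a Euclidean ring. *)
Lemma round2 (A B M : int) : 0 < M -> exists q r, 16 * enorm (A - M * q) (B - M * r) <= 7 * M ^+ 2.
Proof.
move=> M0; have [r hr] := round1 B M0.
have M2 : 0 < 2 * M by lia.
have [q hq] := round1 (2 * A + (B - M * r)) M2.
have {}hq : `|2 * (A - M * q) + (B - M * r)| <= M.
  move: hq; rewrite (_ : 2 * A + (B - M * r) - 2 * M * q = 2 * (A - M * q) + (B - M * r)); last by ring.
  by move: (_ + _) => u; clear; lia.
exists q, r; move: hq hr; move: (A - M * q) (B - M * r) => x y hq hr.
have h1 := sq_norm_le hq; have h2 := @sq_norm_le (2 * y) M (ltac:(by move: hr; clear; lia)).
have E := en4 x y; have E2 : (2 * y) ^+ 2 = 4 * y ^+ 2 by ring.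
by move: h1 h2 E; rewrite E2; move: (enorm x y) (y ^+ 2) ((2 * x + y) ^+ 2) (M ^+ 2); clear; lia.
Qed.
Lemma qeuclid a b : b != q0 -> exists q r, a = qadd (qmul q b) r /\ qnorm r < qnorm b.
Proof.
move=> b0; have nb := qn_gt0 b0.
case E : (qmul a (qconj b)) => [[[x y] z] t].
have [qx [qy h1]] := round2 x y nb; have [qz' [qt h2]] := round2 z t nb.
pose q : mat := (qx, qy, qz', qt); pose r := qadd a (qz (-1) (qmul q b)).
exists q, r; split.
  by rewrite /r; case: (a) (qmul q b) => [[[? ?] ?] ?] [[[? ?] ?] ?]; rewrite /qadd /qz; apply: eq4; ring.
have Er : qmul r (qconj b) = (x - qnorm b * qx, y - qnorm b * qy, z - qnorm b * qz', t - qnorm b * qt).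
  rewrite /r qmulDl qmulzl -qmulA qmul_conj E qmulzr qmulq1 /q /qadd /qz; apply: eq4; ring.
(* Each of the two coordinates contributes at most 7/16 of the squared norm of [b], so that r has at
   most 14/16 of the norm of [b]. *)
have : 16 * (qnorm r * qnorm b) <= 14 * qnorm b ^+ 2.
  have -> : qnorm r * qnorm b = enorm (x - qnorm b * qx) (y - qnorm b * qy) + enorm (z - qnorm b * qz') (t - qnorm b * qt).
    by transitivity (qnorm (qmul r (qconj b))); [rewrite qnM qn_conj|rewrite Er].
  rewrite mulrDr (_ : 14 * qnorm b ^+ 2 = 7 * qnorm b ^+ 2 + 7 * qnorm b ^+ 2); first exact: lerD.
  by ring.
have -> : 16 * (qnorm r * qnorm b) = (16 * qnorm r) * qnorm b by ring.
have -> : 14 * qnorm b ^+ 2 = (14 * qnorm b) * qnorm b by ring.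
by rewrite ler_pM2r //; move: nb; clear; lia.
Qed.

Lemma qgcd z w : exists g a b c d, [/\ g = qadd (qmul a z) (qmul b w), z = qmul c g & w = qmul d g].
Proof.
have [m] := ubnP `|qnorm w|%N; elim: m z w => // m IH z w lt.
have [->|w0] := eqVneq w q0.
  exists z, q1, q0, q1, q0; split; rewrite ?qmul1q //; first by case: z => [[[? ?] ?] ?]; rewrite /qadd /=; apply: eq4; ring.
  by case: z => [[[? ?] ?] ?]; rewrite /=; apply: eq4; ring.
have [q [r [E lr]]] := qeuclid z w0.
have lt' : (`|qnorm r| < m)%N by have := qn_ge0 r; move: lt lr; clear; lia.
have [g [a [b [c [d [Eg Ew Er]]]]]] := IH w r lt'.
exists g, b, (qadd a (qz (-1) (qmul b q))), (qadd (qmul q c) d), c; split => //.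
  rewrite Eg qmulDl qmulzl -qmulA E; move: (qmul q w) => s.
  have -> : qmul b (qadd s r) = qadd (qmul b s) (qmul b r).
    by case: (b) => [[[? ?] ?] ?]; case: (s) => [[[? ?] ?] ?]; case: (r) => [[[? ?] ?] ?]; rewrite /qmul /qadd; apply: eq4; ring.
  by case: (qmul a w) (qmul b r) (qmul b s) => [[[? ?] ?] ?] [[[? ?] ?] ?] [[[? ?] ?] ?]; rewrite /qadd /qz; apply: eq4; ring.
by rewrite qmulDl -qmulA -Ew -Er.
Qed.

Definition quats_of_norm (n : nat) : seq mat := [seq q <- box (2 * n) | qnorm q == n%:Z].
Lemma mem_quats n q : (q \in quats_of_norm n) = (qnorm q == n%:Z).
Proof.
rewrite mem_filter andb_idr // => /eqP; case: q => [[[a b] c] d]; rewrite /qnorm mem_box => E.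
have [? ?] := @en_bd a b n (ltac:(by have := en_ge0 c d; move: E; clear; lia)).
have [? ?] := @en_bd c d n (ltac:(by have := en_ge0 a b; move: E; clear; lia)).
by apply/and4P.
Qed.
Lemma uniq_quats n : uniq (quats_of_norm n).
Proof. by rewrite filter_uniq // uniq_box. Qed.
Lemma size_quats1 : size (quats_of_norm 1) = 12.
Proof. by vm_compute. Qed.

Lemma qdvdP m q : reflect (exists q', q = qz m q') (qdvd m q).
Proof.
case: q => [[[a b] c] d]; apply: (iffP and4P) => [[/dvdzP[a' ->] /dvdzP[b' ->] /dvdzP[c' ->] /dvdzP[d' ->]]|[[[[a' b'] c'] d'] [-> -> -> ->]]].
  by exists (a', b', c', d'); rewrite /qz; apply: eq4; ring.
by split; apply: dvdz_mulr.
Qed.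
Lemma qz_inj m : m != 0 -> injective (qz m).
Proof.
move=> m0 [[[a b] c] d] [[[a' b'] c'] d'] [E1 E2 E3 E4].
by apply: eq4; apply: (mulfI m0).
Qed.
Lemma qmulIq b : b != q0 -> injective (qmul^~ b).
Proof.
move=> b0 x y /= E; apply: (@qz_inj (qnorm b)); first by rewrite gt_eqF ?qn_gt0.
by rewrite -[x]qmulq1 -[y]qmulq1 -!qmulzr -qmul_conj !qmulA E.
Qed.
(** Right divisibility by an element [p] of norm [m], made decidable: z = w p if and only if z times
    the conjugate of [p] is m w. *)
Definition rdiv (m : int) (p z : mat) : bool := qdvd m (qmul z (qconj p)).
Lemma rdivP p z : p != q0 -> reflect (exists w, z = qmul w p) (rdiv (qnorm p) p z).
Proof.
move=> p0; apply: (iffP (qdvdP _ _)) => [[w E]|[w ->]]; exists w.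
  apply: (@qz_inj (qnorm p)); first by rewrite gt_eqF ?qn_gt0.
  by rewrite -qmulzl -E -qmulA qconj_mul qmulzr qmulq1.
by rewrite -qmulA qmul_conj qmulzr qmulq1.
Qed.
Lemma qn_addz k u v : exists m, qnorm (qadd u (qz k v)) = qnorm u + k * m.
Proof.
case: u => [[[a b] c] d]; case: v => [[[a' b'] c'] d'].
exists (2 * a * a' + k * a' ^+ 2 + a * b' + a' * b + k * a' * b' + 2 * b * b' + k * b' ^+ 2 +
  (2 * c * c' + k * c' ^+ 2 + c * d' + c' * d + k * c' * d' + 2 * d * d' + k * d' ^+ 2)).
by rewrite /qnorm /qadd /qz /enorm; ring.
Qed.
Section Prime.
Variable p : nat.
Hypothesis pp : prime p.
Let p0 : (0 < p)%N := prime_gt0 pp.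
Let pz : p%:Z != 0. Proof. by move: p0; clear; lia. Qed.

Lemma qn_p0 q : qnorm q = p%:Z -> q != q0.
Proof. by move=> E; apply: contraNneq pz => q00; rewrite -E q00. Qed.
(** The gcd g of z and p has norm divisible by p, because it is a combination of both and p divides
    the norm of z; its norm divides p^2, and norm p^2 would make p divide z. *)
Lemma right_gcd z : (p%:Z %| qnorm z)%Z -> ~~ qdvd p%:Z z ->
  exists g, [/\ qnorm g = p%:Z, exists w, z = qmul w g & forall q, qnorm q = p%:Z -> (exists w, z = qmul w q) ->
     exists2 e, qnorm e = 1 & q = qmul e g].
Proof.
move=> /dvdzP[k Ek] nd; have [g [a [b [c [d [Eg Ez Ep]]]]]] := qgcd z (qz p%:Z q1).
have [m Em] : exists m, qnorm g = p%:Z * m.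
  rewrite Eg qmulzr qmulq1; have [m ->] := qn_addz p%:Z (qmul a z) b.
  by exists (qnorm a * k + m); rewrite qnM Ek; ring.
have N : qnorm d * m = p%:Z.
  have := congr1 qnorm Ep; rewrite qnM qn_z Em (_ : qnorm q1 = 1) // mulr1 => E.
  by apply: (mulfI pz); rewrite mulrCA -E expr2.
have m0 : 0 <= m by rewrite -(pmulr_rge0 (x := p%:Z)) -?Em ?qn_ge0 //; move: p0; clear; lia.
have dg : qnorm g = p%:Z.
  have Na : (`|qnorm d| * `|m|)%N = p by rewrite -abszM N.
  have /primeP[_ /(_ `|m|%N)] := pp; rewrite -{1}Na dvdn_mull // => /(_ isT)/orP[]/eqP m1.
    by rewrite Em (_ : m = 1) ?mulr1 //; move: m0 m1; clear; lia.
  have d1 : qnorm d = 1.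
    have mp : m = p%:Z by move: m0 m1; clear; lia.
    by apply: (mulIf pz); rewrite -{1}mp N mul1r.
  case/negP: nd; apply/qdvdP; exists (qmul c (qconj d)).
  rewrite Ez; have -> : g = qmul (qconj d) (qz p%:Z q1).
    by rewrite Ep qmulA qconj_mul d1 qmulzl qmul1q; case: (g) => [[[? ?] ?] ?]; rewrite /qz !mul1r.
  by rewrite !qmulzr qmulq1.
exists g; split => //; first by exists c.
move=> q nq [w E]; pose e := qadd (qmul a w) (qmul b (qconj q)).
have Eq : g = qmul e q by rewrite /e qmulDl -!qmulA -E qconj_mul nq.
have e1 : qnorm e = 1.
  by apply: (mulIf pz); rewrite -{1}nq -qnM -Eq dg mul1r.
exists (qconj e); first by rewrite qn_conj.
by rewrite Eq qmulA qconj_mul e1 qmulzl qmul1q; case: (q) => [[[? ?] ?] ?]; rewrite /qz !mul1r.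
Qed.
(** The right divisors of norm p are the left unit multiples of the gcd, and the order has 12
    units. *)
Lemma count_right_divisors z : (p%:Z %| qnorm z)%Z -> ~~ qdvd p%:Z z -> count (rdiv p%:Z^~ z) (quats_of_norm p) = 12.
Proof.
move=> dv nd; have [g [ng zg U]] := right_gcd dv nd; have g0 := qn_p0 ng.
rewrite -size_filter -size_quats1 -(size_map (qmul^~ g) (quats_of_norm 1)); apply: perm_size; apply: uniq_perm.
- by rewrite filter_uniq // uniq_quats.
- by rewrite map_inj_uniq ?uniq_quats //; apply: qmulIq.
move=> q; rewrite mem_filter mem_quats; apply/andP/mapP => [[dq /eqP nq]|[e]].
  have q0' := qn_p0 nq; rewrite -nq in dq; have [e e1 ->] := U q nq (rdivP _ q0' dq).
  by exists e => //; rewrite mem_quats e1.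
rewrite mem_quats => /eqP e1 ->; have nq : qnorm (qmul e g) = p%:Z by rewrite qnM e1 mul1r.
rewrite nq eqxx; split => //; rewrite -[X in rdiv X]nq; apply/rdivP; first exact: qn_p0.
have [w ->] := zg; exists (qmul w (qconj e)); rewrite -qmulA (qmulA (qconj e)) qconj_mul e1.
by rewrite qmulzl qmul1q; case: (g) => [[[? ?] ?] ?]; rewrite /qz !mul1r.
Qed.
Lemma count_dvd z : qdvd p%:Z z -> count (rdiv p%:Z^~ z) (quats_of_norm p) = size (quats_of_norm p).
Proof.
move=> /qdvdP[z' ->]; rewrite -count_predT; apply: eq_count => q.
by rewrite /rdiv qmulzl; apply/qdvdP; exists (qmul z' (qconj q)).
Qed.

(** Group the products w q by their value z: 12 factorizations if p does not divide z, one for every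
    q of norm p otherwise. *)
Lemma double_count (m : nat) (F : mat -> nat) :
  (\sum_(q <- quats_of_norm p) \sum_(w <- quats_of_norm m) F (qmul w q) =
   12 * \sum_(z <- quats_of_norm (p * m) | ~~ qdvd p%:Z z) F z + size (quats_of_norm p) * \sum_(z <- quats_of_norm (p * m) | qdvd p%:Z z) F z)%N.
Proof.
transitivity (\sum_(z <- quats_of_norm (p * m)) F z * count (rdiv p%:Z^~ z) (quats_of_norm p))%N.
  transitivity (\sum_(q <- quats_of_norm p) \sum_(z <- quats_of_norm (p * m) | rdiv p%:Z q z) F z)%N.
    apply: eq_big_seq => q; rewrite mem_quats => /eqP nq; have q0' := qn_p0 nq.
    rewrite -(big_map (qmul^~ q) predT) -[RHS]big_filter; apply: perm_big; apply: uniq_perm.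
    - by rewrite map_inj_uniq ?uniq_quats //; apply: qmulIq.
    - by rewrite filter_uniq // uniq_quats.
    move=> z; rewrite mem_filter mem_quats -[X in rdiv X]nq; apply/mapP/andP => [[w]|[/(rdivP _ q0')[w Ez] /eqP nz]].
      rewrite mem_quats => /eqP nw ->; rewrite qnM nw nq PoszM mulrC eqxx; split => //.
      by rewrite -[X in rdiv X]nq; apply/rdivP => //; exists w.
    exists w => //; rewrite mem_quats; apply/eqP; apply: (mulIf pz).
    by rewrite -{1}nq -qnM -Ez nz PoszM mulrC.
  under eq_bigr do rewrite big_mkcond.
  rewrite exchange_big /=; apply: eq_bigr => z _; rewrite -big_mkcond /= big_const_seq iter_addn_0 mulnC //.
rewrite (bigID (qdvd p%:Z)) /= addnC !big_distrr /=; congr addn.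
  rewrite big_seq_cond [RHS]big_seq_cond; apply: eq_bigr => z /andP[]; rewrite mem_quats => /eqP nz nd.
  by rewrite count_right_divisors 1?mulnC // nz PoszM dvdz_mulr.
by apply: eq_bigr => z d; rewrite count_dvd 1?mulnC.
Qed.
Lemma sum_dvd (m : nat) (F : mat -> nat) :
  (\sum_(z <- quats_of_norm (p * m) | qdvd p%:Z z) F z = if (p %| m)%N then \sum_(z <- quats_of_norm (m %/ p)) F (qz p%:Z z) else 0)%N.
Proof.
case: ifP => [/dvdnP[k ->]|nd]; last first.
  rewrite big_seq_cond big1 // => z /andP[]; rewrite mem_quats => /eqP nz /qdvdP[z' Ez]; case/negP: nd.
  move: nz; rewrite Ez qn_z PoszM expr2 -mulrA => /(mulfI pz) E.
  by apply/dvdnP; exists `|qnorm z'|%N; have := congr1 absz E; rewrite abszM mulnC.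
rewrite mulnK // -(big_map (qz p%:Z) predT) -[LHS]big_filter; apply: perm_big; apply: uniq_perm.
- by rewrite filter_uniq // uniq_quats.
- by rewrite map_inj_uniq ?uniq_quats //; apply: qz_inj.
move=> z; rewrite mem_filter mem_quats; apply/andP/mapP => [[/qdvdP[z' Ez] /eqP nz]|[z']].
  exists z' => //; rewrite mem_quats; apply/eqP; move: nz; rewrite Ez qn_z.
  rewrite (_ : (p * (k * p))%N%:Z = p%:Z ^+ 2 * k%:Z); last by rewrite !PoszM; ring.
  by apply: mulfI; rewrite expf_neq0.
rewrite mem_quats => /eqP nz ->; split; first by apply/qdvdP; exists z'.
by rewrite qn_z nz !PoszM; apply/eqP; ring.
Qed.
End Prime.

(** * A conic over a finite field *)

Section Conic.
Variable F : finFieldType.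
Hypotheses (F2 : (2%:R : F) != 0) (F3 : (3%:R : F) != 0) (oddF : odd #|F|).
Definition fnorm (b : F * F) : F := b.1 ^+ 2 + b.1 * b.2 + b.2 ^+ 2.

Lemma squares_gt : (#|F| < 2 * #|[set x ^+ 2 | x : F]|)%N.
Proof.
have le : (#|F| <= 2 * #|[set x ^+ 2 | x : F]|)%N.
  rewrite -[leqLHS]sum1_card (partition_big_imset (fun x : F => x ^+ 2)) /=.
  apply: (@leq_trans (\sum_(s in [set x ^+ 2 | x : F]) 2)%N); last by rewrite sum_nat_const mulnC.
  apply: leq_sum => s /imsetP[x0 _ ->].
  rewrite sum1_card; apply: leq_trans (_ : #|[set x0; - x0]| <= _)%N; last by rewrite cards2; case: (_ == _).
  by apply: subset_leq_card; apply/subsetP => x; rewrite unfold_in /= => E; rewrite !inE -eqf_sqr.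
by rewrite ltn_neqAle le andbT; apply: contraTneq oddF => ->; rewrite mul2n odd_double.
Qed.
(** Since 4 (x^2 + xy + y^2) = (2x + y)^2 + 3 y^2, it suffices that the squares meet the set of 4a -
    3s with s a square; each is more than half of the field. *)
Lemma nf_surj a : exists b, fnorm b = a.
Proof.
pose S := [set x ^+ 2 | x : F]; pose T := [set 4%:R * a - 3%:R * s | s in S].
have cT : #|T| = #|S| by rewrite card_imset // => s s' /addrI/oppr_inj/(mulfI F3).
have : S :&: T != set0.
  apply/eqP => E; have := subset_leq_card (subsetT (S :|: T)).
  rewrite cardsU E cards0 subn0 cT cardsT addnn -mul2n leqNgt; by rewrite squares_gt.
case/set0Pn => _ /setIP[/imsetP[x _ ->] /imsetP[_ /imsetP[y _ ->] E]].
exists ((x - y) / 2%:R, y); rewrite /fnorm /=.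
have F4 : (4%:R : F) != 0 by rewrite (_ : 4%:R = 2%:R * 2%:R) ?mulf_neq0 // -natrM.
apply: (mulfI F4); transitivity (x ^+ 2 + 3%:R * y ^+ 2); first by field.
by rewrite E subrK.
Qed.
Definition mulE (b g : F * F) : F * F := (b.1 * g.1 - b.2 * g.2, b.1 * g.2 + b.2 * g.1 + b.2 * g.2).
Lemma nfM b g : fnorm (mulE b g) = fnorm b * fnorm g.
Proof. by rewrite /fnorm /mulE /=; ring. Qed.
Lemma mulE_inj g : fnorm g != 0 -> injective (mulE^~ g).
Proof.
move=> g0; have K b : mulE (mulE b g) (g.1 + g.2, - g.2) = (fnorm g * b.1, fnorm g * b.2).
  by rewrite /mulE /fnorm /=; congr (_, _); ring.
move=> b b' /= E; have := K b; rewrite E K => -[/(mulfI g0) E1 /(mulfI g0) E2].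
by rewrite [b]surjective_pairing [b']surjective_pairing E1 E2.
Qed.
Definition fnorm_count (a : F) : nat := #|[set b | fnorm b == a]|.
Lemma cn_le a a' : a != 0 -> a' != 0 -> (fnorm_count a <= fnorm_count a')%N.
Proof.
move=> h h'; have [g Eg] := nf_surj (a' / a).
have g0 : fnorm g != 0 by rewrite Eg mulf_neq0 ?invr_eq0.
rewrite /fnorm_count -(card_imset _ (mulE_inj g0)); apply: subset_leq_card; apply/subsetP => _ /imsetP[b + ->].
by rewrite !inE nfM Eg => /eqP ->; rewrite mulrC divfK.
Qed.
Definition num_cyclo_roots : nat := #|[set t : F | t ^+ 2 + t + 1 == 0]|.
Lemma cn0 : fnorm_count 0 = (1 + #|F|.-1 * num_cyclo_roots)%N.
Proof.
rewrite /fnorm_count; have -> : [set b | fnorm b == 0] = (0, 0) |: [set (t * y, y) | t in [set t | t ^+ 2 + t + 1 == 0], y in [set y | y != 0]].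
  apply/setP => -[x y]; rewrite !inE; apply/eqP/orP => [|[/eqP[-> ->]|/imset2P[t y' + + [-> ->]]]].
  - rewrite /fnorm /=; have [->|y0] := eqVneq y 0.
      by rewrite mulr0 expr0n /= !addr0 => /eqP; rewrite sqrf_eq0 => /eqP->; left.
    move=> E; right; apply/imset2P; exists (x / y) y; rewrite ?inE ?divfK //.
    apply/eqP; apply: (mulIf (expf_neq0 2 y0)); rewrite mul0r -E; field; exact: y0.
  - by rewrite /fnorm /=; ring.
  by rewrite !inE => /eqP E y0; rewrite /fnorm /=; transitivity ((t ^+ 2 + t + 1) * y' ^+ 2); [ring|rewrite E mul0r].
rewrite cardsU1 (_ : _ \notin _ = true) /=; last first.
  by apply/imset2P => -[t y _]; rewrite inE => y0 [_ E]; rewrite -E eqxx in y0.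
rewrite curry_imset2X card_in_imset.
  rewrite cardsX mulnC /num_cyclo_roots; congr (_ + _ * _)%N.
  by rewrite -(cardC1 (0 : F)); apply: eq_card => y; rewrite !inE.
move=> [t y] [t' y']; rewrite !inE /= => /andP[_ y0] _ [E1 E2]; rewrite -E2 in E1 *.
by rewrite (mulIf y0 E1).
Qed.
(** All nonzero values of the norm form have equally many preimages, so counting F^2 by the value
    gives q^2 = 1 + (q - 1) rho + (q - 1) c, where rho is the number of roots and c the required
    number. *)
Lemma conic_card : (fnorm_count (-1)%R + num_cyclo_roots = #|F|.+1)%N.
Proof.
have F1 : (1 < #|F|)%N by apply/card_gt1P; exists 0, 1; split => //; rewrite eq_sym oner_neq0.
have N1 : (-1 : F) != 0 by rewrite oppr_eq0 oner_eq0.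
have : (#|F| * #|F| = fnorm_count 0%R + #|F|.-1 * fnorm_count (-1)%R)%N.
  rewrite -card_prod -sum1_card (partition_big fnorm predT) //= (bigD1 0) //=; congr addn.
    by rewrite sum1_card /fnorm_count; apply: eq_card => b; rewrite !inE.
  rewrite (eq_bigr (fun=> fnorm_count (-1)%R)) => [|a a0]; last first.
    transitivity (fnorm_count a); first by rewrite sum1_card; apply: eq_card => b; rewrite !inE.
    by apply/eqP; rewrite eqn_leq !cn_le.
  by rewrite sum_nat_const cardC1.
rewrite cn0; move: F1; case: #|F| => // q F1 /=; nia.
Qed.
End Conic.

(** * Elements of prime norm *)

(** The last two equations determine (x, y) by Cramer's rule, with determinant the norm of U; the
    first two then hold because the norms of U and V add up to zero. *)
Lemma annihilator_line (K : fieldType) (U1 U2 V1 V2 x y : K) :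
  U1 ^+ 2 + U1 * U2 + U2 ^+ 2 + (V1 ^+ 2 + V1 * V2 + V2 ^+ 2) = 0 -> U1 ^+ 2 + U1 * U2 + U2 ^+ 2 != 0 ->
  [&& U1 + U2 + x * (V1 + V2) + y * V2 == 0, - U2 - x * V2 + y * V1 == 0,
      - V1 + x * U1 - y * U2 == 0 & - V2 + x * U2 + y * (U1 + U2) == 0] =
  (x == (V1 * (U1 + U2) + V2 * U2) / (U1 ^+ 2 + U1 * U2 + U2 ^+ 2)) && (y == (V2 * U1 - V1 * U2) / (U1 ^+ 2 + U1 * U2 + U2 ^+ 2)).
Proof.
move=> NM nd.
apply/and4P/andP => [[_ _ /eqP h3 /eqP h4]|[/eqP -> /eqP ->]].
  split; apply/eqP; apply: (canRL (mulfK nd)).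
    transitivity (V1 * (U1 + U2) + V2 * U2 + (U1 + U2) * (- V1 + x * U1 - y * U2) + U2 * (- V2 + x * U2 + y * (U1 + U2))); first by ring.
    by rewrite h3 h4 !mulr0 !addr0.
  transitivity (V2 * U1 - V1 * U2 - U2 * (- V1 + x * U1 - y * U2) + U1 * (- V2 + x * U2 + y * (U1 + U2))); first by ring.
  by rewrite h3 h4 !mulr0 subr0 addr0.
have L (w w' : K) : w = w' * (U1 ^+ 2 + U1 * U2 + U2 ^+ 2 + (V1 ^+ 2 + V1 * V2 + V2 ^+ 2)) / (U1 ^+ 2 + U1 * U2 + U2 ^+ 2) -> w == 0.
  by move=> ->; rewrite NM mulr0 mul0r.
split.
- by apply: (L _ (U1 + U2)); field.
- by apply: (L _ (- U2)); field.
- by apply: (L _ 0); field.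
by apply: (L _ 0); field.
Qed.
Lemma annihilator_root2 (K : fieldType) (V1 V2 t : K) : V1 ^+ 2 + V1 * V2 + V2 ^+ 2 = 0 -> V1 != 0 ->
  (V2 - t * V1 == 0) && (- t * V2 - V1 - V2 == 0) = (t == V2 / V1).
Proof.
move=> M0 h; apply/andP/eqP => [[/eqP h1 _]|->]; first by apply: (canRL (mulfK h)); apply/esym/eqP; rewrite -subr_eq0 h1.
rewrite divfK // subrr eqxx; split => //; apply/eqP; apply: (mulIf h); rewrite mul0r.
by transitivity (- (V1 ^+ 2 + V1 * V2 + V2 ^+ 2)); [field|rewrite M0 oppr0].
Qed.
Lemma annihilator_root1 (K : fieldType) (U1 U2 t : K) : U1 ^+ 2 + U1 * U2 + U2 ^+ 2 = 0 -> U2 != 0 ->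
  (t * (U1 + U2) + U2 == 0) && (U1 - t * U2 == 0) = (t == U1 / U2).
Proof.
move=> M0 h; apply/andP/eqP => [[_ /eqP h1]|->]; first by apply: (canRL (mulfK h)); apply/esym/eqP; rewrite -subr_eq0 h1.
rewrite divfK // subrr eqxx; split => //; apply/eqP; apply: (mulIf h); rewrite mul0r.
by transitivity (U1 ^+ 2 + U1 * U2 + U2 ^+ 2); [field|rewrite M0].
Qed.

Section Prime.
Variable p : nat.
Hypotheses (pp : prime p) (p2 : p != 2) (p3 : p != 3).
Let F : finFieldType := 'F_p.
Let dF (m : int) : (p%:Z %| m)%Z = (m%:~R == 0 :> F) := dvdz_pcharf (pchar_Fp pp) m.
Let lf (x : F) : int := (x : nat)%:Z.
Let lfK x : (lf x)%:~R = x :> F. Proof. by rewrite -pmulrn natr_Zp. Qed.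
Let simF := (rmorphD, rmorphB, rmorphM, rmorphN, rmorph1, rmorph0, lfK).

Lemma rdiv_qn q z : qnorm q = p%:Z -> rdiv p%:Z q z -> (p%:Z %| qnorm z)%Z.
Proof.
by move=> nq; rewrite -[X in rdiv X]nq => /(rdivP _ (qn_p0 pp nq))[w ->]; rewrite qnM nq dvdz_mull.
Qed.
Lemma en_noz x y : enorm x y = p%:Z -> (p%:Z %| x)%Z -> (p%:Z %| y)%Z -> False.
Proof.
move=> E /dvdzP[x' Ex] /dvdzP[y' Ey]; have p1 := prime_gt1 pp.
have p0 : p%:Z != 0 by move: p1; clear; lia.
have : p%:Z * enorm x' y' = 1 by apply: (mulfI p0); rewrite mulr1 -{3}E Ex Ey /enorm; ring.
have := en_ge0 x' y'; move: (enorm x' y') p1; clear => w p1 w0.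
have [->|w1] : w = 0 \/ 1 <= w by lia.
  by rewrite mulr0.
by move=> h; have := ler_wpM2l (isT : 0 <= p%:Z) w1; rewrite h; lia.
Qed.
Lemma dvd_en u1 u2 v1 v2 : qnorm (u1, u2, v1, v2) = p%:Z -> (p%:Z %| enorm u1 u2)%Z ->
  (u1 = 0 /\ u2 = 0) /\ enorm v1 v2 = p%:Z \/ (v1 = 0 /\ v2 = 0) /\ enorm u1 u2 = p%:Z.
Proof.
rewrite /qnorm => E /dvdzP[k Ek]; have p1 := prime_gt1 pp.
have h1 := en_ge0 u1 u2; have h2 := en_ge0 v1 v2.
have : k = 0 \/ k = 1.
  have : 0 <= k * p%:Z <= p%:Z by rewrite -Ek h1 -E lerDl.
  move: p1; clear => p1 /andP[h1 h2].
  have k0 : 0 <= k by move: h1; rewrite pmulr_lge0 //; lia.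
  have k1 : k <= 1 by move: h2; rewrite -[X in _ <= X]mul1r ler_pM2r //; lia.
  by lia.
case=> k0; rewrite k0 ?mul0r ?mul1r in Ek; [left|right]; rewrite Ek in E *.
  by rewrite add0r in E; split=> //; apply: en_eq0.
by split=> //; apply: en_eq0; apply: (addrI p%:Z); rewrite E addr0.
Qed.
Lemma enF x y : (enorm x y)%:~R = x%:~R ^+ 2 + x%:~R * y%:~R + y%:~R ^+ 2 :> F.
Proof. by rewrite /enorm !rmorphD rmorphM !rmorphXn. Qed.

Lemma and4_eq0 (a b c d a' b' c' d' : F) : a = a' -> b = b' -> c = c' -> d = d' ->
  [&& a == 0, b == 0, c == 0 & d == 0] = [&& a' == 0, b' == 0, c' == 0 & d' == 0].
Proof. by move=> -> -> -> ->. Qed.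
(** Test elements 1 + b j and t + w. An element u + v j of norm p right-divides exactly one of them:
    some 1 + b j if p does not divide the norm of u, some t + w if it does. *)
Let z1 (b : F * F) : mat := (1, 0, lf b.1, lf b.2).
Let z2 (t : F) : mat := (lf t, 1, 0, 0).
Lemma z1_rdiv u1 u2 v1 v2 b : rdiv p%:Z (u1, u2, v1, v2) (z1 b) =
  [&& u1%:~R + u2%:~R + b.1 * (v1%:~R + v2%:~R) + b.2 * v2%:~R == 0, - u2%:~R - b.1 * v2%:~R + b.2 * v1%:~R == 0,
      - v1%:~R + b.1 * u1%:~R - b.2 * u2%:~R == 0 & - v2%:~R + b.1 * u2%:~R + b.2 * (u1%:~R + u2%:~R) == 0 :> F].
Proof.
rewrite /rdiv /qdvd /qmul /qconj /z1 !dF !simF /= ?lfK.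
by apply: and4_eq0; ring.
Qed.
Lemma z2_rdiv u1 u2 v1 v2 t : rdiv p%:Z (u1, u2, v1, v2) (z2 t) =
  [&& t * (u1%:~R + u2%:~R) + u2%:~R == 0, u1%:~R - t * u2%:~R == 0,
      v2%:~R - t * v1%:~R == 0 & - t * v2%:~R - v1%:~R - v2%:~R == 0 :> F].
Proof.
rewrite /rdiv /qdvd /qmul /qconj /z2 !dF !simF /= ?lfK.
by apply: and4_eq0; ring.
Qed.
Let nu (q : mat) : bool := (p%:Z %| enorm q.1.1.1 q.1.1.2)%Z.

Lemma count_affine_points q : qnorm q = p%:Z -> #|[pred b | rdiv p%:Z q (z1 b)]| = ~~ nu q :> nat.
Proof.
case: q => [[[u1 u2] v1] v2] E; rewrite /nu /=; case: (boolP (p%:Z %| enorm u1 u2)%Z) => [d|nd] /=.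
  apply: eq_card0 => b; rewrite !inE z1_rdiv; apply/negbTE/negP => /and4P[h1 h2 h3 h4].
  case: (dvd_en E d) => [[[u10 u20] En]|[[v10 v20] En]].
    apply: (en_noz En); rewrite dF.
      by move: h3; rewrite u10 u20 !rmorph0 !mulr0 subr0 addr0 oppr_eq0.
    by move: h4; rewrite u10 u20 !rmorph0 !addr0 !mulr0 !addr0 oppr_eq0.
  have U2 : u2%:~R == 0 :> F by move: h2; rewrite v10 v20 !rmorph0 !mulr0 subr0 addr0 oppr_eq0.
  apply: (en_noz En); rewrite dF //.
  by move: h1; rewrite v10 v20 (eqP U2) !rmorph0 !addr0 !mulr0 !addr0.
have NM : (enorm u1 u2)%:~R + (enorm v1 v2)%:~R = 0 :> F.
  by rewrite -rmorphD /= -[_ + _]/(qnorm (u1, u2, v1, v2)) E; apply/eqP; rewrite -dF.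
rewrite dF enF in nd; rewrite !enF in NM.
pose N : F := u1%:~R ^+ 2 + u1%:~R * u2%:~R + u2%:~R ^+ 2; rewrite -/N in nd.
rewrite -(card1 ((v1%:~R * (u1%:~R + u2%:~R) + v2%:~R * u2%:~R) / N, (v2%:~R * u1%:~R - v1%:~R * u2%:~R) / N)).
apply: eq_card => -[x y]; rewrite !inE z1_rdiv /= xpair_eqE.
exact: annihilator_line.
Qed.
Lemma count_points_at_infinity q : qnorm q = p%:Z -> #|[pred t | rdiv p%:Z q (z2 t)]| = nu q :> nat.
Proof.
case: q => [[[u1 u2] v1] v2] E; rewrite /nu /=; case: (boolP (p%:Z %| enorm u1 u2)%Z) => [d|nd] /=.
  case: (dvd_en E d) => [[[u10 u20] En]|[[v10 v20] En]].
    have M0 : (enorm v1 v2)%:~R = 0 :> F by apply/eqP; rewrite -dF En.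
    have V1 : v1%:~R != 0 :> F.
      apply/negP => h; apply: (en_noz En); rewrite dF //.
      by move: M0; rewrite enF (eqP h) expr0n mul0r !add0r => /eqP; rewrite expf_eq0.
    rewrite -(card1 (v2%:~R / v1%:~R : F)); apply: eq_card => t; rewrite !inE z2_rdiv u10 u20 !rmorph0.
    rewrite !mulr0 !addr0 mulr0 subr0 eqxx /=; rewrite enF in M0; exact: annihilator_root2.
  have M0 : (enorm u1 u2)%:~R = 0 :> F by apply/eqP; rewrite -dF En.
  have V1 : u2%:~R != 0 :> F.
    apply/negP => h; apply: (en_noz En); rewrite dF //.
    by move: M0; rewrite enF (eqP h) expr0n mulr0 !addr0 => /eqP; rewrite expf_eq0.
  rewrite -(card1 (u1%:~R / u2%:~R : F)); apply: eq_card => t; rewrite !inE z2_rdiv v10 v20 !rmorph0.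
  rewrite !mulr0 !subr0 eqxx !andbT /=; rewrite enF in M0; exact: annihilator_root1.
apply: eq_card0 => t; rewrite !inE z2_rdiv; apply/negbTE/negP => /and4P[/eqP h1 /eqP h2 _ _].
case/negP: nd; rewrite dF enF; move: h1 h2; move: (u1%:~R : F) (u2%:~R : F) => U1 U2 h1 h2.
have E1 : U1 = t * U2 by apply/eqP; rewrite -subr_eq0 h2.
by apply/eqP; transitivity (U2 * (t * (U1 + U2) + U2)); [rewrite E1; ring|rewrite h1 mulr0].
Qed.

(** Pairs of a test element and a right divisor of norm p, counted in both ways; only test elements
    of norm divisible by p have such divisors, and each has 12. *)
Lemma count_right_divisors_sum (I : finType) (z : I -> mat) (P : pred I) (N : pred mat) :
  (forall i, ~~ qdvd p%:Z (z i)) -> (forall i, (p%:Z %| qnorm (z i))%Z = P i) ->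
  (forall q, qnorm q = p%:Z -> #|[pred i | rdiv p%:Z q (z i)]| = N q :> nat) ->
  count N (quats_of_norm p) = (12 * #|[set i | P i]|)%N.
Proof.
move=> nd dP H.
transitivity (\sum_(q <- quats_of_norm p) \sum_i (rdiv p%:Z q (z i)))%N.
  rewrite -sum1_count big_mkcond; apply: eq_big_seq => q; rewrite mem_quats => /eqP nq.
  transitivity (N q : nat); first by case: (N q).
  rewrite -(H q nq) -sum1_card big_mkcond; apply: eq_bigr => i _.
  by rewrite inE; case: (rdiv _ _ _).
rewrite exchange_big /= [LHS](eq_bigr (fun i => 12 * (P i))%N) => [|i _].
  by rewrite -big_distrr /= -big_mkcond /= sum1_card cardsE.
rewrite -big_mkcond /= sum1_count; case h : (P i).
  by rewrite count_right_divisors // dP h.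
apply/eqP; rewrite muln0 -leqn0 leqNgt -has_count; apply/hasPn => q; rewrite mem_quats => /eqP nq.
by apply: contraFN h => /(rdiv_qn nq); rewrite dP.
Qed.
(** The norms 1 + N(b) and t^2 + t + 1 of the test elements are divisible by p for p + 1 of them, by
    [conic_card]. *)
Lemma size_quats_of_prime : size (quats_of_norm p) = (12 * p.+1)%N.
Proof.
have p1 := prime_gt1 pp.
have nz m : (0 < m < p)%N -> (m%:R : F) != 0.
  move=> /andP[m0 mp]; rewrite pmulrn -dF dvdzE /=; apply/negP => /(dvdn_leq m0); rewrite leqNgt mp //.
have p4 : (3 < p)%N by case: p p1 p2 p3 => [|[|[|[|]]]].
have cF : #|F| = p by apply: card_Fp.
have odp : odd #|F| by rewrite cF; case: (even_prime pp) => // E; case/eqP: p2.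
have C := @conic_card F (nz 2 ltac:(by rewrite (ltnW p4))) (nz 3 p4) odp.
rewrite cF in C; rewrite -C -(count_predC nu) mulnDr addnC; apply: f_equal2.
  rewrite (@count_right_divisors_sum _ z1 (fun b => fnorm b == -1) (predC nu)) //.
  - by move=> b; rewrite /qdvd /z1 dvdz1; apply/negP => /andP[h _]; move: h p1; rewrite /=; clear; lia.
  - move=> b; rewrite dF /qnorm /z1 rmorphD /= !enF !simF /= ?lfK -(subr_eq0 (fnorm b)) /fnorm.
    by apply: (f_equal (fun x : F => x == 0)); ring.
  by move=> q nq; rewrite (count_affine_points nq).
rewrite (@count_right_divisors_sum _ z2 (fun t => t ^+ 2 + t + 1 == 0) nu) //.
- by move=> b; rewrite /qdvd /z2 dvdz1; apply/negP => /and4P[_ h _ _]; move: h p1; rewrite /=; clear; lia.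
- move=> b; rewrite dF /qnorm /z2 rmorphD /= !enF !simF /= ?lfK.
  by apply: (f_equal (fun x : F => x == 0)); ring.
exact: count_points_at_infinity.
Qed.
End Prime.

(** * Elements of given norm and divisor sums *)

Lemma sigma_dvd p n : (0 < p)%N -> (0 < n)%N ->
  (\sum_(d <- divisors n | p %| d) d = if p %| n then p * sigma (n %/ p) else 0)%N.
Proof.
move=> p0 n0; case: ifP => [/dvdnP[k Ek]|nd]; last first.
  rewrite big_seq_cond big1 // => d /andP[]; rewrite -dvdn_divisors // => dn pd.
  by rewrite (dvdn_trans pd dn) in nd.
have k0 : (0 < k)%N by move: n0; rewrite Ek muln_gt0 => /andP[].
rewrite Ek mulnK // /sigma big_distrr /= -(big_map (muln p) predT id) -big_filter; apply: perm_big; apply: uniq_perm.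
- by rewrite filter_uniq // divisors_uniq.
- by rewrite map_inj_uniq ?divisors_uniq // => x y /eqP; rewrite eqn_pmul2l // => /eqP.
move=> d; rewrite mem_filter -dvdn_divisors ?muln_gt0 ?k0 //; apply/andP/mapP => [[/dvdnP[e ->]]|[e]].
  by rewrite dvdn_pmul2r // => ek; exists e; rewrite 1?mulnC // -dvdn_divisors.
by rewrite -dvdn_divisors // => ek ->; rewrite dvdn_mulr // mulnC dvdn_pmul2r.
Qed.
(** The Hecke relation at p, obtained by separating the divisors prime to p, which are the same for
    m and pm. *)
Lemma sigma_rec p m : prime p -> (0 < m)%N ->
  (p.+1 * sigma m = sigma (p * m) + p * (if p %| m then sigma (m %/ p) else 0))%N.
Proof.
move=> pp m0; have p0 := prime_gt0 pp.
have S n : (0 < n)%N -> (sigma n = (if p %| n then p * sigma (n %/ p) else 0) + \sum_(d <- divisors n | ~~ (p %| d)) d)%N.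
  by move=> n0; rewrite -sigma_dvd // /sigma (bigID (fun d => p %| d)%N).
have E : (\sum_(d <- divisors (p * m) | ~~ (p %| d)) d = \sum_(d <- divisors m | ~~ (p %| d)) d)%N.
  rewrite -big_filter -[RHS]big_filter; apply: perm_big; apply: uniq_perm; rewrite ?filter_uniq ?divisors_uniq //.
  move=> d; rewrite !mem_filter -!dvdn_divisors ?muln_gt0 ?p0 //; case: (boolP (p %| d)%N) => //= nd.
  by rewrite Gauss_dvdr // coprime_sym prime_coprime.
have := S m m0; have := S (p * m)%N; rewrite muln_gt0 p0 m0 E dvdn_mulr // mulKn // => /(_ isT).
by rewrite mulSn; case: (p %| m)%N; lia.
Qed.

Lemma prime_coprime6 p n : prime p -> (p %| n)%N -> coprime n 6 -> p != 2 /\ p != 3.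
Proof.
by move=> pp dv; rewrite (_ : 6 = 2 * 3)%N // coprimeMr => /andP[c2 c3]; split; apply: contraTneq dv => ->; rewrite -prime_coprime // coprime_sym.
Qed.
(** Removing one prime factor p, [double_count] with the constant function 1 gives for the numbers
    of elements the same recursion as [sigma_rec] gives for sigma. *)
Lemma size_quats_of_norm n : (0 < n)%N -> coprime n 6 -> size (quats_of_norm n) = (12 * sigma n)%N.
Proof.
have [k] := ubnP n; elim: k n => // k IH n lt n0 c.
have [->|n1] := eqVneq n 1%N; first by rewrite size_quats1 /sigma (_ : divisors 1 = [:: 1%N]) // big_seq1.
have pp : prime (pdiv n) by apply: pdiv_prime; case: n n0 n1 {lt c} => [|[]].
have [m En] := dvdnP (pdiv_dvd n); move: (pdiv n) pp En => p pp En; rewrite mulnC in En.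
have p1 := prime_gt1 pp; have p0 := ltnW p1.
have m0 : (0 < m)%N by move: n0; rewrite En muln_gt0 => /andP[].
have [p2 p3] := prime_coprime6 pp (ltac:(by rewrite En dvdn_mulr) : (p %| n)%N) c.
have cm : coprime m 6 by move: c; rewrite En coprimeMl => /andP[].
have lm : (m < n)%N by rewrite En ltn_Pmull.
have c1 (T : Type) (s : seq T) : (\sum_(x <- s) 1 = size s)%N by rewrite sum1_size.
have SR := sigma_rec pp m0; rewrite -En in SR.
have := double_count pp m (fun=> 1%N); rewrite sum_dvd // -En.
rewrite (eq_bigr (fun=> size (quats_of_norm m))) => [|q _]; last exact: c1.
rewrite big_const_seq count_predT iter_addn_0 c1 (IH m) //; last by apply: leq_trans lm lt.
rewrite size_quats_of_prime // => S.
have Sz : (size (quats_of_norm n) = \sum_(z <- quats_of_norm n | ~~ qdvd p%:Z z) 1 + (if p %| m then size (quats_of_norm (m %/ p)) else 0))%N.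
  have := sum_dvd pp m (fun=> 1%N); rewrite -En c1 => <-.
  by rewrite addnC -(c1 _ (quats_of_norm n)) [LHS](bigID (qdvd p%:Z)).
rewrite Sz; move: S SR; case: ifP => [pm|_]; last by move: (sigma n) (sigma m) (\sum_(z <- _ | _) _)%N; clear; nia.
have m10 : (0 < m %/ p)%N by rewrite divn_gt0 // dvdn_leq.
rewrite (IH (m %/ p)%N) //; last 2 first.
- by apply: leq_ltn_trans (leq_div m p) _; apply: leq_trans lm lt.
- by apply: coprime_dvdl cm; rewrite dvdn_div.
by move: (sigma n) (sigma m) (sigma _) (\sum_(z <- _ | _) _)%N; clear; nia.
Qed.

(** * Parity and residues modulo sqrt(-3) *)

Definition ev (x y : int) : bool := (2 %| x)%Z && (2 %| y)%Z.
Definition evv (z : mat) : bool := let: (a, b, c, d) := z in ev c d.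
(** The first coordinate a + b w is divisible by sqrt(-3) = 2 w - 1, modulo which w is -1. *)
Definition d3 (z : mat) : bool := let: (a, b, c, d) := z in (3 %| a - b)%Z.
(* Multiplying on the right by conj q instead of q, with both norms 2 mod 3, keeps the
   parity type of the element but exchanges the two coordinates modulo sqrt(-3). *)
Definition balance_sign (z : mat) : bool := evv z == d3 z.
Definition oddz (x : int) : bool := ~~ (2 %| x)%Z.
Lemma ozD x y : oddz (x + y) = oddz x (+) oddz y. Proof. by rewrite /oddz; lia. Qed.
Lemma ozN x : oddz (- x) = oddz x. Proof. by rewrite /oddz; lia. Qed.
Lemma ozM x y : oddz (x * y) = oddz x && oddz y.
Proof. by rewrite /oddz !dvdzE abszM Euclid_dvdM // negb_or. Qed.
Lemma evE x y : ev x y = ~~ oddz x && ~~ oddz y. Proof. by rewrite /ev /oddz !negbK. Qed.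
(** 2 is inert in Z[w], so x^2 + xy + y^2 is even only if x and y are. An element of odd norm
    therefore has exactly one even coordinate. *)
Lemma odd_qnorm z : let: (a, b, c, d) := z in oddz (qnorm z) = ~~ ev a b (+) ~~ ev c d.
Proof.
case: z => [[[a b] c] d]; rewrite /qnorm /enorm !expr2 !ozD !ozM !evE.
by case: (oddz a); case: (oddz b); case: (oddz c); case: (oddz d).
Qed.
Lemma evv_mul w q : oddz (qnorm w) -> oddz (qnorm q) -> evv (qmul w q) = (evv w == evv q).
Proof.
case: w => [[[a b] c] d]; case: q => [[[a' b'] c'] d'].
rewrite (odd_qnorm (a, b, c, d)) (odd_qnorm (a', b', c', d')) /evv /qmul !evE !ozD !ozN !ozM !ozD.
by case: (oddz a); case: (oddz b); case: (oddz c); case: (oddz d); case: (oddz a'); case: (oddz b'); case: (oddz c'); case: (oddz d').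
Qed.
Lemma evv_conj q : evv (qconj q) = evv q.
Proof. by case: q => [[[a b] c] d]; rewrite /evv /qconj !evE !ozN. Qed.
Lemma en_mod3 x y : enorm x y = (x - y) ^+ 2 + 3 * (x * y).
Proof. by rewrite /enorm; ring. Qed.
(** Modulo sqrt(-3) write the elements as A + C j and A' + C' j; norm 2 means that all four are 1 or
    -1. The first coordinates of the two products are AA' - CC' and AA' + CC', and exactly one of
    them vanishes modulo 3. *)
Lemma d3_mul w q : (qnorm w %% 3 = 2)%Z -> (qnorm q %% 3 = 2)%Z -> d3 (qmul w q) = ~~ d3 (qmul w (qconj q)).
Proof.
case: w => [[[a b] c] d]; case: q => [[[a' b'] c'] d']; rewrite /qnorm !en_mod3 => Nw Nq.
rewrite /d3 /qmul /qconj.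
rewrite (_ : _ - (a * b' + _ + _ + _ - _) = (a - b) * (a' - b') - (c - d) * (c' - d') - 3 * (b * b' + c * d')); last by ring.
rewrite (_ : _ - (a * - b' + _ + _ + _ - _) = (a - b) * (a' - b') + (c - d) * (c' - d') + 3 * (a * b' + c * d')); last by ring.
move: Nw Nq; move: (a - b) (c - d) (a' - b') (c' - d') => A C A' C'.
have S (x y k l : int) : ((x ^+ 2 + 3 * k + (y ^+ 2 + 3 * l)) %% 3 = 2)%Z -> exists e f u v, [/\ x = 3 * u + e, y = 3 * v + f, e = 1 \/ e = -1 & f = 1 \/ f = -1].
  have [u [e [Ex He]]] := res3 x; have [v [f [Ey Hf]]] := res3 y => H; exists e, f, u, v.
  suff : (e = 1 \/ e = -1) /\ (f = 1 \/ f = -1) by case.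
  have : ((e ^+ 2 + f ^+ 2) %% 3 = 2)%Z.
    rewrite -[RHS]H Ex Ey (_ : _ + _ + (_ + _) = (e ^+ 2 + f ^+ 2) + 3 * (3 * u ^+ 2 + 2 * u * e + k + 3 * v ^+ 2 + 2 * v * f + l)); last by ring.
    by move: (e ^+ 2 + f ^+ 2) (3 * u ^+ 2 + _ + _ + _ + _ + _); clear; lia.
  have Z (P : Prop) (t : bool) : t -> t = false -> P by move=> ->.
  by case: He Hf => -> [] -> /eqP E; split; auto; apply: Z E _; vm_compute.
move=> /S[e [f [u [v [-> -> He Hf]]]]] /S[e' [f' [u' [v' [-> -> He' Hf']]]]].
rewrite (_ : (3 * u + e) * _ - _ - _ = (e * e' - f * f') + 3 * (3 * u * u' + u * e' + e * u' - (3 * v * v' + v * f' + f * v') - (b * b' + c * d'))); last by ring.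
rewrite (_ : (3 * u + e) * _ + _ + _ = (e * e' + f * f') + 3 * (3 * u * u' + u * e' + e * u' + (3 * v * v' + v * f' + f * v') + (a * b' + c * d'))); last by ring.
have R (x y : int) : (3 %| x + 3 * y)%Z = (3 %| x)%Z by lia.
rewrite !R.
by case: He => ->; case: Hf => ->; case: He' => ->; case: Hf' => ->.
Qed.
Lemma fp_conj w q : oddz (qnorm w) -> oddz (qnorm q) -> (qnorm w %% 3 = 2)%Z -> (qnorm q %% 3 = 2)%Z ->
  balance_sign (qmul w q) = ~~ balance_sign (qmul w (qconj q)).
Proof.
move=> ow oq nw nq; rewrite /balance_sign (d3_mul nw nq) evv_mul // evv_mul ?qn_conj // evv_conj.
by case: (evv w); case: (evv q); case: (d3 _).
Qed.
Lemma fp_z (p : nat) z : odd p -> ~~ (3 %| p)%N -> balance_sign (qz p%:Z z) = balance_sign z.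
Proof.
move=> op p3; case: z => [[[a b] c] d]; rewrite /balance_sign /evv /d3 /qz /ev.
have E2 x : (2 %| p%:Z * x)%Z = (2 %| x)%Z by rewrite !dvdzE abszM Euclid_dvdM //= dvdn2 op.
have E3 x : (3 %| p%:Z * x)%Z = (3 %| x)%Z by rewrite !dvdzE abszM Euclid_dvdM //= (negbTE p3).
by rewrite -mulrBr !E2 E3.
Qed.
Lemma fp_balance p n : prime p -> (p %% 3 = 2)%N -> p != 2 -> (0 < n)%N -> odd n -> (n %% 3 = 1)%N -> odd (logn p n) ->
  (\sum_(z <- quats_of_norm n) balance_sign z = \sum_(z <- quats_of_norm n) ~~ balance_sign z)%N.
Proof.
move=> pp p32 p2; have p0 := prime_gt0 pp.
have op : odd p by case: (even_prime pp) => // E; rewrite E in p2.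
have p3 : ~~ (3 %| p)%N by rewrite /dvdn p32.
have [k] := ubnP n; elim: k n => // k IH n lt n0 on n3 ol.
have pn : (p %| n)%N.
  have : (0 < logn p n)%N by move: ol; case: (logn p n).
  by rewrite logn_gt0 mem_primes => /and3P[].
have [m En] := dvdnP pn; rewrite mulnC in En.
have m0 : (0 < m)%N by move: n0; rewrite En muln_gt0 => /andP[].
have om : odd m by move: on; rewrite En oddM => /andP[].
have m3 : (m %% 3 = 2)%N.
  move: n3; rewrite En -modnMm p32; have : (m %% 3 < 3)%N by rewrite ltn_pmod.
  by case: (m %% 3)%N => [|[|[]]].
have D : (\sum_(q <- quats_of_norm p) \sum_(w <- quats_of_norm m) balance_sign (qmul w q) = \sum_(q <- quats_of_norm p) \sum_(w <- quats_of_norm m) ~~ balance_sign (qmul w q))%N.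
  rewrite [LHS](eq_big_seq (fun q => \sum_(w <- quats_of_norm m) ~~ balance_sign (qmul w (qconj q)))%N).
    rewrite -(big_map qconj predT (fun q => \sum_(w <- quats_of_norm m) ~~ balance_sign (qmul w q))%N).
    apply: perm_big; apply: uniq_perm; rewrite ?uniq_quats // ?map_inj_uniq ?uniq_quats //; first exact: can_inj qconjK.
    move=> q; rewrite mem_quats; apply/mapP/idP => [[q' + ->]|nq]; first by rewrite mem_quats qn_conj.
    by exists (qconj q); rewrite ?qconjK // mem_quats qn_conj.
  move=> q; rewrite mem_quats => /eqP nq; apply: eq_big_seq => w; rewrite mem_quats => /eqP nw.
  by rewrite fp_conj // ?nq ?nw /oddz; move: om op m3 p32; clear; lia.
have D1 := double_count pp m (fun z => balance_sign z : nat); have D2 := double_count pp m (fun z => ~~ balance_sign z : nat).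
have E1 := sum_dvd pp m (fun z => balance_sign z : nat); have E2 := sum_dvd pp m (fun z => ~~ balance_sign z : nat).
rewrite /= -En in D1 D2 E1 E2.
rewrite [LHS](bigID (qdvd p%:Z)) [RHS](bigID (qdvd p%:Z)) /= E1 E2.
rewrite D1 D2 E1 E2 in D; clear D1 D2 E1 E2.
move: D; case: ifP => [pm|_]; last by move: (\sum_(z <- _ | _) _)%N (\sum_(z <- _ | _) _)%N; clear; lia.
(* The multiples of p come from elements of norm n / p^2, in which p still has odd exponent, so they
   are balanced by induction. The other elements all occur 12 times in [D] and are balanced as
   well. *)
have Z : (\sum_(z <- quats_of_norm (m %/ p)) balance_sign (qz p%:Z z) = \sum_(z <- quats_of_norm (m %/ p)) ~~ balance_sign (qz p%:Z z))%N.
  under eq_bigr do rewrite fp_z //; under [RHS]eq_bigr do rewrite fp_z //.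
  have [l El] := dvdnP pm; rewrite El mulnK //.
  have l0 : (0 < l)%N by move: m0; rewrite El muln_gt0 => /andP[].
  apply: IH => //.
  - have ln : (l < n)%N.
      by rewrite En El mulnCA ltn_Pmulr // (leq_trans (prime_gt1 pp) (leq_pmulr p p0)).
    exact: leq_trans ln lt.
  - by move: om; rewrite El oddM => /andP[].
  - move: m3; rewrite El -modnMm p32; have : (l %% 3 < 3)%N by rewrite ltn_pmod.
    by case: (l %% 3)%N => [|[|[]]].
  by move: ol; rewrite En El !lognM ?muln_gt0 ?l0 ?p0 // logn_prime // eqxx add1n addn1 /= negbK.
by rewrite Z; move: (\sum_(z <- _ | _) _)%N (\sum_(z <- _ | _) _)%N; clear; lia.
Qed.

From mathcomp Require Import classical_sets fsbigop.
Import Order.TTheory GRing.Theory Num.Theory.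

(** * Selling reduction and Hurwitz class numbers *)

Definition trip := (int * int * int)%type.
(* 2 f(u, v) = x u^2 + y v^2 + z (u - v)^2. *)
Definition selling_form (t : trip) : bqf := let: (x, y, z) := t in (((x + z) %/ 2)%Z, - z, ((y + z) %/ 2)%Z).
Definition selling_reduced (t : trip) := par3 t && (0 < p3 t)%N.

Lemma bqf_equiv_refl f : bqf_equiv f f.
Proof. by case: f => [[a b] c]; exists 1, 0, 0, 1; split => //; rewrite /bqf_act /bqf_a /bqf_b /bqf_c /=; congr (_, _, _); ring. Qed.
Lemma bqf_equiv_trans f g h : bqf_equiv f g -> bqf_equiv g h -> bqf_equiv f h.
Proof.
case: f => [[a b] c] [p [q [r [s [D ->]]]]] [p' [q' [r' [s' [D' ->]]]]].
exists (p * p' + q * r'), (p * q' + q * s'), (r * p' + s * r'), (r * q' + s * s'); split.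
  by transitivity ((p * s - q * r) * (p' * s' - q' * r')); [ring|rewrite D D' mulr1].
by rewrite /bqf_act /bqf_a /bqf_b /bqf_c /=; congr (_, _, _); ring.
Qed.
Lemma bqf_equiv_sym f g : bqf_equiv f g -> bqf_equiv g f.
Proof.
case: f => [[a b] c] [p [q [r [s [D ->]]]]]; exists s, (- q), (- r), p; split; first by rewrite -D; ring.
rewrite /bqf_act /bqf_a /bqf_b /bqf_c /=; congr (_, _, _).
- by transitivity (a * (p * s - q * r) ^+ 2); [rewrite D expr1n mulr1|ring].
- by transitivity (b * (p * s - q * r) ^+ 2); [rewrite D expr1n mulr1|ring].
by transitivity (c * (p * s - q * r) ^+ 2); [rewrite D expr1n mulr1|ring].
Qed.
Lemma bqf_class_eq f g : bqf_class f = bqf_class g <-> bqf_equiv f g.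
Proof.
split=> [E|E]; first by suff : bqf_class f g by []; rewrite E; apply: bqf_equiv_refl.
apply/seteqP; split=> h /= H; apply: bqf_equiv_trans H => //; exact: bqf_equiv_sym.
Qed.
Lemma disc_act f p q r s : p * s - q * r = 1 -> bqf_disc (bqf_act f p q r s) = bqf_disc f.
Proof.
case: f => [[a b] c] D; rewrite /bqf_disc /bqf_act /bqf_a /bqf_b /bqf_c /=.
by transitivity ((b ^+ 2 - 4 * a * c) * (p * s - q * r) ^+ 2); [ring|rewrite D expr1n mulr1].
Qed.
Lemma act_gt0 f p q r s : p * s - q * r = 1 -> bqf_posdef f -> 0 < bqf_a (bqf_act f p q r s).
Proof.
case: f => [[a b] c] D [/= a0]; rewrite /bqf_disc /bqf_a /bqf_b /bqf_c /= => d0.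
rewrite /bqf_act /bqf_a /bqf_b /bqf_c /=; have a4 : 0 < 4 * a by rewrite mulr_gt0.
rewrite -(pmulr_rgt0 _ a4).
rewrite (_ : 4 * a * (a * p ^+ 2 + b * p * r + c * r ^+ 2) = (2 * a * p + b * r) ^+ 2 + (4 * a * c - b ^+ 2) * r ^+ 2); last by ring.
have [r0|r0] := eqVneq r 0.
  rewrite r0 expr0n /= !mulr0 !addr0 exprn_even_gt0 //= !mulf_eq0 (gt_eqF a0) /=.
  by apply/eqP => p0; move: D; rewrite p0 r0 mul0r mulr0 subrr.
by rewrite ltr_wpDl ?sqr_ge0 // mulr_gt0 ?exprn_even_gt0 //; move: d0; clear; lia.
Qed.
Lemma posdef_equiv f g : bqf_equiv f g -> bqf_posdef f -> bqf_posdef g /\ bqf_disc g = bqf_disc f.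
Proof.
case=> p [q [r [s [D ->]]]] H; rewrite disc_act //; split => //; split; first exact: act_gt0.
by rewrite disc_act //; case: H.
Qed.

Lemma sel2 t : par3 t -> let: (x, y, z) := t in let: (a, b, c) := selling_form t in [/\ 2 * a = x + z, b = - z & 2 * c = y + z].
Proof. by case: t => [[x y] z] /=; split; lia. Qed.
Lemma sel_posdef t : selling_reduced t -> 0 < esym2 t -> bqf_posdef (selling_form t) /\ bqf_disc (selling_form t) = - esym2 t.
Proof.
move=> /andP[p g] e0; have := sel2 p; case: t p g e0 => [[x y] z] p g e0.
case: (selling_form (x, y, z)) => [[a b] c] [Ea Eb Ec]; rewrite /bqf_posdef /bqf_disc /bqf_a /bqf_b /bqf_c /=.
have E : b ^+ 2 - 4 * a * c = - (x * y + y * z + z * x).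
  rewrite (_ : b ^+ 2 - 4 * a * c = b ^+ 2 - (2 * a) * (2 * c)); last by ring.
  by rewrite Ea Eb Ec; ring.
rewrite E oppr_lt0; split => //; split => //.
by move: g Ea; rewrite /p3 /selling_weight3 /full3 /half3; clear; lia.
Qed.

(** Make b <= 0. If then 2a + b or 2c + b is negative, replacing c respectively a by a + b + c
    lowers a + c; if neither is, (2a + b, 2c + b, -b) is the reduced triple. *)
Lemma selling_reduction a b c : bqf_posdef (a, b, c) -> exists2 t, selling_reduced t & bqf_equiv (a, b, c) (selling_form t).
Proof.
have [m] := ubnP `|(a + c)%R|%N; elim: m a b c => // m IH a b c lt P.
have pos u v w : bqf_posdef (u, v, w) -> 0 < u /\ 0 < w.
  case; rewrite /bqf_disc /bqf_a /bqf_b /bqf_c /=; move=> u0 d; split => //; have u4 : 0 < 4 * u by rewrite mulr_gt0.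
  rewrite -(pmulr_rgt0 _ u4).
  by have := sqr_ge0 v; move: d; clear; lia.
have step u v w : bqf_equiv (a, b, c) (u, v, w) -> u + w < a + c -> exists2 t, selling_reduced t & bqf_equiv (a, b, c) (selling_form t).
  move=> e l; have [Q _] := posdef_equiv e P; have [p1 p2] := pos _ _ _ P; have [q1 q2] := pos _ _ _ Q.
  by have [|t gt et] := IH u v w _ Q; [move: lt l p1 p2 q1 q2; clear; lia|exists t => //; apply: bqf_equiv_trans e et].
have neg u v w : bqf_equiv (a, b, c) (u, v, w) -> u + w = a + c -> v <= 0 -> exists2 t, selling_reduced t & bqf_equiv (a, b, c) (selling_form t).
  move=> e s v0; have [Q _] := posdef_equiv e P; have [p1 p2] := pos _ _ _ P; have [q1 q2] := pos _ _ _ Q.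
  have [h1|h1] := ltrP (2 * u + v) 0.
    apply: (step u (v + 2 * u) (u + v + w)); last by lia.
    apply: bqf_equiv_trans e _; exists 1, 1, 0, 1; split => //; rewrite /bqf_act /bqf_a /bqf_b /bqf_c /=; congr (_, _, _); ring.
  have [h2|h2] := ltrP (2 * w + v) 0.
    apply: (step (u + v + w) (v + 2 * w) w); last by lia.
    apply: bqf_equiv_trans e _; exists 1, 0, 1, 1; split => //; rewrite /bqf_act /bqf_a /bqf_b /bqf_c /=; congr (_, _, _); ring.
  have E : selling_form (2 * u + v, 2 * w + v, - v) = (u, v, w).
    by rewrite /selling_form; congr (_, _, _); [clear; lia|exact: opprK|clear; lia].
  exists (2 * u + v, 2 * w + v, - v); last by rewrite E.
  apply/andP; split; first by rewrite /par3; clear; lia.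
  rewrite /p3 /selling_weight3 /full3 /half3.
  have [[e1 esym2]|] : (2 * u + v = 0 /\ 2 * w + v = 0) \/ ~ (2 * u + v = 0 /\ 2 * w + v = 0) by lia.
    have Ev : v = - 2 * u by move: e1; clear; lia. have Ew : w = u by move: e1 esym2; clear; lia.
    by case: Q; rewrite Ev Ew /bqf_disc /bqf_a /bqf_b /bqf_c /= => _; rewrite (_ : _ - _ = 0) ?ltxx //; ring.
  by lia.
have [b0|b0] := lerP b 0; first by apply: (neg a b c) => //; apply: bqf_equiv_refl.
apply: (neg c (- b) a); [|lia|lia].
by exists 0, (-1), 1, 0; split => //; rewrite /bqf_act /bqf_a /bqf_b /bqf_c /=; congr (_, _, _); ring.
Qed.

(** * Uniqueness of reduced triples *)

(** Twice p^2 + pq + q^2: the minimum on nonzero vectors is 2, attained at six vectors. *)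
Definition Q2 (p q : int) := p ^+ 2 + q ^+ 2 + (p + q) ^+ 2.
Lemma Q2_ge p q : ~ (p = 0 /\ q = 0) -> 2 <= Q2 p q.
Proof.
move=> H; have : 0 < Q2 p q; last by rewrite /Q2; have [k ->] := sq_mod2 p; have [l ->] := sq_mod2 q; have [m ->] := sq_mod2 (p + q); clear; lia.
have [p0|p0] := eqVneq p 0; last by rewrite /Q2 -addrA ltr_pwDl ?addr_ge0 ?sqr_ge0 // exprn_even_gt0.
have q0 : q != 0 by apply/eqP => q0; apply: H; rewrite p0 q0.
by rewrite /Q2 ltr_wpDr ?sqr_ge0 // ltr_wpDl ?sqr_ge0 // exprn_even_gt0.
Qed.
Lemma Q2_eq p q : Q2 p q = 2 -> [\/ p = 1 /\ q = 0, p = -1 /\ q = 0, p = 0 /\ q = 1 | p = 0 /\ q = -1 \/ p = 1 /\ q = -1 \/ p = -1 /\ q = 1].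
Proof.
rewrite /Q2 => E.
have B (u : int) : u ^+ 2 <= 2 -> -1 <= u <= 1.
  clear; rewrite expr2 => H; have [h|h] : 2 <= `|u| \/ -1 <= u <= 1 by lia.
    have := ler_pM (ltac:(by []) : 0 <= 2 :> int) (ltac:(by []) : 0 <= 2 :> int) h h.
    by have := sqr_ge0 u; rewrite expr2 -normrM; move: H; move: (u * u); clear; lia.
  by [].
have [p1 q1 s1] : [/\ -1 <= p <= 1, -1 <= q <= 1 & -1 <= p + q <= 1].
  by have := sqr_ge0 p; have := sqr_ge0 q; have := sqr_ge0 (p + q); split; apply: B; lia.
have nz : ~ (p = 0 /\ q = 0) by case=> p0 q0; move: E; rewrite p0 q0 addr0 expr0n.
have : (p = 1 /\ q = 0) \/ (p = -1 /\ q = 0) \/ (p = 0 /\ q = 1) \/ (p = 0 /\ q = -1 \/ p = 1 /\ q = -1 \/ p = -1 /\ q = 1).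
  by move: p1 q1 s1 nz; clear; lia.
by case=> [|[|[|]]]; [constructor 1|constructor 2|constructor 3|constructor 4].
Qed.

Lemma sel_act t t' p q r s : par3 t -> par3 t' -> selling_form t' = bqf_act (selling_form t) p q r s ->
  let: (x, y, z) := t in let: (x', y', z') := t' in
  [/\ x' + z' = x * p ^+ 2 + y * r ^+ 2 + z * (p - r) ^+ 2, y' + z' = x * q ^+ 2 + y * s ^+ 2 + z * (q - s) ^+ 2 &
      x' + y' = x * (p + q) ^+ 2 + y * (r + s) ^+ 2 + z * (p - r + (q - s)) ^+ 2].
Proof.
move=> P P'; have := sel2 P; have := sel2 P'; case: t {P} => [[x y] z]; case: t' {P'} => [[x' y'] z'].
case: (selling_form _) => [[a' b'] c'] [Ea' Eb' Ec']; case: (selling_form _) => [[a b] c] [Ea Eb Ec].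
rewrite /bqf_act /bqf_a /bqf_b /bqf_c /= => -[Ha Hb Hc].
have Ex : x = 2 * a + b by rewrite Ea Eb addrK. have Ey : y = 2 * c + b by rewrite Ec Eb addrK.
have Ez : z = - b by rewrite Eb opprK.
have H1 : x' + z' = x * p ^+ 2 + y * r ^+ 2 + z * (p - r) ^+ 2 by rewrite -Ea' Ha Ex Ey Ez; ring.
have H2 : y' + z' = x * q ^+ 2 + y * s ^+ 2 + z * (q - s) ^+ 2 by rewrite -Ec' Hc Ex Ey Ez; ring.
split => //; rewrite (_ : x' + y' = (x' + z') + (y' + z') - 2 * z'); last by ring.
have Ez' : z' = - b' by rewrite Eb' opprK.
by rewrite H1 H2 Ez' Hb Ex Ey Ez; ring.
Qed.
Definition tsum (t : trip) : int := t.1.1 + t.1.2 + t.2.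
Lemma nz_rows (p q r s : int) : p * s - q * r = 1 -> [/\ ~ (p = 0 /\ q = 0), ~ (r = 0 /\ s = 0) & ~ (p - r = 0 /\ q - s = 0)].
Proof.
move=> D; split=> -[E1 E2]; move: D.
- by rewrite E1 E2 !mul0r subrr.
- by rewrite E1 E2 !mulr0 subrr.
rewrite (_ : p * s - q * r = (p - r) * s - (q - s) * r); last by ring.
by rewrite E1 E2 !mul0r subrr.
Qed.
Lemma good_ge0 x y z : selling_reduced (x, y, z) -> [/\ 0 <= x, 0 <= y, 0 <= z & [\/ 0 < x /\ 0 < y, 0 < y /\ 0 < z | 0 < z /\ 0 < x]].
Proof.
case/andP=> _; rewrite /p3 /selling_weight3 /full3 /half3 => H.
have [? ? ?] : [/\ 0 <= x, 0 <= y & 0 <= z] by split; lia.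
split=> //; have : (0 < x /\ 0 < y) \/ (0 < y /\ 0 < z) \/ (0 < z /\ 0 < x) by lia.
by case=> [|[|]]; [constructor 1|constructor 2|constructor 3].
Qed.
Lemma tsum_act t t' p q r s : selling_reduced t -> par3 t' -> p * s - q * r = 1 -> selling_form t' = bqf_act (selling_form t) p q r s ->
  let: (x, y, z) := t in 2 * tsum t' = x * Q2 p q + y * Q2 r s + z * Q2 (p - r) (q - s).
Proof.
case: t => [[x y] z]; case: t' => [[x' y'] z'] /andP[P _] P' D E; have [H1 H2 H3] := sel_act P P' E.
transitivity ((x' + z') + (y' + z') + (x' + y')); first by rewrite /tsum /=; ring.
by rewrite H1 H2 H3 /Q2; ring.
Qed.
(** A reduced triple minimizes x + y + z in its class: twice the sum of [t'] is x, y, z weighted by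
    [Q2] of nonzero vectors, hence with factors of at least 2. *)
Lemma tsum_le t t' : selling_reduced t -> par3 t' -> bqf_equiv (selling_form t) (selling_form t') -> tsum t <= tsum t'.
Proof.
move=> g P [p [q [r [s [D E]]]]]; have := tsum_act g P D E; case: t g E => [[x y] z] g E S.
have [x0 y0 z0 _] := good_ge0 g; have [n1 n2 n3] := nz_rows D.
have := ler_wpM2l x0 (Q2_ge n1); have := ler_wpM2l y0 (Q2_ge n2); have := ler_wpM2l z0 (Q2_ge n3).
move: S; rewrite /tsum /=; move: (x * Q2 p q) (y * Q2 r s) (z * Q2 (p - r) (q - s)) => u v w; clear; lia.
Qed.
Definition cyc (t : trip) : seq trip := let: (x, y, z) := t in [:: (x, y, z); (y, z, x); (z, x, y)].
(** Odd permutations come from matrices of determinant -1; they stay in the class when an entry is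
    zero, because then the form has an improper automorphism. *)
Definition anti (t : trip) : seq trip := let: (x, y, z) := t in [:: (y, x, z); (x, z, y); (z, y, x)].
(** Both rows of the change of basis are among the six minimal vectors. The determinant and the
    third row discard most of the 36 pairs; each remaining one permutes the triple. *)
Lemma sel_core (x y z x' y' z' p q r s : int) : Q2 p q = 2 -> Q2 r s = 2 -> p * s - q * r = 1 ->
  z = 0 \/ Q2 (p - r) (q - s) = 2 ->
  x' + z' = x * p ^+ 2 + y * r ^+ 2 + z * (p - r) ^+ 2 -> y' + z' = x * q ^+ 2 + y * s ^+ 2 + z * (q - s) ^+ 2 ->
  x' + y' = x * (p + q) ^+ 2 + y * (r + s) ^+ 2 + z * (p - r + (q - s)) ^+ 2 ->
  [\/ [/\ x' = x, y' = y & z' = z], [/\ x' = y, y' = z & z' = x] | [/\ x' = z, y' = x & z' = y]] \/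
  z = 0 /\ [\/ [/\ x' = y, y' = x & z' = z], [/\ x' = x, y' = z & z' = y] | [/\ x' = z, y' = y & z' = x]].
Proof.
move=> q1 q2 D K H1 H2 H3.
have fin : [|| [&& x' == x, y' == y & z' == z], [&& x' == y, y' == z & z' == x] | [&& x' == z, y' == x & z' == y]]
  || ((z == 0) && [|| [&& x' == y, y' == x & z' == z], [&& x' == x, y' == z & z' == y] | [&& x' == z, y' == y & z' == x]]).
  have E1 : 2 * x' = (x' + z') + (x' + y') - (y' + z') by ring.
  have E2 : 2 * y' = (y' + z') + (x' + y') - (x' + z') by ring.
  have E3 : 2 * z' = (x' + z') + (y' + z') - (x' + y') by ring.
  move: E1 E2 E3; rewrite H1 H2 H3; clear H1 H2 H3.
  have half (u v w : int) : 2 * u = w -> w = 2 * v -> u = v by lia.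
  move: (Q2_eq q1) (Q2_eq q2) D K; rewrite /Q2; clear q1 q2.
  case=> [[-> ->]|[-> ->]|[-> ->]|[[-> ->]|[[-> ->]|[-> ->]]]];
  (case=> [[-> ->]|[-> ->]|[-> ->]|[[-> ->]|[[-> ->]|[-> ->]]]]; 
   (move/eqP=> D; first [by exfalso; vm_compute in D; discriminate D|clear D]);
   (case=> [->|K]; [|first [by exfalso; move/eqP: K => K; vm_compute in K; discriminate K|clear K]]);
   move=> /half E1 /half E2 /half E3;
   first [by rewrite (E1 x) ?(E2 y) ?(E3 z) ?eqxx ?orbT //; ring
         |by rewrite (E1 y) ?(E2 z) ?(E3 x) ?eqxx ?orbT //; ring
         |by rewrite (E1 z) ?(E2 x) ?(E3 y) ?eqxx ?orbT //; ring
         |by rewrite (E1 y) ?(E2 x) ?(E3 0) ?eqxx ?orbT //; ring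
         |by rewrite (E1 x) ?(E2 0) ?(E3 y) ?eqxx ?orbT //; ring
         |by rewrite (E1 0) ?(E2 y) ?(E3 x) ?eqxx ?orbT //; ring
         |by rewrite (E1 x) ?(E2 y) ?(E3 0) ?eqxx ?orbT //; ring
         |by rewrite (E1 y) ?(E2 0) ?(E3 x) ?eqxx ?orbT //; ring
         |by rewrite (E1 0) ?(E2 x) ?(E3 y) ?eqxx ?orbT //; ring]).
case/orP: fin => [|/andP[/eqP z0]].
  by case/or3P => /and3P[/eqP-> /eqP-> /eqP->]; left; [constructor 1|constructor 2|constructor 3].
by case/or3P => /and3P[/eqP-> /eqP-> /eqP->]; right; split=> //; [constructor 1|constructor 2|constructor 3].
Qed.
(** Equivalent reduced triples have the same sum, so [Q2] equals 2 on every row with positive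
    coefficient. Two of the coefficients are positive; a cyclic shift of the rows p, r, p - r brings
    them to the first two places, as [sel_core] wants. *)
Lemma selling_unique t t' : selling_reduced t -> selling_reduced t' -> bqf_equiv (selling_form t) (selling_form t') ->
  t' \in cyc t \/ (let: (x, y, z) := t in [|| x == 0, y == 0 | z == 0]) /\ t' \in anti t.
Proof.
move=> g g' e; have [[P _] [P' _]] := (andP g, andP g').
have le := tsum_le g P' e; have le' := tsum_le g' P (bqf_equiv_sym e).
case: e => p [q [r [s [D E]]]]; have S := tsum_act g P' D E; have A := sel_act P P' E.
have [n1 n2 n3] := nz_rows D.
case: t g {P E} le le' S A => [[x y] z] g; case: t' g' {P'} => [[x' y'] z'] g'; rewrite /tsum /=.
move=> le le' S [H1 H2 H3]; have [x0 y0 z0 pos] := good_ge0 g; clear g g'.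
have K (u m : int) : 0 < u -> u * m <= u * 2 -> m <= 2 by move=> u0; rewrite ler_pM2l.
have L1 := ler_wpM2l x0 (Q2_ge n1); have L2 := ler_wpM2l y0 (Q2_ge n2); have L3 := ler_wpM2l z0 (Q2_ge n3).
have [M1 M2 M3] : [/\ x * Q2 p q <= x * 2, y * Q2 r s <= y * 2 & z * Q2 (p - r) (q - s) <= z * 2].
  move: L1 L2 L3 S le le'; move: (x * Q2 p q) (y * Q2 r s) (z * Q2 (p - r) (q - s)) => u v w; clear; split; lia.
have Kx : 0 < x -> Q2 p q = 2 by move=> h; apply/eqP; rewrite eq_le (Q2_ge n1) andbT; apply: (K x).
have Ky : 0 < y -> Q2 r s = 2 by move=> h; apply/eqP; rewrite eq_le (Q2_ge n2) andbT; apply: (K y).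
have Kz : 0 < z -> Q2 (p - r) (q - s) = 2 by move=> h; apply/eqP; rewrite eq_le (Q2_ge n3) andbT; apply: (K z).
clear M1 M2 M3.
clear L1 L2 L3 K S le le' n1 n2 n3.
have pack (P : bool) (x1 y1 z1 : int) : 
  [\/ [/\ x1 = x, y1 = y & z1 = z], [/\ x1 = y, y1 = z & z1 = x] | [/\ x1 = z, y1 = x & z1 = y]] \/
  P /\ [\/ [/\ x1 = y, y1 = x & z1 = z], [/\ x1 = x, y1 = z & z1 = y] | [/\ x1 = z, y1 = y & z1 = x]] ->
  (x1, y1, z1) \in [:: (x, y, z); (y, z, x); (z, x, y)] \/ P /\ (x1, y1, z1) \in [:: (y, x, z); (x, z, y); (z, y, x)].
  by case=> [H|[-> H]]; [left|right; split=> //]; case: H => -[-> -> ->]; rewrite !inE eqxx ?orbT.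
have Z (u m : int) : 0 <= u -> (0 < u -> m = 2) -> u = 0 \/ m = 2.
  by rewrite le_eqVlt => /orP[/eqP<-|h H]; [left|right; exact: H].
apply: pack; case: pos => -[h1 h2].
- have := sel_core (Kx h1) (Ky h2) D (Z _ _ z0 Kz) H1 H2 H3.
  by case=> [H|[-> H]]; [left|right; rewrite eqxx !orbT].
- have C := @sel_core y z x x' y' z' r s (r - p) (s - q) (Ky h1).
  have {C} := C _ _ _ _ _ _; case.
  + by rewrite -(Kz h2) /Q2; ring.
  + by rewrite -D; ring.
  + by case: (Z _ _ x0 Kx) => [->|<-]; [left|right; congr Q2; ring].
  + by rewrite H1; ring.
  + by rewrite H2; ring.
  + by rewrite H3; ring.
  + by case=> H; left; [constructor 2|constructor 3|constructor 1].
  by case=> -> H; right; rewrite eqxx; split => //; case: H => H; [constructor 3|constructor 1|constructor 2].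
have C := @sel_core z x y x' y' z' (p - r) (q - s) p q (Kz h1) (Kx h2).
have {C} := C _ _ _ _ _; case.
- by rewrite -D; ring.
- by case: (Z _ _ y0 Ky) => [->|<-]; [left|right; rewrite /Q2; ring].
- by rewrite H1; ring.
- by rewrite H2; ring.
- by rewrite H3; ring.
- by case=> H; left; [constructor 3|constructor 1|constructor 2].
by case=> -> H; right; rewrite eqxx orbT; split => //; case: H => H; [constructor 2|constructor 3|constructor 1].
Qed.

Lemma sel_cyc x y z : par3 (x, y, z) -> bqf_equiv (selling_form (x, y, z)) (selling_form (y, z, x)).
Proof.
move=> P; have P' : par3 (y, z, x) by move: P; rewrite /par3; clear; lia.
have [Ea _ Ec] := sel2 P; have [Ea' _ Ec'] := sel2 P'.
exists 1, (-1), 1, 0; split => //; rewrite /selling_form /bqf_act /bqf_a /bqf_b /bqf_c /=; move: Ea Ec Ea' Ec'.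
move: ((x + z) %/ 2)%Z ((y + z) %/ 2)%Z ((y + x) %/ 2)%Z ((z + x) %/ 2)%Z => a c a' c'; clear => Ea Ec Ea' Ec'.
congr (_, _, _); [transitivity (a - z + c)|transitivity (- 2 * a + z)|transitivity a]; try ring; by lia.
Qed.
Lemma sel_swap x y : par3 (x, y, 0) -> bqf_equiv (selling_form (x, y, 0)) (selling_form (y, x, 0)).
Proof.
by move=> _; exists 0, (-1), 1, 0; split => //; rewrite /selling_form /bqf_act /bqf_a /bqf_b /bqf_c /=; congr (_, _, _); ring.
Qed.
Lemma p3_cyc x y z : p3 (y, z, x) = p3 (x, y, z).
Proof. by rewrite /p3 /selling_weight3 /full3 /half3; case: (0 < x); case: (0 < y); case: (0 < z); case: (x == 0); case: (y == 0); case: (z == 0). Qed.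
Lemma p3_swap x y z : p3 (y, x, z) = p3 (x, y, z).
Proof. by rewrite /p3 /selling_weight3 /full3 /half3; case: (0 < x); case: (0 < y); case: (0 < z); case: (x == 0); case: (y == 0); case: (z == 0). Qed.
Lemma good_cyc x y z : selling_reduced (x, y, z) = selling_reduced (y, z, x).
Proof. by rewrite /selling_reduced (p3_cyc x y z); congr (_ && _); rewrite /par3; apply/idP/idP; clear; lia. Qed.
Lemma good_swap x y z : selling_reduced (x, y, z) = selling_reduced (y, x, z).
Proof. by rewrite /selling_reduced (p3_swap x y z); congr (_ && _); rewrite /par3; apply/idP/idP; clear; lia. Qed.

Definition tbox (B : nat) : seq trip := [seq (q, c) | q <- [seq (a, b) | a <- irange B, b <- irange B], c <- irange B].
Lemma mem_tbox B x y z : ((x, y, z) \in tbox B) = [&& `|x| <= B%:Z, `|y| <= B%:Z & `|z| <= B%:Z].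
Proof.
have M (S T : eqType) (s : seq S) (t : seq T) x0 y0 : ((x0, y0) \in [seq (a, b) | a <- s, b <- t]) = (x0 \in s) && (y0 \in t).
  by apply/allpairsP/andP => [[[u v] [/= us vt [-> ->]]]|[xs yt]]; last exists (x0, y0).
by rewrite /tbox !M !mem_irange !andbA.
Qed.
Lemma uniq_tbox B : uniq (tbox B).
Proof.
have U : uniq (irange B) by rewrite map_inj_uniq ?iota_uniq // => i j; lia.
by rewrite /tbox; do 2 (apply: allpairs_uniq => //; last by case=> ? ? [? ?]).
Qed.
Lemma good_box N t : selling_reduced t -> esym2 t = N%:Z -> t \in tbox N.
Proof.
case: t => [[x y] z] /andP[_ F0] E; rewrite mem_tbox.
have [h1 h2 h3] := pw3_bd (F0 : (0 < selling_weight3 x y z)%N) (ltac:(by rewrite -E) : x * y + y * z + z * x <= N%:Z).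
by apply/and3P.
Qed.

(** * Class weights and reduced triples *)

Section Classes.
Variable N : nat.
Hypothesis N0 : (0 < N)%N.
Definition glist : seq trip := [seq t <- tbox N | selling_reduced t && (esym2 t == N%:Z)].
Lemma mem_glist t : (t \in glist) = selling_reduced t && (esym2 t == N%:Z).
Proof.
rewrite mem_filter andb_idr // => /andP[g /eqP E]; exact: good_box.
Qed.
Definition selling_class (t : trip) : set bqf := bqf_class (selling_form t).
Lemma clsP t t' : selling_class t' = selling_class t <-> bqf_equiv (selling_form t) (selling_form t').
Proof. by rewrite bqf_class_eq; split; apply: bqf_equiv_sym. Qed.
Lemma glist_cyc x y z : ((y, z, x) \in glist) = ((x, y, z) \in glist).
Proof. by rewrite !mem_glist -good_cyc (_ : esym2 (y, z, x) = esym2 (x, y, z)) // /esym2; ring. Qed.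
Lemma glist_swap x y z : ((y, x, z) \in glist) = ((x, y, z) \in glist).
Proof. by rewrite !mem_glist -good_swap (_ : esym2 (y, x, z) = esym2 (x, y, z)) // /esym2; ring. Qed.
Lemma glist_good t : t \in glist -> selling_reduced t.
Proof. by rewrite mem_glist => /andP[]. Qed.
Lemma cls_cyc x y z : (x, y, z) \in glist -> selling_class (y, z, x) = selling_class (x, y, z).
Proof. by move/glist_good/andP => [P _]; apply/clsP; apply: sel_cyc. Qed.
Lemma cls_swap x y : (x, y, 0) \in glist -> selling_class (y, x, 0) = selling_class (x, y, 0).
Proof. by move/glist_good/andP => [P _]; apply/clsP; apply: sel_swap. Qed.
Lemma cls_unique t t' : t \in glist -> t' \in glist -> selling_class t' = selling_class t ->
  t' \in cyc t \/ (let: (x, y, z) := t in [|| x == 0, y == 0 | z == 0]) /\ t' \in anti t.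
Proof. by move=> /glist_good g /glist_good g' /clsP; apply: selling_unique. Qed.

End Classes.

Section Classes.
Variable N : nat.
Hypothesis N0 : (0 < N)%N.
Let L := glist N.

Lemma glist_posdef t : t \in L -> bqf_posdef (selling_form t) /\ bqf_disc (selling_form t) = - N%:Z.
Proof.
rewrite mem_glist => /andP[g /eqP E].
by have [] := sel_posdef g (ltac:(by rewrite E; move: N0; clear; lia) : 0 < esym2 t); rewrite E.
Qed.
Lemma cls_sel t f : t \in L -> selling_class t f -> bqf_posdef f /\ bqf_disc f = - N%:Z.
Proof. by move=> /glist_posdef[P D] e; have [Q ->] := posdef_equiv e P. Qed.
Lemma cls_mem t t' : t \in L -> selling_reduced t' -> bqf_equiv (selling_form t) (selling_form t') -> t' \in cyc t ++ anti t.
Proof.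
move=> tL g e; have [P D] := cls_sel tL e.
rewrite mem_cat; have [->//|[_ ->]] := selling_unique (glist_good tL) g e.
by rewrite orbT.
Qed.
Lemma good_two k : 0 < k -> selling_reduced (2 * k, 2 * k, 0).
Proof. by move=> k0; rewrite /selling_reduced /par3 /p3 /selling_weight3 /full3 /half3; lia. Qed.
Lemma good_three k : 0 < k -> selling_reduced (k, k, k).
Proof. by move=> k0; rewrite /selling_reduced /par3 /p3 /selling_weight3 /full3 /half3; lia. Qed.
Lemma class_weight_half t : t \in L -> (exists k, selling_class t (k, 0, k)) -> exists k, (2 * k, 2 * k, 0) \in cyc t ++ anti t.
Proof.
move=> tL [k e]; have [[k0 _] _] := cls_sel tL e; rewrite /bqf_a /= in k0; exists k; apply: cls_mem => //.
  exact: good_two.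
by rewrite (_ : selling_form (2 * k, 2 * k, 0) = (k, 0, k)) // /selling_form oppr0 addr0 mulrC mulzK.
Qed.
Lemma equiv_three (k : int) : bqf_equiv (k, k, k) (k, - k, k).
Proof.
by exists 1, (-1), 0, 1; split => //; rewrite /bqf_act /bqf_a /bqf_b /bqf_c /=; congr (_, _, _); ring.
Qed.
Lemma sel_three (k : int) : selling_form (k, k, k) = (k, - k, k).
Proof. by rewrite /selling_form; congr (_, _, _); lia. Qed.
Lemma class_weight_third t : t \in L -> (exists k, selling_class t (k, k, k)) -> exists k, (k, k, k) \in cyc t ++ anti t.
Proof.
move=> tL [k e]; have [[k0 _] _] := cls_sel tL e; rewrite /bqf_a /= in k0; exists k; apply: cls_mem => //.
  exact: good_three.
by rewrite sel_three; exact: (@bqf_equiv_trans _ (k, k, k) _ e (equiv_three k)).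
Qed.

Lemma sum_list t0 (E : seq trip) : uniq E -> (forall t, t \in E -> t \in L /\ selling_class t = selling_class t0) ->
  (forall t, t \in L -> selling_class t = selling_class t0 -> t \in E) ->
  (\sum_(t <- L | selling_class t == selling_class t0) p3 t = \sum_(t <- E) p3 t)%N.
Proof.
move=> uE A B; rewrite -big_filter; apply: perm_big; apply: uniq_perm => //.
  by rewrite !filter_uniq // uniq_tbox.
move=> t; rewrite mem_filter; apply/andP/idP => [[/eqP e tL]|/A[tL e]]; first exact: B.
by split => //; apply/eqP.
Qed.
(** A class with a triple (x, y, 0) has six triples of weight 1, or three if x = y, the multiples of
    x^2 + y^2. A class of positive triples has three of weight 2, or a single one if x = y = z, the
    multiples of x^2 + xy + y^2. *)
Definition class_sum_eq (t0 : trip) : Prop := (\sum_(t <- L | selling_class t == selling_class t0) p3 t)%:R = 6 * class_weight (selling_class t0) :> rat.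

Lemma class_sum_eq_zero x y : (x, y, 0) \in L -> class_sum_eq (x, y, 0).
Proof.
move=> tL; have [x0 y0 _ _] := good_ge0 (glist_good tL).
have [xp yp] : 0 < x /\ 0 < y.
  by have [_ _ _] := good_ge0 (glist_good tL); case=> -[h1 h2]; move: h1 h2; clear; lia.
have px : (2 %| x)%Z by have /glist_good/andP[+ _] := tL; rewrite /par3; clear; lia.
have c1 : (y, 0, x) \in L by rewrite glist_cyc.
have c2 : (0, x, y) \in L by rewrite glist_cyc.
have e1 : selling_class (y, 0, x) = selling_class (x, y, 0) by apply: cls_cyc tL.
have esym2 : selling_class (0, x, y) = selling_class (x, y, 0) by rewrite (cls_cyc c1).
have a0 : (y, x, 0) \in L by rewrite glist_swap.
have a1 : (x, 0, y) \in L by rewrite glist_cyc.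
have a2 : (0, y, x) \in L by rewrite glist_cyc.
have d0 : selling_class (y, x, 0) = selling_class (x, y, 0) by apply: cls_swap tL.
have d1 : selling_class (x, 0, y) = selling_class (x, y, 0) by rewrite (cls_cyc a0).
have d2 : selling_class (0, y, x) = selling_class (x, y, 0) by rewrite (cls_cyc a1).
have v u w : 0 < u -> 0 < w -> [/\ p3 (u, w, 0) = 1%N, p3 (w, 0, u) = 1%N & p3 (0, u, w) = 1%N].
  move=> hu hw; have E : p3 (u, w, 0) = 1%N by rewrite /p3 /selling_weight3 /full3 /half3 hu hw ltxx eqxx !andbF !orbT.
  by split; [exact: E|rewrite (p3_cyc u w 0)|rewrite (p3_cyc w 0 u) (p3_cyc u w 0)].
have U t : t \in L -> selling_class t = selling_class (x, y, 0) -> t \in cyc (x, y, 0) ++ anti (x, y, 0).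
  by move=> tL' e; have := cls_unique tL tL' e; rewrite mem_cat => -[->|[_ ->]]; rewrite ?orbT.
have [E|ne] := eqVneq x y.
  rewrite /class_sum_eq (@sum_list _ [:: (x, x, 0); (x, 0, x); (0, x, x)]).
  - rewrite !big_cons big_nil; have [-> -> ->] := v x x xp xp; rewrite /class_weight asboolT //.
    exists (x %/ 2)%Z; have -> : ((x %/ 2)%Z, 0, (x %/ 2)%Z) = selling_form (x, y, 0) by rewrite /selling_form E oppr0 addr0.
    exact: bqf_equiv_refl.
  - by rewrite /= !inE !xpair_eqE eqxx (gt_eqF xp) (lt_eqF xp).
  - by move=> t; rewrite !inE => /or3P[] /eqP->; rewrite -?E in tL c1 c2 e1 esym2 *.
  by move=> t tL' /(U _ tL'); rewrite -E /= !inE; do ![case/orP]; move=> ->; rewrite ?orbT.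
rewrite /class_sum_eq (@sum_list _ (cyc (x, y, 0) ++ anti (x, y, 0))) //.
- rewrite /= !big_cons big_nil; have [-> -> ->] := v x y xp yp; have [-> -> ->] := v y x yp xp.
  rewrite /class_weight asboolF; last first.
    by case/(class_weight_half tL) => k; rewrite /= !inE !xpair_eqE; move: xp yp ne; clear; lia.
  rewrite asboolF //; case/(class_weight_third tL) => k; rewrite /= !inE !xpair_eqE; move: xp yp ne; clear; lia.
- rewrite /= !inE !xpair_eqE !(gt_eqF xp) !(lt_eqF xp) !(gt_eqF yp) !(lt_eqF yp) (negbTE ne) eq_sym (negbTE ne).
  by rewrite ?andbF ?orbF.
by move=> t; rewrite /= !inE; do ![case/orP]; move=> /eqP->.
Qed.
Lemma class_sum_eq_cyc x y z : (x, y, z) \in L -> class_sum_eq (y, z, x) -> class_sum_eq (x, y, z).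
Proof. by move=> tL; rewrite /class_sum_eq (cls_cyc tL). Qed.
Lemma class_sum_eqP t : t \in L -> class_sum_eq t.
Proof.
case: t => [[x y] z] tL.
have [z0|z0] := eqVneq z 0; first by rewrite z0 in tL *; apply: class_sum_eq_zero.
have c1 : (y, z, x) \in L by rewrite glist_cyc.
have c2 : (z, x, y) \in L by rewrite glist_cyc.
have [x0|x0] := eqVneq x 0.
  by apply: class_sum_eq_cyc => //; rewrite x0 in c1 *; apply: class_sum_eq_zero.
have [y0|y0] := eqVneq y 0.
  by apply: class_sum_eq_cyc => //; apply: class_sum_eq_cyc => //; rewrite y0 in c2 *; apply: class_sum_eq_zero.
have [xp yp zp] : [/\ 0 < x, 0 < y & 0 < z].
  by have [? ? ? _] := good_ge0 (glist_good tL); rewrite !lt0r x0 y0 z0.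
have v u v w : 0 < u -> 0 < v -> 0 < w -> p3 (u, v, w) = 2%N.
  by move=> hu hv hw; rewrite /p3 /selling_weight3 /full3 /half3 hu hv hw !gt_eqF.
have U t : t \in L -> selling_class t = selling_class (x, y, z) -> t \in cyc (x, y, z).
  move=> tL' e; have := cls_unique tL tL' e.
  by rewrite (negbTE x0) (negbTE y0) (negbTE z0) => -[|[]].
have n1 : ~ (exists k, selling_class (x, y, z) (k, 0, k)).
  by case/(class_weight_half tL) => k; rewrite /= !inE !xpair_eqE; move: xp yp zp; clear; lia.
have [/andP[/eqP Ey /eqP Ez]|ne] := boolP ((y == x) && (z == x)).
  rewrite Ey Ez in tL U n1 *; rewrite /class_sum_eq (@sum_list _ [:: (x, x, x)]) //.
  - rewrite big_cons big_nil v // /class_weight asboolF // asboolT //.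
    exists x; apply: bqf_equiv_sym; rewrite sel_three; exact: equiv_three.
  - by move=> t; rewrite inE => /eqP->.
  by move=> t tL' /(U _ tL'); rewrite !inE !orbb.
rewrite /class_sum_eq (@sum_list _ (cyc (x, y, z))) //.
- rewrite /= !big_cons big_nil !v // /class_weight asboolF // asboolF //.
  by case/(class_weight_third tL) => k; rewrite /= !inE !xpair_eqE; move: ne; clear; lia.
- by rewrite /= !inE !xpair_eqE; move: ne; clear; lia.
move=> t; rewrite !inE => /or3P[] /eqP-> //; split => //; first exact: cls_cyc tL.
by rewrite (cls_cyc c1) (cls_cyc tL).
Qed.

Lemma hurwitz_classesE : hurwitz_classes N = [set` undup (map selling_class L)]%classic.
Proof.
apply/seteqP; split=> C /=.
  case=> -[[a b] c] [P [D ->]]; have [t g e] := selling_reduction P.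
  rewrite mem_undup; apply/mapP; exists t; last by apply/bqf_class_eq.
  have [Q D'] := posdef_equiv e P; rewrite mem_glist g /= -eqr_opp.
  have e0 : 0 < esym2 t.
    have := sel2 (andP g).1; case: t {g e} D' Q => [[x y] z]; case: (selling_form _) => [[a' b'] c'] D' Q [Ea Eb Ec].
    have [_ d0] := Q; rewrite -oppr_lt0 (_ : - _ = bqf_disc (a', b', c')) //.
    rewrite /bqf_disc /bqf_a /bqf_b /bqf_c /esym2 /= (_ : b' ^+ 2 - 4 * a' * c' = b' ^+ 2 - (2 * a') * (2 * c')); last by ring.
    by rewrite Ea Eb Ec; ring.
  by have [_ <-] := sel_posdef g e0; rewrite D' D.
rewrite mem_undup => /mapP[t tL ->]; have [P D] := glist_posdef tL.
by exists (selling_form t).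
Qed.

Lemma hurwitz_sum : 6 * \sum_(C \in hurwitz_classes N) class_weight C = (\sum_(t <- L) p3 t)%:R.
Proof.
rewrite hurwitz_classesE -fsbig_seq ?undup_uniq // mulr_sumr.
transitivity (\sum_(C <- undup (map selling_class L)) 6 * class_weight C : rat); first by [].
transitivity (\sum_(C <- undup (map selling_class L)) (\sum_(t <- L | selling_class t == C) p3 t)%:R : rat).
  apply: eq_big_seq => C; rewrite mem_undup => /mapP[t tL ->].
  by rewrite (class_sum_eqP tL).
rewrite -natr_sum; congr (_%:R).
under eq_bigr do rewrite big_mkcond.
rewrite exchange_big /=; apply: eq_big_seq => t tL.
rewrite -big_mkcond (@big_one _ _ _ (fun=> p3 t) (selling_class t)) ?undup_uniq //.
by rewrite mem_undup map_f.
Qed.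
End Classes.

(** * Ternary representations and conclusion *)

Lemma count_add3 (T : eqType) (s : seq T) (A B C D : pred T) : (forall z, z \in s -> (A z = B z + C z + D z :> nat)%N) ->
  (count A s = count B s + count C s + count D s)%N.
Proof.
elim: s => // x s IH H; rewrite /= IH => [|z zs]; last by apply: H; rewrite inE zs orbT.
by rewrite (H x) ?mem_head //; lia.
Qed.
(** Left multiplication by the unit w. *)
Definition omg (z : mat) : mat := let: (a, b, c, d) := z in (- b, a + b, - d, c + d).
Definition omgi (z : mat) : mat := let: (a, b, c, d) := z in (a + b, - a, c + d, - c).
Definition swp (z : mat) : mat := let: (a, b, c, d) := z in (c, d, a, b).
Definition rho (z : mat) : bool := let: (a, b, c, d) := z in (2 %| b)%Z.
Lemma omgK z : omgi (omg z) = z.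
Proof. by case: z => [[[a b] c] d]; apply: eq4; ring. Qed.
Lemma omgiK z : omg (omgi z) = z.
Proof. by case: z => [[[a b] c] d]; apply: eq4; ring. Qed.
Lemma count_bij n (P : pred mat) f g : cancel f g -> cancel g f -> (forall z, qnorm (f z) = qnorm z) ->
  count (fun z => P (f z)) (quats_of_norm n) = count P (quats_of_norm n).
Proof.
move=> fK gK qf; rewrite -(count_map f); apply/permP; apply: uniq_perm; rewrite ?map_inj_uniq ?uniq_quats //; first exact: can_inj fK.
move=> z; apply/mapP/idP => [[w + ->]|]; rewrite !mem_quats ?qf // => /eqP E.
by exists (g z); rewrite ?gK // mem_quats -qf gK E.
Qed.
Lemma qn_omg z : qnorm (omg z) = qnorm z.
Proof. by case: z => [[[a b] c] d]; rewrite /qnorm /omg /enorm; ring. Qed.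
Lemma qn_swp z : qnorm (swp z) = qnorm z.
Proof. by case: z => [[[a b] c] d]; rewrite /qnorm /swp addrC. Qed.
Lemma swpK z : swp (swp z) = z. Proof. by case: z => [[[a b] c] d]. Qed.
Lemma evv_omg z : evv (omg z) = evv z.
Proof. by case: z => [[[a b] c] d]; rewrite /evv /omg /ev; lia. Qed.
Lemma d3_omg z : d3 (omg z) = d3 z.
Proof. by case: z => [[[a b] c] d]; rewrite /d3 /omg; lia. Qed.
(** The first coordinate is nonzero in Z[w]/2 = F_4, whose three nonzero elements are permuted
    cyclically by w; exactly one of them has even w-coefficient. *)
Lemma rho3 z : oddz (qnorm z) -> evv z -> (rho z + rho (omg z) + rho (omg (omg z)) = 1)%N.
Proof.
by move=> o; have := odd_qnorm z; rewrite o; case: z {o} => [[[a b] c] d]; rewrite /evv /omg /rho /ev; lia.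
Qed.
Lemma evv_swp z : oddz (qnorm z) -> evv (swp z) = ~~ evv z.
Proof. by move=> o; have := odd_qnorm z; rewrite o; case: z {o} => [[[a b] c] d]; rewrite /evv /swp; case: (ev a b); case: (ev c d). Qed.
Lemma d3_swp z : (qnorm z %% 3 = 1)%Z -> d3 (swp z) = ~~ d3 z.
Proof.
case: z => [[[a b] c] d]; rewrite /qnorm /swp /d3 !en_mod3; move: (a - b) (c - d) (a * b) (c * d) => x y k l.
have [u [e [-> He]]] := res3 x; have [v [f [-> Hf]]] := res3 y => H.
have {}H : ((e ^+ 2 + f ^+ 2) %% 3 = 1)%Z.
  rewrite -[RHS]H (_ : _ + _ + (_ + _) = (e ^+ 2 + f ^+ 2) + 3 * (3 * u ^+ 2 + 2 * u * e + k + 3 * v ^+ 2 + 2 * v * f + l)); last by ring.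
  by move: (e ^+ 2 + f ^+ 2) (3 * u ^+ 2 + _ + _ + _ + _ + _); clear; lia.
have R (s t : int) : (3 %| 3 * s + t)%Z = (3 %| t)%Z by lia.
rewrite !R; have Z (P : Prop) (t : bool) : t -> t = false -> P by move=> ->.
by move/eqP: H; case: He Hf => -> [] -> // E; apply: Z E _; vm_compute.
Qed.

Section Counts.
Variable n : nat.
Hypothesis on : odd n.
Lemma oz_Qn z : z \in quats_of_norm n -> oddz (qnorm z).
Proof. by rewrite mem_quats => /eqP ->; rewrite /oddz; move: on; clear; lia. Qed.
Lemma count_rho (P : pred mat) : (forall z, P (omg z) = P z) ->
  count (fun z => evv z && P z) (quats_of_norm n) = (3 * count (fun z => [&& evv z, rho z & P z]) (quats_of_norm n))%N.
Proof.
move=> PO; have C := count_bij n (fun z => [&& evv z, rho z & P z]) omgK omgiK qn_omg.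
have C2 := count_bij n (fun z => [&& evv (omg z), rho (omg z) & P (omg z)]) omgK omgiK qn_omg.
rewrite (_ : (3 * _ = count (fun z => [&& evv z, rho z & P z]) (quats_of_norm n) + count (fun z => [&& evv (omg z), rho (omg z) & P (omg z)]) (quats_of_norm n)
  + count (fun z => [&& evv (omg (omg z)), rho (omg (omg z)) & P (omg (omg z))]) (quats_of_norm n))%N); last by rewrite C2 C; lia.
apply: count_add3 => z zQ; rewrite !evv_omg !PO.
case e : (evv z) => //=; have := rho3 (oz_Qn zQ) e.
by case: (P z); case: (rho z); case: (rho _); case: (rho _).
Qed.
Lemma count_evv : (2 * count evv (quats_of_norm n) = size (quats_of_norm n))%N.
Proof.
rewrite -(count_predC evv) mul2n -addnn; congr addn.
rewrite -(count_bij n evv swpK swpK qn_swp); apply: eq_in_count => z zQ.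
by rewrite /= evv_swp // oz_Qn.
Qed.
Lemma count_fp : (n %% 3 = 1)%N ->
  count balance_sign (quats_of_norm n) = (2 * count (fun z => evv z && d3 z) (quats_of_norm n))%N /\
  count (predC balance_sign) (quats_of_norm n) = (2 * count (fun z => evv z && ~~ d3 z) (quats_of_norm n))%N.
Proof.
move=> n3; have d z : z \in quats_of_norm n -> d3 (swp z) = ~~ d3 z.
  by rewrite mem_quats => /eqP E; apply: d3_swp; rewrite E; move: n3; clear; lia.
rewrite !mul2n -!addnn; split.
  rewrite -[X in (_ + X)%N](count_bij n (fun z => evv z && d3 z) swpK swpK qn_swp).
  rewrite -[RHS]addn0 -[X in (_ + X)%N](count_pred0 (quats_of_norm n)); apply: count_add3 => z zQ; rewrite /= addn0.
  by rewrite evv_swp ?oz_Qn // d // /balance_sign; case: (evv z); case: (d3 z).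
rewrite -[X in (_ + X)%N](count_bij n (fun z => evv z && ~~ d3 z) swpK swpK qn_swp).
rewrite -[RHS]addn0 -[X in (_ + X)%N](count_pred0 (quats_of_norm n)); apply: count_add3 => z zQ; rewrite /= addn0.
by rewrite evv_swp ?oz_Qn // d // /balance_sign; case: (evv z); case: (d3 z).
Qed.
Hypotheses (n0 : (0 < n)%N) (c6 : coprime n 6).
(** Of the 12 sigma(n) elements, half have an even second coordinate, by exchanging the coordinates,
    and [rho] selects a third of these. *)
Lemma count_all : count (fun z => evv z && rho z) (quats_of_norm n) = (2 * sigma n)%N.
Proof.
have := @count_rho predT (fun=> erefl); have := count_evv; rewrite size_quats_of_norm //.
rewrite (eq_count (_ : (fun z => evv z && predT z) =1 evv)) => [|z]; last by rewrite andbT.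
rewrite (eq_count (_ : (fun z => [&& evv z, rho z & predT z]) =1 (fun z => evv z && rho z))) => [|z]; last by rewrite andbT.
by lia.
Qed.
Lemma count_d3 p : (n %% 3 = 1)%N -> prime p -> (p %% 3 = 2)%N -> odd (logn p n) ->
  count (fun z => [&& evv z, rho z & d3 z]) (quats_of_norm n) = sigma n.
Proof.
move=> n3 pp p3 ol.
have p2 : p != 2.
  apply: contraTneq ol => ->; rewrite (_ : logn 2 n = 0%N) //; apply/eqP; rewrite -leqn0 leqNgt logn_gt0 mem_primes.
  by rewrite dvdn2 on !andbF.
have := fp_balance pp p3 p2 n0 on n3 ol.
rewrite -!(big_mkcond _ (fun=> 1%N)) /= !sum1_count.
have [E1 E2] := count_fp n3; rewrite -/(predC balance_sign) E1 [X in _ = X -> _]E2.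
have := count_rho d3_omg; have := count_evv; rewrite size_quats_of_norm //.
have : count evv (quats_of_norm n) = (count (fun z => evv z && d3 z) (quats_of_norm n) + count (fun z => evv z && ~~ d3 z) (quats_of_norm n) + count pred0 (quats_of_norm n))%N.
  by apply: count_add3 => z _; rewrite addn0; case: (evv z); case: (d3 z).
by rewrite count_pred0; lia.
Qed.
End Counts.

(** The norm of a sqrt(-3) + 2 (x + y w) j, so that r^2 + [qf] is the norm of an element with even
    second coordinate and [rho]. *)
Definition qf (t : trip) : int := let: (a, x, y) := t in 3 * a ^+ 2 + 4 * enorm x y.
Definition ternary_reps (N : nat) : nat := count (fun t => qf t == N%:Z) (tbox N).
Definition hurwitz6 (N : nat) : nat := (\sum_(t <- glist N) p3 t)%N.
Lemma nest K (Q : pred int) (C : trip -> int -> bool) (F : trip -> nat) :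
  (\sum_(r <- irange K | Q r) \sum_(t <- tbox K | C t r) F t = \sum_(q <- box K | Q q.2 && C q.1 q.2) F q.1)%N.
Proof.
rewrite [RHS]big_mkcond /box big_allpairs exchange_big /= big_mkcond; apply: eq_bigr => r _.
by case: (Q r) => /=; [rewrite [LHS]big_mkcond|rewrite big1].
Qed.
Lemma irange_indep (n K : nat) (P : pred int) (F : int -> nat) : (n <= K)%N ->
  (\sum_(r <- irange K | P r && (r ^+ 2 < n%:Z)%R) F r = \sum_(r <- irange n | P r && (r ^+ 2 < n%:Z)%R) F r)%N.
Proof.
move=> le; have U B : uniq (irange B) by rewrite map_inj_uniq ?iota_uniq // => i j; lia.
apply: (@sum_bij _ _ _ _ _ _ _ _ id id) => // r; rewrite !mem_irange => h /andP[pr lt] _; split; rewrite ?pr ?lt //.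
  by apply: sq_le; apply: ltW.
by move: h le; clear; lia.
Qed.
Lemma qf_ge0 t : 0 <= qf t.
Proof. by case: t => [[a x] y]; rewrite /qf; have := en_ge0 x y; have := sqr_ge0 a; lia. Qed.
Lemma qf_box (N : nat) t : qf t = N%:Z -> t \in tbox N.
Proof.
case: t => [[a x] y]; rewrite /qf mem_tbox => E; have h := en_ge0 x y; have s := sqr_ge0 a.
have a1 : `|a| <= N%:Z by apply: sq_le; move: E h s; clear; lia.
have le : enorm x y <= (N %/ 2)%N%:Z by move: E h s; clear; lia.
have [x1 y1] := en_bd le; apply/and3P; split => //; move: x1 y1; clear; lia.
Qed.
Lemma RN_inner (n : nat) (r : int) : r ^+ 2 < n%:Z -> ternary_reps `|(n%:Z - r ^+ 2)%R|%N = (\sum_(t <- tbox n | (r ^+ 2 + qf t == n%:Z)%R) 1)%N.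
Proof.
move=> lt; rewrite /ternary_reps -sum1_count; apply: (@sum_bij _ _ _ _ _ _ _ _ id id); rewrite ?uniq_tbox // => t _.
  move=> /eqP E _; have E2 : r ^+ 2 + qf t = n%:Z by rewrite E gez0_abs; [ring|rewrite subr_ge0 ltW].
  split; rewrite ?E2 ?eqxx //; have [m Em] : exists m : nat, qf t = m%:Z by exists `|qf t|%N; rewrite gez0_abs ?qf_ge0.
  have mn : (m <= n)%N by have := sqr_ge0 r; move: E2; rewrite Em; clear; lia.
  by have := qf_box Em; move: mn; clear; case: t => [[a x] y]; rewrite !mem_tbox; lia.
move=> /eqP E _; have E2 : qf t = (`|n%:Z - r ^+ 2|%N)%:Z by rewrite gez0_abs ?subr_ge0 ?ltW // -E; ring.
by split; rewrite ?E2 ?eqxx // qf_box.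
Qed.
Lemma h6_inner (n : nat) (r : int) : r ^+ 2 < n%:Z ->
  hurwitz6 `|(n%:Z - r ^+ 2)%R|%N = (\sum_(t <- tbox (3 * n) | (r ^+ 2 + esym2 t == n%:Z)%R && par3 t) p3 t)%N.
Proof.
move=> lt; rewrite /hurwitz6 /glist big_filter; apply: (@sum_bij _ _ _ _ _ _ _ _ id id); rewrite ?uniq_tbox // => t _.
  move=> /andP[/andP[p _] /eqP E] F0; have E2 : r ^+ 2 + esym2 t = n%:Z by rewrite E gez0_abs; [ring|rewrite subr_ge0 ltW].
  split; rewrite ?E2 ?eqxx //; have := @p3_bd n (t, r) F0 E2.
  by case: (t) => [[a x] y]; rewrite mem_tbox mem_box; lia.
move=> /andP[/eqP E p] F0; have E2 : esym2 t = (`|n%:Z - r ^+ 2|%N)%:Z by rewrite gez0_abs ?subr_ge0 ?ltW // -E; ring.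
by split; rewrite ?E2 ?eqxx ?andbT ?good_box // /selling_reduced p.
Qed.
Lemma sum_hurwitz6 (n : nat) : (0 < n)%N -> (n %% 3 = 2)%N -> odd n ->
  (\sum_(r <- irange n | ~~ (3 %| r)%Z && (r ^+ 2 < n%:Z)%R) hurwitz6 `|(n%:Z - r ^+ 2)%R|%N = sigma n)%N.
Proof.
move=> n0 n3 on; rewrite -(@irange_indep n (3 * n)); last by lia.
rewrite -(sum_selling_weight n0 n3 on) (eq_bigr (fun r => \sum_(t <- tbox (3 * n) | (r ^+ 2 + esym2 t == n%:Z)%R && par3 t) p3 t)%N); last first.
  by move=> r /andP[_ lt]; rewrite h6_inner.
rewrite nest [LHS]big_mkcond [RHS]big_mkcond; apply: eq_bigr => -[t r] _ /=; rewrite /cond /=.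
case: eqP => E; rewrite ?andbF //=; case: (par3 t); rewrite ?andbF //= andbT.
case: (boolP (3 %| r)%Z) => //= _; case: ltrP => // le.
(* A triple of positive weight has e > 0, so r^2 < n holds for all terms that count. *)
case: (posnP (p3 t)) => // F0; have : 0 < esym2 t; last by move: E le; clear; lia.
have := F0; case: (t) => [[x y] z]; rewrite /p3 /selling_weight3 /full3 /half3 /esym2 => H.
have [x0 [y0 z0]] : 0 <= x /\ 0 <= y /\ 0 <= z by move: H; clear; lia.
have [[xy yz] zx] := (mulr_ge0 x0 y0, mulr_ge0 y0 z0, mulr_ge0 z0 x0).
have : (0 < x /\ 0 < y) \/ (0 < y /\ 0 < z) \/ (0 < z /\ 0 < x) by move: H; clear; lia.
by case=> [[h1 h2]|[[h1 h2]|[h1 h2]]]; have := mulr_gt0 h1 h2; move: xy yz zx; clear; lia.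
Qed.
(* r + a sqrt(-3) = (r - a) + 2 a w. *)
Definition toZ (q : mat) : mat := let: (a, x, y, r) := q in (r - a, 2 * a, 2 * x, 2 * y).
Definition ofZ (z : mat) : mat := let: (a, b, c, d) := z in ((b %/ 2)%Z, (c %/ 2)%Z, (d %/ 2)%Z, a + (b %/ 2)%Z).
Lemma sum_ternary_reps (n : nat) (P : pred int) (P' : pred mat) : nonsquare n%:Z -> (forall q, P' (toZ q) = P q.2) ->
  (\sum_(r <- irange n | P r && (r ^+ 2 < n%:Z)%R) ternary_reps `|(n%:Z - r ^+ 2)%R|%N = count (fun z => [&& evv z, rho z & P' z]) (quats_of_norm n))%N.
Proof.
move=> sq PP; rewrite (eq_bigr (fun r => \sum_(t <- tbox n | (r ^+ 2 + qf t == n%:Z)%R) 1)%N); last first.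
  by move=> r /andP[_ lt]; rewrite RN_inner.
rewrite (nest _ _ (fun t r => r ^+ 2 + qf t == n%:Z) (fun=> 1%N)) -sum1_count.
have Z q : qnorm (toZ q) = q.2 ^+ 2 + qf q.1 by case: q => [[[a x] y] r]; rewrite /qnorm /toZ /qf /enorm /=; ring.
have K z : evv z -> rho z -> toZ (ofZ z) = z.
  by case: z => [[[a b] c] d]; rewrite /evv /ev /rho /toZ /ofZ => /andP[h1 h2] h3; apply: eq4; lia.
apply: (@sum_bij _ _ _ _ _ _ _ _ toZ ofZ); rewrite ?uniq_box ?uniq_quats //.
  move=> q _ /andP[/andP[p lt] /eqP E] _; rewrite mem_quats Z E eqxx PP p; split => //.
    by case: (q) => [[[a x] y] r]; rewrite /evv /rho /ev /toZ !dvdz_mulr.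
  by case: (q) => [[[a x] y] r]; rewrite /toZ /ofZ; apply: eq4; lia.
move=> z; rewrite mem_quats => /eqP nz /and3P[e rh p] _; have Kz := K z e rh.
have E : (ofZ z).2 ^+ 2 + qf (ofZ z).1 = n%:Z by rewrite -Z Kz.
have lt : (ofZ z).2 ^+ 2 < n%:Z by rewrite lt_neqAle sq -E lerDl qf_ge0.
split => //; last by rewrite -PP Kz p lt E eqxx.
have t1 : (ofZ z).1 \in tbox n.
  have [m Em] : exists m : nat, qf (ofZ z).1 = m%:Z by exists `|qf (ofZ z).1|%N; rewrite gez0_abs ?qf_ge0.
  have := qf_box Em; have : (m <= n)%N by have := sqr_ge0 (ofZ z).2; move: E; rewrite Em; clear; lia.
  by clear; case: (ofZ z) => [[[a x] y] r] /=; rewrite !mem_tbox; lia.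
have := sq_le (ltW lt); move: t1; case: (ofZ z) => [[[a x] y] r] /=; rewrite mem_tbox mem_box.
by move=> /and3P[-> -> ->] ->.
Qed.

(** * Comparison of the ternary form with class numbers *)

Lemma sq_mod4 (a : int) : exists k, a ^+ 2 = 4 * k \/ a ^+ 2 = 4 * k + 1.
Proof.
have := divz_eq a 2; have : (a %% 2)%Z = 0 \/ (a %% 2)%Z = 1 by lia.
move: (a %/ 2)%Z (a %% 2)%Z => u v [->|->] ->; [exists (u ^+ 2); left|exists (u ^+ 2 + u); right]; ring.
Qed.
Definition mod4_is12 (N : nat) := (N %% 4 == 1)%N || (N %% 4 == 2)%N.
(** If x = y = z modulo 2, then e = 3 z^2 modulo 4, which is 0 or 3. *)
Lemma hurwitz6_mod4 N : mod4_is12 N -> hurwitz6 N = 0%N.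
Proof.
rewrite /mod4_is12 /hurwitz6 => H; rewrite big_seq big1 // => t; rewrite mem_glist => /andP[/andP[p _] /eqP E]; exfalso.
case: t p E => [[x y] z] /andP[/dvdzP[k Ek] /dvdzP[l El]].
have -> : y = l * 2 + z by rewrite -El subrK.
have -> : x = (k + l) * 2 + z.
  by move: Ek El; clear; lia.
have [m Em] := sq_mod4 z; rewrite /esym2.
rewrite (_ : _ + _ = 3 * z ^+ 2 + 4 * ((k + l) * l + (k + l) * z + l * z)); last by ring.
move: ((k + l) * l + _ + _) Em H => w; move: (z ^+ 2); clear; lia.
Qed.
Lemma ternary_reps_mod4 N : mod4_is12 N -> ternary_reps N = 0%N.
Proof.
rewrite /mod4_is12 /ternary_reps => H; apply/eqP; rewrite -leqn0 leqNgt -has_count; apply/hasPn => -[[a x] y] _; apply/eqP => E.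
by have [m Em] := sq_mod4 a; move: E Em H; rewrite /qf; move: (a ^+ 2) (enorm x y); clear; lia.
Qed.
Lemma ternary_reps_mod3 N : (N %% 3 = 2)%N -> ternary_reps N = 0%N.
Proof.
rewrite /ternary_reps => H; apply/eqP; rewrite -leqn0 leqNgt -has_count; apply/hasPn => -[[a x] y] _; apply/eqP => E.
have [u [v [Ev Hv]]] := res3 (x - y).
have : N%:Z = v ^+ 2 + 3 * (a ^+ 2 + 4 * (x * y) + 4 * (3 * u ^+ 2 + 2 * u * v) + v ^+ 2).
  by rewrite -E /qf en_mod3 Ev; ring.
move: (a ^+ 2 + _ + _ + _) => w; case: Hv => ->; rewrite ?expr0n ?sqrrN ?expr1n /=; move: H; clear; lia.
Qed.
Lemma hurwitz_eq_hurwitz6 N : (0 < N)%N -> 6 * hurwitz N = (hurwitz6 N)%:R.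
Proof.
move=> N0; rewrite /hurwitz gtn_eqF //; case: ifP => [H|_]; last exact: hurwitz_sum.
by rewrite hurwitz6_mod4 // mulr0.
Qed.
Lemma odd_coprime6 n : odd n -> (n %% 3 != 0)%N -> coprime n 6.
Proof.
by move=> o n3; rewrite (_ : 6 = 2 * 3)%N // coprimeMr coprimen2 o coprime_sym prime_coprime.
Qed.
(** For 3 | r the number n - r^2 is 2 modulo 3 and is not represented, so the sum over all r, known
    from the quaternion order, lives on the r prime to 3. *)
Lemma sum_ternary_reps_prime_to3 n : (0 < n)%N -> (n %% 3 = 2)%N -> odd n ->
  (\sum_(r <- irange n | ~~ (3 %| r)%Z && (r ^+ 2 < n%:Z)%R) ternary_reps `|(n%:Z - r ^+ 2)%R|%N = 2 * sigma n)%N.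
Proof.
move=> n0 n3 on; rewrite -(count_all on n0 (odd_coprime6 on ltac:(by rewrite n3))).
have := @sum_ternary_reps n predT predT (nsq2 n3) (fun=> erefl).
rewrite (eq_count (_ : _ =1 (fun z => evv z && rho z))) => [<-|z]; last by rewrite /= andbT.
rewrite [RHS](bigID (fun r => 3 %| r)%Z) /= [X in (X + _)%N]big1 => [|r /andP[lt d]].
  by rewrite add0n; apply: eq_bigl => r; rewrite andbC.
apply: ternary_reps_mod3; have [k Ek] := dvdzP d.
have : (`|(n%:Z - r ^+ 2)%R|%N)%:Z = n%:Z - 3 * (3 * k ^+ 2) by rewrite gez0_abs ?subr_ge0 ?ltW // Ek; ring.
by move: `|_|%N (3 * k ^+ 2) => m w; move: n3; clear; lia.
Qed.

(** Both sums for n equal 2 sigma(n) after doubling the class number side. By hypothesis they agree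
    term by term except at r = s and r = -s, where n - r^2 = N. *)
Lemma ternary_reps_step (N n s : nat) : (n = N + s ^ 2)%N -> (0 < N)%N -> (n %% 3 = 2)%N -> odd n -> ~~ (3 %| s)%N ->
  (forall r : int, ~~ (3 %| r)%Z -> r ^+ 2 < n%:Z -> r ^+ 2 != (s ^ 2)%N%:Z ->
     ternary_reps `|(n%:Z - r ^+ 2)%R|%N = (2 * hurwitz6 `|(n%:Z - r ^+ 2)%R|%N)%N) ->
  ternary_reps N = (2 * hurwitz6 N)%N.
Proof.
move=> En N0 n3 on s3 IH; have n0 : (0 < n)%N by rewrite En addn_gt0 N0.
have := sum_ternary_reps_prime_to3 n0 n3 on; rewrite -(sum_hurwitz6 n0 n3 on) big_distrr /=.
rewrite (bigID (fun r : int => r ^+ 2 == (s ^ 2)%N%:Z)) [RHS](bigID (fun r : int => r ^+ 2 == (s ^ 2)%N%:Z)) /=.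
rewrite [X in (_ + X = _)%N -> _](eq_bigr (fun r : int => (2 * hurwitz6 `|(n%:Z - r ^+ 2)%R|)%N)) => [|r /andP[/andP[h1 h2] h3]]; last exact: IH.
move/addIn; have Es r : r ^+ 2 = (s ^ 2)%N%:Z -> `|(n%:Z - r ^+ 2)%R|%N = N.
  by move=> ->; rewrite En; clear; lia.
rewrite [LHS](eq_bigr (fun=> ternary_reps N)) => [|r /andP[_ /eqP /Es ->] //].
rewrite [RHS](eq_bigr (fun=> 2 * hurwitz6 N)%N) => [|r /andP[_ /eqP /Es ->] //].
rewrite !big_const_seq !iter_addn_0 => /eqP; rewrite eqn_mul2r => /orP[|/eqP//].
rewrite -leqn0 leqNgt -has_count => /negP[]; apply/hasP; exists s%:Z.
  rewrite mem_irange; apply: sq_le; rewrite En -mulnn; clear; lia.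
rewrite dvdzE s3 /= expr2 -PoszM mulnn eqxx andbT.
by move: En N0; clear; lia.
Qed.
Lemma ternary_reps_hurwitz6 N : (N %% 3 = 1)%N -> ternary_reps N = (2 * hurwitz6 N)%N.
Proof.
have [k] := ubnP N; elim: k N => // k IH N lt N3.
have [z|nz] := boolP (mod4_is12 N); first by rewrite ternary_reps_mod4 // hurwitz6_mod4.
have N0 : (0 < N)%N by case: N N3 {lt nz}.
have sub (n : nat) (r : int) : r ^+ 2 < n%:Z -> (n = `|(n%:Z - r ^+ 2)%R| + `|(r ^+ 2)%R|)%N /\ (`|(r ^+ 2)%R|%N)%:Z = r ^+ 2.
  by move=> h; have := sqr_ge0 r; move: h; move: (r ^+ 2) => w; lia.
have r3 (r : int) : ~~ (3 %| r)%Z -> (`|(r ^+ 2)%R| %% 3 = 1)%N.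
  move=> h; have [u [v [Er Hv]]] := res3 r.
  have : r ^+ 2 = v ^+ 2 + 3 * (3 * u ^+ 2 + 2 * u * v) by rewrite Er; ring.
  have := sqr_ge0 r; move: (3 * u ^+ 2 + _) (r ^+ 2) => w q; move: h Er; case: Hv => ->; rewrite ?expr0n ?sqrrN ?expr1n /=; clear; lia.
have big (s : nat) (r : int) : r ^+ 2 != (s ^ 2)%N%:Z -> (`|(r ^+ 2)%R| < s ^ 2)%N \/ (s ^ 2 < `|(r ^+ 2)%R|)%N.
  by have := sqr_ge0 r; move: (r ^+ 2) (s ^ 2)%N; clear; lia.
(* As N = 1 mod 3, n = N + s^2 is 2 mod 3 for s = 1 and s = 2; the residue of N modulo 4 decides
   which s makes n odd. *)
have [N4|N4] : (N %% 4 = 0)%N \/ (N %% 4 = 3)%N by move: nz; rewrite /mod4_is12; have := ltn_pmod N (isT : 0 < 4)%N; case: (N %% 4)%N => [|[|[|[|]]]] //; auto.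
  apply: (@ternary_reps_step N (N + 1 ^ 2) 1) => //; first by rewrite -modnDm N3.
    by move: N4; clear; lia.
  move=> r h1 h2 h3; have [E1 E2] := sub _ _ h2; have R3 := r3 r h1; have B := big 1%N r h3.
  apply: IH; move: E1 R3 B N3 lt N0; move: `|(r ^+ 2)%R|%N `|(_ - _)%R|%N; clear; rewrite exp1n; lia.
apply: (@ternary_reps_step N (N + 2 ^ 2) 2) => //; first by rewrite -modnDm N3.
  by move: N4; clear; lia.
move=> r h1 h2 h3; have [E1 E2] := sub _ _ h2; have R3 := r3 r h1; have B := big 2%N r h3.
(* For s = 2 the terms r = 1 and r = -1 involve N + 3, beyond the reach of the induction; but N + 3
   is 2 mod 4, where both functions vanish. *)
have [lt4|gt4] := B.
  have E : `|(r ^+ 2)%R|%N = 1%N by move: R3 lt4; clear; move: `|_|%N => [|[|[|[|]]]].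
  have z : mod4_is12 `|((N + 2 ^ 2)%N%:Z - r ^+ 2)%R|%N.
    by rewrite /mod4_is12; move: E1; rewrite E; move: `|_|%N N4; clear; lia.
  by rewrite ternary_reps_mod4 // hurwitz6_mod4.
apply: IH; move: E1 R3 gt4 N3 lt N0; move: `|(r ^+ 2)%R|%N `|(_ - _)%R|%N; clear; lia.
Qed.

(** * The formula in both residue classes *)

Lemma nsq_logn p n : (0 < n)%N -> odd (logn p n) -> nonsquare n%:Z.
Proof.
move=> n0 o k; apply/eqP => E; have En : n = (`|k| ^ 2)%N by rewrite -abszX E.
by move: o; rewrite En lognX mul2n odd_double.
Qed.
Lemma sum_irange (n : nat) (P : pred int) (F : int -> rat) :
  \sum_(i < (2 * n).+1 | P (i%:Z - n%:Z)) F (i%:Z - n%:Z) = \sum_(r <- irange n | P r) F r.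
Proof.
rewrite /irange big_map -(big_mkord (fun i => P (i%:Z - n%:Z)) (fun i => F (i%:Z - n%:Z))).
by rewrite /index_iota subn0.
Qed.
Lemma sum_neg (n : nat) (P : pred int) (F : int -> nat) : (forall r, F (- r) = F r) ->
  (\sum_(r <- irange n | P r) F r = \sum_(r <- irange n | P (- r)%R) F r)%N.
Proof.
move=> HF; have U : uniq (irange n) by rewrite map_inj_uniq ?iota_uniq // => i j; lia.
by apply: (@sum_bij _ _ _ _ _ _ _ _ -%R -%R) => // r; rewrite !mem_irange => h p _; split; rewrite ?normrN ?opprK ?HF.
Qed.

(* r ranges over integers with |r| < sqrt n, written r = i - n with i < 2n+1
   (which covers all such r) and the condition r^2 < n. *)
Theorem theorem5 (n : nat) (c : int) :
  (0 < n)%N -> coprime n 6 ->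
  (exists p : nat, [/\ prime p, (p %% 3 = 2)%N & odd (logn p n)]) ->
  ((n %% 3 = 1)%N -> c = 0) ->
  ((n %% 3 = 2)%N -> c = 1 \/ c = 2) ->
  \sum_(i < (2 * n).+1 | ((i%:Z - n%:Z) ^+ 2 < n%:Z) && (3 %| (i%:Z - n%:Z - c))%Z)
     hurwitz `|(n%:Z - (i%:Z - n%:Z) ^+ 2)|%N
  = (sigma n)%:R / 12.
Proof.
move=> n0 c6 [p [pp p3 ol]] c1 c2.
have on : odd n by move: c6; rewrite (_ : 6 = 2 * 3)%N // coprimeMr coprimen2 => /andP[].
have n3 : (n %% 3)%N = 1%N \/ (n %% 3)%N = 2%N.
  move: c6; rewrite (_ : 6 = 2 * 3)%N // coprimeMr => /andP[_]; rewrite coprime_sym prime_coprime // /dvdn.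
  by have := ltn_pmod n (isT : 0 < 3)%N; case: (n %% 3)%N => [|[|[|]]] //; auto.
rewrite (sum_irange n (fun r => (r ^+ 2 < n%:Z) && (3 %| r - c)%Z) (fun r => hurwitz `|(n%:Z - r ^+ 2)%R|%N)).
pose S := (\sum_(r <- irange n | ((3 %| r - c)%Z && (r ^+ 2 < n%:Z))%R) hurwitz6 `|(n%:Z - r ^+ 2)%R|%N)%N.
(* [S] is six times the sum of class numbers. *)
suff E : (2 * S = sigma n)%N.
  have -> : (sigma n)%:R / 12 = S%:R / 6 :> rat by rewrite -E natrM; field.
  apply: (mulfI (isT : 6 != 0 :> rat)); rewrite [RHS]mulrC divfK // mulr_sumr /S natr_sum.
  apply: eq_big => r; first by rewrite andbC.
  move=> /andP[lt _]; apply: hurwitz_eq_hurwitz6; rewrite absz_gt0 subr_eq0 gt_eqF //.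
rewrite /S; case: n3 => n3.
  (* For n = 1 mod 3, [d3] of r + a sqrt(-3) means 3 | r, and then n - r^2 = 1 mod 3, where the
     ternary form counts twelve times the class number. *)
  rewrite (c1 n3) -(count_d3 on n0 c6 n3 pp p3 ol) -(@sum_ternary_reps n (fun r => 3 %| r)%Z d3 (nsq_logn n0 ol)); last first.
    by case=> [[[a x] y] r]; rewrite /d3 /toZ /=; lia.
  rewrite big_distrr /=; apply: eq_big => r; first by rewrite subr0.
  rewrite subr0 => /andP[d lt]; rewrite ternary_reps_hurwitz6 //; have [k Ek] := dvdzP d.
  have : (`|(n%:Z - r ^+ 2)%R|%N)%:Z = n%:Z - 3 * (3 * k ^+ 2) by rewrite gez0_abs ?subr_ge0 ?ltW // Ek; ring.
  by move: `|_|%N (3 * k ^+ 2) => m w; move: n3; clear; lia.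
rewrite -(sum_hurwitz6 n0 n3 on) mul2n -addnn [RHS](bigID (fun r : int => 3 %| r - c)%Z) /=.
have cc := c2 n3; congr addn.
  by apply: eq_bigl => r; case: (_ < _); rewrite ?andbF ?andbT //; case: cc => ->; lia.
(* The substitution of -r for r exchanges the classes 1 and 2 modulo 3, which therefore contribute
   equally. *)
rewrite sum_neg => [|r]; last by rewrite sqrrN.
by apply: eq_bigl => r; rewrite sqrrN; case: (_ < _); rewrite ?andbF ?andbT //; case: cc => ->; lia.
Qed.
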